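(* Let $F$ be a countable algebraically closed field of characteristic $p$ and let $K$ be a finitely generated extension of $F$ of positive transcendence degree over $F$. If $\phi:A\to F\{\tau\}$ is a Drinfeld module, then $\phi(K)$ is the direct sum of $\phi(F)$ and a free $A$-submodule of rank $\aleph_0$.
   Context: Setting: $p$ prime, $q$ a power of $p$, $A$ the ring of functions on a nonsingular projective curve over $\mathbb{F}_q$ regular away from a fixed closed point; $F\supseteq\mathbb{F}_q$. $F\{\tau\}$ twisted polynomials with $\tau(x)=x^q$. A Drinfeld module $\phi:A\to F\{\tau\}$ is a ring morphism with $\tau^0$-coefficient of $\phi_a$ equal to $i(a)$ (fixed morphism $i:A\to F$), not all $\phi_a$ of degree $0$ in $\tau$. For a field $L\supseteq F$, $\phi(L)$ is $L$ with $A$-action $a\cdot x=\phi_a(x)$. *)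

(* Defs.v *)
From HB Require Import structures.
From mathcomp Require Import all_boot all_order all_algebra all_field.
From mathcomp Require Import boolp.
From mathcomp Require Import mpoly.

Set Implicit Arguments.
Unset Strict Implicit.
Unset Printing Implicit Defensive.

Import GRing.Theory.
Local Open Scope ring_scope.

(* An extension L / k is given by its structural embedding j : k -> L. *)
Section FieldExtensions.
Variables (k L : fieldType) (j : {rmorphism k -> L}).

(* divring_closed S says that S is a subfield of L. *)
Definition finitely_generated_extension : Prop :=
  exists s : seq L, forall S : {pred L}, divring_closed S ->
    (forall a, j a \in S) -> {subset s <= S} -> forall x, x \in S.

Definition algebraically_independent (n : nat) (t : n.-tuple L) : Prop :=
  forall P : {mpoly k[n]}, mmap j (tnth t) P = 0 -> P = 0.

Definition has_transcendence_degree (d : nat) : Prop :=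
  (exists t : d.-tuple L, algebraically_independent t) /\
  (forall n (t : n.-tuple L), algebraically_independent t -> n <= d)%N.

End FieldExtensions.

(* Nonsingular projective curves over Fq are represented by their function   *)
(* fields, i.e. the finitely generated extensions c : Fq -> k of             *)
(* transcendence degree 1. The local ring at a closed point determines that  *)
(* point, and the local rings that occur are exactly the valuation rings O   *)
(* of k with Fq <= O < k; so a closed point is represented by its local ring *)
(* O, and a function x is regular at it when x \in O.                        *)
Section Curves.
Variables (Fq k : fieldType) (c : {rmorphism Fq -> k}).

Definition function_field_of_curve : Prop :=
  finitely_generated_extension c /\ has_transcendence_degree c 1.

Definition closed_point (O : {pred k}) : Prop :=
  [/\ subring_closed O, forall a, c a \in O, exists x, x \notin O
    & forall x, (x \in O) || (x^-1 \in O)].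

Definition regular_away_from (oo : {pred k}) : {pred k} :=
  [pred x | `[< forall O : {pred k},
                  closed_point O -> ~ (O =i oo) -> x \in O >]].

Lemma regular_away_from_subring oo : subring_closed (regular_away_from oo).
Proof.
split=> [|x y /asboolP hx /asboolP hy|x y /asboolP hx /asboolP hy];
  apply/asboolP => O hO neO; have [[h1 hB hM] _ _ _] := hO; first exact: h1.
- by apply: hB; [apply: hx | apply: hy].
- by apply: hM; [apply: hx | apply: hy].
Qed.

HB.instance Definition _ oo :=
  GRing.isSubringClosed.Build k (regular_away_from oo)
    (regular_away_from_subring oo).

Definition ring_away_from (oo : {pred k}) : Type :=
  {x : k | x \in regular_away_from oo}.

HB.instance Definition _ oo := SubType.on (ring_away_from oo).
HB.instance Definition _ oo := Choice.on (ring_away_from oo).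
HB.instance Definition _ oo :=
  [SubChoice_isSubComNzRing of ring_away_from oo by <:].

End Curves.

Section QPower.
Variables (Fq : finFieldType) (L : fieldType) (g : {rmorphism Fq -> L}).

(* The i-th power of tau : x |-> x^q, with q = #|Fq|. The embedding argument *)
(* only serves to make additivity provable, hence to infer the instances     *)
(* below.                                                                    *)
Definition qpow of {rmorphism Fq -> L} := fun (i : nat) (x : L) =>
  x ^+ (#|Fq| ^ i).

Lemma qpowE i x : qpow g i x = x ^+ (#|Fq| ^ i). Proof. by []. Qed.

Lemma qpowD i j x : qpow g i (qpow g j x) = qpow g (i + j) x.
Proof. by rewrite !qpowE -exprM addnC expnD. Qed.

Lemma qpow_is_nmod_morphism i : nmod_morphism (qpow g i).
Proof.
have [p pr_p charFq] := finPcharP Fq.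
have pL : p \in [pchar L] by rewrite (fmorph_pchar g).
have cardFq : #|Fq| = (p ^ logn p #|Fq|)%N := card_pprimeChar charFq.
have q_nat : [pchar L].-nat (#|Fq| ^ i)%N.
  by rewrite pnatX cardFq pnatX pnatE // pL.
split=> [|x y]; last exact: exprDn_pchar.
by rewrite qpowE expr0n expn_eq0 -leqn0 leqNgt ltnW ?finNzRing_gt1.
Qed.

Lemma qpow_is_monoid_morphism i : monoid_morphism (qpow g i).
Proof. by split=> [|x y]; rewrite !qpowE ?expr1n ?exprMn. Qed.

HB.instance Definition _ i :=
  GRing.isNmodMorphism.Build L L (qpow g i) (qpow_is_nmod_morphism i).
HB.instance Definition _ i :=
  GRing.isMonoidMorphism.Build L L (qpow g i) (qpow_is_monoid_morphism i).

End QPower.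

(* F{tau}: the polynomial \sum_i f_i 'X^i stands for \sum_i f_i tau^i, and   *)
(* tau^i b = b^(q^i) tau^i, so (\sum_i f_i tau^i) h = \sum_i f_i h_i tau^i   *)
(* where h_i is h with its coefficients raised to the power q^i.             *)
Definition twisted_poly (Fq : finFieldType) (F : fieldType)
  (g : {rmorphism Fq -> F}) : Type := {poly F}.

Section TwistedPoly.
Variables (Fq : finFieldType) (F : fieldType) (g : {rmorphism Fq -> F}).

HB.instance Definition _ := GRing.Zmodule.copy (twisted_poly g) {poly F}.

Definition tau_coef (f : twisted_poly g) (i : nat) : F := (f : {poly F})`_i.
(* One more than the degree in tau, and 0 for the zero polynomial. *)
Definition tau_size (f : twisted_poly g) : nat := size (f : {poly F}).

Definition twisted_one : twisted_poly g := (1 : {poly F}).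

Definition twisted_mul (f h : twisted_poly g) : twisted_poly g :=
  \sum_(i < tau_size f)
    tau_coef f i *: (map_poly (qpow g i) (h : {poly F}) * 'X^i).

Let term (a : F) (i : nat) (h : {poly F}) : {poly F} :=
  a *: (map_poly (qpow g i) h * 'X^i).

Let termD a i : {morph term a i : h1 h2 / h1 + h2}.
Proof. by move=> h1 h2; rewrite /term rmorphD mulrDl scalerDr. Qed.
Let term0 a i : term a i 0 = 0.
Proof. by rewrite /term rmorph0 mul0r scaler0. Qed.
Let term0l i h : term 0 i h = 0.
Proof. by rewrite /term scale0r. Qed.
Let term_sum a i (I : finType) (H : I -> {poly F}) :
  term a i (\sum_j H j) = \sum_j term a i (H j).
Proof. exact: (big_morph _ (termD a i) (term0 a i)). Qed.
Let term_term a i b j h : term a i (term b j h) = term (a * qpow g i b) (i + j) h.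
Proof.
rewrite /term map_polyZ rmorphM /= map_polyXn -scalerAl scalerA -mulrA -exprD.
rewrite (addnC j) -map_poly_comp; congr (_ *: (_ * _)).
by apply: eq_map_poly => x /=; rewrite qpowD.
Qed.

Let mulE (n : nat) (f h : {poly F}) : (size f <= n)%N ->
  twisted_mul f h = \sum_(i < n) term f`_i i h.
Proof.
move=> le_fn; rewrite /twisted_mul /tau_size /tau_coef.
rewrite (big_ord_widen n (fun i => term f`_i i h) le_fn) big_mkcond /=.
apply: eq_bigr => i _; case: ltnP => // /(nth_default 0) ->.
by rewrite term0l.
Qed.

Let mulDl : left_distributive twisted_mul +%R.
Proof.
move=> f1 f2 h; pose n := maxn (size (f1 : {poly F})) (size (f2 : {poly F})).
rewrite (@mulE n _ _ (size_polyD _ _)) (@mulE n f1) ?leq_maxl //.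
rewrite (@mulE n f2) ?leq_maxr // -big_split /=; apply: eq_bigr => i _.
by rewrite coefD /term scalerDl.
Qed.

Let mulDr : right_distributive twisted_mul +%R.
Proof.
move=> f h1 h2; rewrite !(@mulE (size (f : {poly F})) f) // -big_split /=.
by apply: eq_bigr => i _; rewrite termD.
Qed.

Let mul0l h : twisted_mul 0 h = 0.
Proof. by rewrite (@mulE 0 0) ?size_poly0 // big_ord0. Qed.

Let mul_term a i h k : twisted_mul (term a i h) k =
  \sum_(j < size h) term (a * qpow g i h`_j) (i + j) k.
Proof.
rewrite (@mulE (i + size h)); last first.
  rewrite /term (leq_trans (size_scale_leq _ _)) // -addnC.
  rewrite (leq_trans (size_polyMleq _ _)) // size_polyXn addnS /=.
  by rewrite leq_add2r size_poly.
rewrite big_split_ord /= big1 ?add0r => [|j _]; last first.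
  by rewrite /term coefZ coefMXn ltn_ord mulr0 scale0r.
apply: eq_bigr => j _.
by rewrite {2}/term coefZ coefMXn ltnNge leq_addr /= addKn coef_map.
Qed.

Let mulA : associative twisted_mul.
Proof.
move=> f h k.
have mul_suml (I : finType) (H : I -> {poly F}) :
    twisted_mul (\sum_i H i) k = \sum_i twisted_mul (H i) k.
  exact: (big_morph (twisted_mul^~ k) (fun x y => mulDl x y k) (mul0l k)).
rewrite (@mulE (size (f : {poly F})) f h) // mul_suml.
rewrite (@mulE (size (f : {poly F})) f) //; apply: eq_bigr => i _.
rewrite mul_term (@mulE (size (h : {poly F})) h) // term_sum.
by apply: eq_bigr => j _; rewrite term_term.
Qed.

Let map_qpow0 (h : {poly F}) : map_poly (qpow g 0) h = h.
Proof. by apply: map_poly_id => x _; rewrite qpowE expn0 expr1. Qed.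

Let mul1l : left_id twisted_one twisted_mul.
Proof.
move=> h; rewrite (@mulE 1 1) ?size_poly1 // big_ord1 /term coef1 scale1r.
by rewrite mulr1 map_qpow0.
Qed.

Let mul1r : right_id twisted_one twisted_mul.
Proof.
move=> f; rewrite (@mulE (size (f : {poly F})) f) // -[RHS]coefK poly_def.
by apply: eq_bigr => i _; rewrite /term rmorph1 mul1r.
Qed.

Let one_neq0 : twisted_one != 0.
Proof. exact: oner_neq0. Qed.

HB.instance Definition _ := GRing.Zmodule_isNzRing.Build (twisted_poly g)
  mulA mul1l mul1r mulDl mulDr one_neq0.

End TwistedPoly.

Section DrinfeldModules.
Variables (Fq : finFieldType) (F : fieldType) (g : {rmorphism Fq -> F}).
Variable A : comNzRingType.

Definition drinfeld_module (i : {rmorphism A -> F})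
    (phi : {rmorphism A -> twisted_poly g}) : Prop :=
  (forall a, tau_coef (phi a) 0 = i a) /\ ~ (forall a, tau_size (phi a) <= 1)%N.

Section Evaluation.
Variables (L : fieldType) (j : {rmorphism F -> L}).

(* The F_q-linear operator x |-> \sum_i f_i x^(q^i) given by f in F{tau}. *)
Definition tau_eval (f : twisted_poly g) (x : L) : L :=
  \sum_(i < tau_size f) j (tau_coef f i) * qpow (j \o g) i x.

Let evalE (n : nat) (f : twisted_poly g) x : (tau_size f <= n)%N ->
  tau_eval f x = \sum_(i < n) j (tau_coef f i) * qpow (j \o g) i x.
Proof.
move=> le_fn; rewrite /tau_eval.
rewrite (big_ord_widen n (fun i => j (tau_coef f i) * qpow (j \o g) i x) le_fn).
rewrite big_mkcond /=; apply: eq_bigr => i _; case: ltnP => // le_fi.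
by rewrite /tau_coef nth_default // rmorph0 mul0r.
Qed.

Lemma tau_evalDr f : {morph tau_eval f : x y / x + y}.
Proof.
move=> x y; rewrite /tau_eval -big_split /=; apply: eq_bigr => i _.
by rewrite rmorphD mulrDr.
Qed.

Lemma tau_evalDl x : {morph tau_eval^~ x : f h / f + h}.
Proof.
move=> f h; pose n := maxn (tau_size f) (tau_size h).
rewrite (@evalE n _ _ (size_polyD _ _)) (@evalE n f) ?leq_maxl //.
rewrite (@evalE n h) ?leq_maxr // -big_split /=; apply: eq_bigr => i _.
by rewrite /tau_coef coefD rmorphD mulrDl.
Qed.

Lemma tau_eval1 x : tau_eval 1 x = x.
Proof.
rewrite (@evalE 1) ?[tau_size _]size_poly1 // big_ord1 /tau_coef /=.
by rewrite [X in j X]coef1 rmorph1 mul1r qpowE expn0 expr1.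
Qed.

Lemma tau_evalM f h x : tau_eval (f * h) x = tau_eval f (tau_eval h x).
Proof.
have eval0 : tau_eval 0 x = 0 by rewrite (@evalE 0) ?[tau_size _]size_poly0 ?big_ord0.
rewrite [f * h]/(twisted_mul f h) /twisted_mul.
rewrite (big_morph (tau_eval^~ x) (tau_evalDl x) eval0) {2}/tau_eval.
apply: eq_bigr => i _.
rewrite (@evalE (i + tau_size h)); last first.
  rewrite /tau_size (leq_trans (size_scale_leq _ _)) //.
  rewrite (leq_trans (size_polyMleq _ _)) // size_polyXn addnS /= addnC.
  by rewrite leq_add2l size_poly.
rewrite big_split_ord /= big1 ?add0r => [|l _]; last first.
  by rewrite /tau_coef coefZ coefMXn ltn_ord mulr0 rmorph0 mul0r.
rewrite /tau_eval rmorph_sum mulr_sumr; apply: eq_bigr => l _.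
rewrite {1}/tau_coef coefZ coefMXn ltnNge leq_addr /= addKn coef_map /=.
rewrite !rmorphM -mulrA; congr (_ * (_ * _)); last by rewrite /= qpowD.
by rewrite /= !qpowE rmorphXn.
Qed.

End Evaluation.

(* phi(L): the additive group of L, with a acting by x |-> phi_a(x). *)
Definition drinfeld_points (phi : {rmorphism A -> twisted_poly g})
  (L : fieldType) (j : {rmorphism F -> L}) : Type := L.

Section Points.
Variables (phi : {rmorphism A -> twisted_poly g}).
Variables (L : fieldType) (j : {rmorphism F -> L}).

HB.instance Definition _ := GRing.Zmodule.copy (drinfeld_points phi j) L.

Let act (a : A) (x : drinfeld_points phi j) : drinfeld_points phi j :=
  tau_eval j (phi a) (x : L).

Let actA a b x : act a (act b x) = act (a * b) x.
Proof. by rewrite /act rmorphM tau_evalM. Qed.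
Let act1 : left_id 1 act.
Proof. by move=> x; rewrite /act rmorph1 tau_eval1. Qed.
Let actDr : right_distributive act +%R.
Proof. by move=> a x y; rewrite /act tau_evalDr. Qed.
Let actDl x : {morph act^~ x : a b / a + b}.
Proof. by move=> a b; rewrite /act rmorphD tau_evalDl. Qed.

HB.instance Definition _ := GRing.Zmodule_isLmodule.Build A
  (drinfeld_points phi j) actA act1 actDr actDl.

(* phi(F) as a subset of phi(L). *)
Definition constant_points : {pred drinfeld_points phi j} :=
  [pred x | `[< exists y : F, x = j y >]].

Lemma drinfeld_scaleE (a : A) (x : drinfeld_points phi j) :
  a *: x = tau_eval j (phi a) x.
Proof. by []. Qed.

End Points.
End DrinfeldModules.

Arguments constant_points {Fq F g A} phi {L} j.

Section Submodules.
Variables (A : nzRingType) (V : lmodType A).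

(* V is the internal direct sum of its submodules U and W. *)
Definition internal_direct_sum (U W : {pred V}) : Prop :=
  [/\ submod_closed U, submod_closed W,
      forall x, exists u w, [/\ u \in U, w \in W & x = u + w]
    & forall x, x \in U -> x \in W -> x = 0].

Definition free_of_rank_aleph0 (W : {pred V}) : Prop :=
  exists b : nat -> V,
    (forall n (a : 'I_n -> A), \sum_(l < n) a l *: b l = 0 ->
       forall l, a l = 0) /\
    (forall x, x \in W <->
       exists n (a : 'I_n -> A), x = \sum_(l < n) a l *: b l).

End Submodules.

(* Main.v *)
From HB Require Import structures.
Require Import Defs.
From mathcomp Require Import all_boot all_order all_algebra all_field.
From mathcomp Require Import boolp ring mpoly.
From mathcomp Require classical_sets.

(** Write D for F{tau}. Filter K by F-subspaces W 0 = F, W 1, W 2, ... with union K such that x^q in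
    W n.+1 implies x in W n. Then K/F is a free left D-module: lift bases of the successive quotients
    modulo the image of tau; this uses that F is perfect. Its rank is aleph_0, because y t^(qi), i >= 0,
    are independent modulo K^q when t is not in F and y is not in K^q. The filtration comes from pole
    orders on finite extensions of rational function fields k(t), for finitely many subfields k of K
    with intersection F. They are compared with the scale q^s / q^n, where n bounds the degree: an element
    of order at most 1 / q^n has no pole, and x |-> x^q shifts s by one.

    It remains to see that {poly D}, with a in A acting as left multiplication by phi a, is a free
    A-module of rank aleph_0. Comparing leading coefficients in phi_T phi_a = phi_a phi_T shows that A
    has finitely many elements of each degree, hence finite quotients; being integrally closed it is a
    Dedekind domain. Submodules of finite rank of {poly D} are finitely generated, and phi(A) is pure
    in D since A is integrally closed. So a pure free submodule can be enlarged to contain a given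
    vector: this adds an invertible ideal I, a direct summand of some A^N, and a complement of I in
    A^N embeds into fresh coordinates of {poly D}. *)

Set Implicit Arguments.
Unset Strict Implicit.
Unset Printing Implicit Defensive.

Import GRing.Theory.
Local Open Scope ring_scope.

(** * Degrees in F{tau} *)

(** For transcendence degree above 1, K is not a function field of one variable over F, and K/k(t)
    may be inseparable, so divisors and finitely generated integral closures are not at hand. Zorn's
    lemma provides k: a maximal subfield containing F over which t is transcendental. Then K is
    algebraic over k(t), k is algebraically closed in K, and finite generation of K bounds the
    degrees. Each further t is taken in the intersection of the earlier k but outside F; such t are
    algebraically independent, so the intersection reaches F after finitely many choices. The W n
    need not be finite-dimensional over F, so bases are picked greedily along an enumeration of K.
    Countability of F enters there and in the enumeration of [{poly D}] that drives the chain of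
    pure submodules. D has infinite rank over A because F is infinite, so finite generation at
    finite rank needs its own proof: a leading term argument on T-adic digits. The ideals that occur
    need not be principal, which is why a basis cannot simply grow by one vector at a time. *)

Section TwistedSize.
Variables (Fq : finFieldType) (F : fieldType) (g : {rmorphism Fq -> F}).
Local Notation D := (twisted_poly g).
Local Notation q := #|Fq|.

Lemma card_gt1 : (1 < q)%N.
Proof. exact: finNzRing_gt1. Qed.

Lemma cardX_gt0 i : (0 < q ^ i)%N.
Proof. by rewrite expn_gt0 ltnW ?card_gt1. Qed.

Lemma qpow_inj (L : fieldType) (h : {rmorphism Fq -> L}) i :
  injective (qpow h i).
Proof. exact: fmorph_inj. Qed.

Lemma tau_coefD (f h : D) n : tau_coef (f + h) n = tau_coef f n + tau_coef h n.
Proof. exact: coefD. Qed.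

Lemma tau_coefB (f h : D) n : tau_coef (f - h) n = tau_coef f n - tau_coef h n.
Proof. exact: coefB. Qed.

Lemma tau_coef0 n : tau_coef (0 : D) n = 0.
Proof. exact: coef0. Qed.

Lemma tau_coef_out (f : D) n : (tau_size f <= n)%N -> tau_coef f n = 0.
Proof. exact: nth_default. Qed.

Lemma tau_size_leP (f : D) n :
  reflect (forall m, (n <= m)%N -> tau_coef f m = 0) (tau_size f <= n)%N.
Proof.
apply: (iffP idP) => [le_fn m le_nm|h].
  by apply: tau_coef_out; apply: leq_trans le_nm.
exact/leq_sizeP.
Qed.

Lemma tau_size0 : tau_size (0 : D) = 0%N.
Proof. exact: size_poly0. Qed.

Lemma tau_size_eq0 (f : D) : (tau_size f == 0%N) = (f == 0).
Proof. exact: size_poly_eq0. Qed.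

Lemma tau_size_gt0 (f : D) : (0 < tau_size f)%N = (f != 0).
Proof. exact: size_poly_gt0. Qed.

Lemma tau_size1 : tau_size (1 : D) = 1%N.
Proof. exact: size_poly1. Qed.

Lemma tau_lead_neq0 (f : D) : f != 0 -> tau_coef f (tau_size f).-1 != 0.
Proof. by rewrite /tau_coef -lead_coefE lead_coef_eq0. Qed.

Lemma tau_sizeD (f h : D) : (tau_size (f + h)%R <= maxn (tau_size f) (tau_size h))%N.
Proof. exact: size_polyD. Qed.

Lemma tau_sizeN (f : D) : tau_size (- f) = tau_size f.
Proof. exact: size_polyN. Qed.

Lemma tau_coefM (f h : D) n :
  tau_coef (f * h) n =
    \sum_(i < n.+1) tau_coef f i * qpow g i (tau_coef h (n - i)).
Proof.
pose t i := tau_coef f i * qpow g i (tau_coef h (n - i)).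
have e1 : tau_coef (f * h) n = \sum_(i < tau_size f | (i < n.+1)%N) t i.
  rewrite [f * h]/(twisted_mul f h) /twisted_mul {1}/tau_coef coef_sum.
  rewrite [RHS]big_mkcond /=; apply: eq_bigr => i _.
  rewrite coefZ coefMXn coef_map /t ltnS.
  by case: ltnP => //= _; rewrite mulr0.
rewrite e1; pose m := maxn (tau_size f) n.+1.
rewrite (big_ord_widen_cond m (fun i => (i < n.+1)%N) t) ?leq_maxl //.
rewrite [RHS](big_ord_widen m t) ?leq_maxr //.
rewrite big_mkcond [RHS]big_mkcond; apply: eq_bigr => i _ /=.
case: ifP => [|/negbT]; first by case/andP=> ->.
rewrite negb_and => /orP[/negbTE -> //|].
by rewrite -leqNgt => /tau_coef_out h0; case: ifP => // _; rewrite /t h0 mul0r.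
Qed.

Lemma tau_coefM_top (f h : D) m n :
  (tau_size f <= m.+1)%N -> (tau_size h <= n.+1)%N ->
  tau_coef (f * h) (m + n) = tau_coef f m * qpow g m (tau_coef h n).
Proof.
move=> sf sh; rewrite tau_coefM.
have lt_m : (m < (m + n).+1)%N by rewrite ltnS leq_addr.
rewrite (bigD1 (Ordinal lt_m)) //= addKn big1 ?addr0 // => i ne_im.
have [lt_im|lt_mi|eq_im] := ltngtP i m.
- rewrite (tau_coef_out (f := h)) ?rmorph0 ?mulr0 //.
  by apply: leq_trans sh _; rewrite ltn_subRL ltn_add2r.
- by rewrite tau_coef_out ?mul0r //; apply: leq_trans sf _.
- by case/eqP: ne_im; apply: val_inj.
Qed.

Lemma tau_sizeM_leq (f h : D) m n :
  (tau_size f <= m.+1)%N -> (tau_size h <= n)%N -> (tau_size (f * h)%R <= m + n)%N.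
Proof.
move=> sf sh; apply/tau_size_leP => l le_l; rewrite tau_coefM big1 // => i _.
have [lt_mi|le_im] := ltnP m i.
  by rewrite tau_coef_out ?mul0r //; apply: leq_trans sf _.
rewrite (tau_coef_out (f := h)) ?rmorph0 ?mulr0 //; apply: leq_trans sh _.
by rewrite leq_subRL ?(leq_trans _ le_l) ?leq_add // (leq_trans le_im) ?leq_addr.
Qed.

Lemma tau_sizeM (f h : D) : f != 0 -> h != 0 ->
  tau_size (f * h) = ((tau_size f).-1 + tau_size h)%N.
Proof.
move=> f0 h0; apply/eqP; rewrite eqn_leq tau_sizeM_leq ?leqSpred //=.
have := tau_size_gt0 h; rewrite h0; case sh: (tau_size h) => [//|n] _.
rewrite addnS ltnNge; apply/negP => /tau_coef_out.
rewrite tau_coefM_top ?leqSpred ?sh //; apply/eqP; rewrite mulf_neq0 ?tau_lead_neq0 //.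
by rewrite fmorph_eq0; have := tau_lead_neq0 h0; rewrite sh.
Qed.

Lemma tau_mulf_eq0 (f h : D) : (f * h == 0) = (f == 0) || (h == 0).
Proof.
apply/idP/idP => [|/orP[]/eqP->]; rewrite ?mul0r ?mulr0 //.
apply: contraTT; rewrite negb_or => /andP[f0 h0].
by rewrite -tau_size_gt0 tau_sizeM // addn_gt0 orbC tau_size_gt0 h0.
Qed.

Lemma tau_mulfI (f : D) : f != 0 -> injective ( *%R f).
Proof.
move=> f0 x y /eqP; rewrite -subr_eq0 -mulrBr tau_mulf_eq0 (negbTE f0) /=.
by rewrite subr_eq0 => /eqP.
Qed.

Definition tau_term (a : F) n : D := a *: 'X^n : {poly F}.

Lemma tau_coef_term a n m : tau_coef (tau_term a n) m = a * (m == n)%:R.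
Proof. by rewrite /tau_coef coefZ coefXn. Qed.

Lemma tau_size_term a n : (tau_size (tau_term a n) <= n.+1)%N.
Proof.
apply/tau_size_leP => m lt_nm; rewrite tau_coef_term.
by rewrite (gtn_eqF lt_nm) mulr0.
Qed.

End TwistedSize.

(** * Finiteness properties of A *)

Section FiniteDegree.
Variables (Fq : finFieldType) (F : closedFieldType) (g : {rmorphism Fq -> F}).
Variables (A : comNzRingType) (phi : {rmorphism A -> twisted_poly g}).
Hypothesis phi_inj : injective phi.
Variables (T : A) (r : nat).
Hypotheses (r_gt0 : (0 < r)%N) (size_T : tau_size (phi T) = r.+1).
Local Notation D := (twisted_poly g).
Local Notation q := #|Fq|.

Lemma phi_eq0 a : (phi a == 0) = (a == 0).
Proof. by rewrite -(inj_eq phi_inj) rmorph0. Qed.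

Lemma A_mulfI (a : A) : a != 0 -> injective ( *%R a).
Proof.
move=> a0 x y /(congr1 phi); rewrite !rmorphM => /tau_mulfI h.
by apply/phi_inj/h; rewrite phi_eq0.
Qed.

Lemma lead_commute (f : D) n : (tau_size f <= n.+1)%N ->
  phi T * f = f * phi T ->
  tau_coef (phi T) r * tau_coef f n ^+ (q ^ r) =
    tau_coef f n * tau_coef (phi T) r ^+ (q ^ n).
Proof.
move=> sf e; have sT : (tau_size (phi T) <= r.+1)%N by rewrite size_T.
by have := tau_coefM_top sT sf; rewrite e addnC (tau_coefM_top sf sT) !qpowE.
Qed.

(** With l the leading coefficient of [phi T], every such coefficient is a root of l X^(q^r) -
    l^(q^n) X. The bound q^r on the number of roots does not depend on n. *)
Lemma lead_finite n : exists2 rs : seq F, (size rs <= q ^ r)%N &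
  forall a, (tau_size (phi a) <= n.+1)%N -> tau_coef (phi a) n \in rs.
Proof.
set l := tau_coef (phi T) r.
have l0 : l != 0 by have := @tau_lead_neq0 _ _ _ (phi T); rewrite -tau_size_gt0 size_T; apply.
pose P : {poly F} := l *: 'X^(q ^ r) - l ^+ (q ^ n) *: 'X.
have qr1 : (1 < q ^ r)%N by rewrite -(exp1n r) ltn_exp2r ?card_gt1.
have sP : size P = (q ^ r).+1.
  rewrite size_polyDl ?size_scale ?size_polyXn // size_polyN.
  by rewrite (leq_ltn_trans (size_scale_leq _ _)) ?size_polyX.
have [rs Prs] := closed_field_poly_normal P.
have P0 : P != 0 by rewrite -size_poly_gt0 sP.
have lP0 : lead_coef P != 0 by rewrite lead_coef_eq0.
exists rs => [|a sa].
  by rewrite -ltnS -sP Prs size_scale // size_prod_XsubC.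
have: root P (tau_coef (phi a) n).
  rewrite /root !hornerE subr_eq0; apply/eqP.
  by rewrite lead_commute 1?mulrC // -!rmorphM mulrC.
by rewrite Prs rootZ // root_prod_XsubC.
Qed.

(** The growth factor q^r is uniform in n; this is what bounds the index of aA later. *)
Lemma A_finite : exists e : nat -> seq A, forall n,
  [/\ uniq (e n), (forall a, (a \in e n) = (tau_size (phi a) <= n)%N)
    & (size (e n.+1) <= q ^ r * size (e n))%N].
Proof.
have step (s : seq A) n : (forall a, (a \in s) = (tau_size (phi a) <= n)%N) ->
    exists s' : seq A, [/\ uniq s', (size s' <= q ^ r * size s)%N
       & (forall a, (a \in s') = (tau_size (phi a) <= n.+1)%N)].
  move=> sP; have [rs srs rsP] := lead_finite n.
  pose W c (a : A) := (tau_size (phi a) <= n.+1)%N && (tau_coef (phi a) n == c).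
  (* One representative [w c] is fixed for each coefficient c that occurs at tau^n; subtracting it
     from any other element with that coefficient leaves an element of the previous list. *)
  have [w wP] : exists w : F -> A, forall c a, W c a -> W c (w c).
    have /choice[w wP] : forall c, exists a, (exists b, W c b) -> W c a.
      move=> c; have [[b Wb]|nW] := pselect (exists b, W c b); first by exists b.
      by exists 0.
    by exists w => c a Wa; apply: wP; exists a.
  pose s0 := [seq w c + a | c <- rs, a <- s].
  pose s' := [seq a <- undup s0 | (tau_size (phi a) <= n.+1)%N].
  exists s'; split; first by rewrite filter_uniq ?undup_uniq.
    rewrite size_filter (leq_trans (count_size _ _)) // (leq_trans (size_undup _)) //.
    by rewrite size_allpairs leq_mul2r srs orbT.
  move=> a; rewrite mem_filter mem_undup andb_idr // => sa.
  pose c := tau_coef (phi a) n.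
  have Wa : W c a by rewrite /W sa eqxx.
  have /andP[sw /eqP cw] := wP _ _ Wa.
  apply/allpairsP; exists (c, a - w c); split=> /=; [exact: rsP| |by rewrite addrC subrK].
  rewrite sP rmorphB; apply/tau_size_leP => m; rewrite leq_eqVlt => /orP[/eqP<-|lt_nm].
    by rewrite tau_coefB cw subrr.
  by rewrite tau_coefB !tau_coef_out ?subrr //; apply: leq_trans lt_nm.
have base a : (a \in [:: 0 : A]) = (tau_size (phi a) <= 0)%N.
  by rewrite inE leqn0 tau_size_eq0 phi_eq0.
have /choice[f fP] (x : seq A * nat) : exists s' : seq A,
    (forall a, (a \in x.1) = (tau_size (phi a) <= x.2)%N) ->
    [/\ uniq s', (size s' <= q ^ r * size x.1)%N
       & (forall a, (a \in s') = (tau_size (phi a) <= x.2.+1)%N)].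
  have [h|nh] := pselect (forall a, (a \in x.1) = (tau_size (phi a) <= x.2)%N).
    by have [s' hs'] := step _ _ h; exists s'.
  by exists [::].
pose e := fix e n := if n is m.+1 then f (e m, m) else [:: 0].
have eP n : uniq (e n) /\ forall a, (a \in e n) = (tau_size (phi a) <= n)%N.
  by elim: n => [//|n [u h]] /=; have [] := fP (e n, n) h.
exists e => n; have [u h] := eP n; split=> //.
by have [] := fP (e n, n) h.
Qed.

(* Multiplication by a raises the degree by a fixed amount, so the index of   *)
(* aA is bounded by the growth of the finite sets of elements of degree < n.  *)
Lemma incongruent_bound (a : A) : a != 0 ->
  exists C, forall xs : seq A,
    uniq xs -> {in xs &, forall x x', (exists y, x - x' = a * y) -> x = x'} ->
    (size xs <= C)%N.
Proof.
move=> a0; have [e eP] := A_finite.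
pose d := (tau_size (phi a)).-1; exists ((q ^ r) ^ d)%N => xs xsU xsP.
pose N := \max_(x <- xs) tau_size (phi x).
have grow m : (size (e (N + m)) <= (q ^ r) ^ m * size (e N))%N.
  elim: m => [|m IH]; first by rewrite addn0 expn0 mul1n.
  rewrite addnS (leq_trans (let: And3 _ _ h := eP _ in h)) //.
  by rewrite expnS -mulnA leq_mul2l IH orbT.
have eN_gt0 : (0 < size (e N))%N.
  have [_ h _] := eP N; have : 0 \in e N by rewrite h rmorph0 tau_size0.
  by case: (e N).
(* On pairs from [xs] and [e N], (x, y) |-> x + a y is injective, since [xs] is incongruent modulo
   a, and it lands in [e (N + d)]. *)
rewrite -(leq_pmul2r eN_gt0); apply: leq_trans (grow d).
rewrite -(size_allpairs (fun x y => x + a * y)); apply: uniq_leq_size.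
  apply: allpairs_uniq => //; first by have [] := eP N.
  move=> [x y] [x' y'] /allpairsP[[x1 y1] /= [x1s _ [-> ->]]].
  move=> /allpairsP[[x2 y2] /= [x2s _ [-> ->]]] h.
  have ex : x1 = x2.
    apply: xsP => //; exists (y2 - y1); rewrite mulrBr.
    by apply/eqP; rewrite subr_eq addrAC -[_ + x2]addrC -h addrK.
  by move: h; rewrite ex => /addrI /(A_mulfI a0) ->.
move=> z /allpairsP[[x y] /= [xs_x eNy ->]].
have [_ -> _] := eP (N + d)%N; rewrite rmorphD rmorphM.
apply: leq_trans (tau_sizeD _ _) _; rewrite geq_max; apply/andP; split.
  by apply: leq_trans (leq_addr _ _); apply: leq_bigmax_seq.
rewrite addnC; apply: tau_sizeM_leq; last by have [_ <- _] := eP N.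
exact: leqSpred.
Qed.

(** An incongruent list of maximal length is a complete system of residues; [incongruent_bound]
    provides the maximum. *)
Lemma residues (a : A) : a != 0 ->
  exists E : seq A, forall x, exists2 e, e \in E & exists y, x = e + a * y.
Proof.
move=> a0; have [C CP] := incongruent_bound a0.
pose ok (xs : seq A) := uniq xs /\
  {in xs &, forall x x', (exists y, x - x' = a * y) -> x = x'}.
pose Q n := `[< exists2 xs, ok xs & size xs = n >].
have Q0 : exists n, Q n by exists 0%N; apply/asboolP; exists [::]; split.
have Qle n : Q n -> (n <= C)%N by move=> /asboolP[xs [u h] <-]; apply: CP.
case: (ex_maxnP Q0 Qle) => n /asboolP[xs [u h] sxs] nmax.
exists xs => x; apply: contrapT => nx.
suff /asboolP/nmax : exists2 xs, ok xs & size xs = n.+1 by rewrite ltnn.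
have xP e : e \in xs -> ~ exists y, x - e = a * y.
  by move=> ee [y hy]; apply: nx; exists e => //; exists y; rewrite -hy addrC subrK.
exists (x :: xs); last by rewrite /= sxs.
split=> [|y y']; first by rewrite /= u andbT; apply/negP => /xP[]; exists 0; rewrite subrr mulr0.
rewrite !inE => /predU1P[->|ys] /predU1P[->|y's] //.
- by move=> /(xP _ y's).
- case=> z hz; case: (xP _ ys); exists (- z); by rewrite mulrN -hz opprB.
- exact: h.
Qed.

(** Pigeonhole on the powers of T in the finite ring A/aA. Multiplication by T^j - T^i will carry z
    into a multiple of a while keeping its leading T-adic digit. *)
Lemma dvd_powB (a : A) : a != 0 ->
  exists i j, (i < j)%N /\ exists y, T ^+ j - T ^+ i = a * y.
Proof.
move=> a0; have [E EP] := residues a0.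
have /choice[f fP] : forall n, exists e, e \in E /\ exists y, T ^+ n = e + a * y.
  by move=> n; have [e eE h] := EP (T ^+ n); exists e.
have [inj_f|/injectivePn] := boolP (injectiveb (fun i : 'I_(size E).+1 => f i)).
  suff: (size (codom (fun i : 'I_(size E).+1 => f i)) <= size E)%N.
    by rewrite size_codom card_ord ltnn.
  by apply: uniq_leq_size => // x /codomP[i ->]; case: (fP i).
have main (i j : 'I_(size E).+1) : f i = f j -> exists y, T ^+ j - T ^+ i = a * y.
  move=> fij; have [_ [y1 ->]] := fP i; have [_ [y2 ->]] := fP j.
  by exists (y2 - y1); rewrite fij mulrBr opprD addrACA subrr add0r.
case=> i [j ne_ij fij]; have [lt_ij|lt_ji|eq_ij] := ltngtP i j.
- by exists i, j; split=> //; apply: main.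
- by exists j, i; split=> //; apply: main.
- by case/eqP: ne_ij; apply: val_inj.
Qed.

(** If N bounds the degrees of residues modulo T, then an element x of larger degree is d + T y with
    y of smaller degree; so the finitely many elements up to N generate A over the powers of T. *)
Lemma A_fin_gen : exists L : seq A, forall S : A -> Prop,
  (forall x y, S x -> S y -> S (x + y)) -> (forall x, S x -> S (T * x)) ->
  (forall x, x \in L -> S x) -> forall x, S x.
Proof.
have T0 : T != 0 by rewrite -phi_eq0 -tau_size_gt0 size_T.
have [E EP] := residues T0; have [e eP] := A_finite.
pose N := \max_(x <- E) tau_size (phi x).
exists (e N) => S SD ST SL.
have SE x : x \in E -> S x.
  by move=> xE; apply: SL; have [_ -> _] := eP N; apply: leq_bigmax_seq.
suff main n x : (tau_size (phi x) <= n)%N -> S x by move=> x; apply: (main _ _ (leqnn _)).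
elim: n x => [|n IH] x sx; first by apply: SL; have [_ -> _] := eP N; apply: leq_trans sx _.
have [le_xN|lt_Nx] := leqP (tau_size (phi x)) N.
  by apply: SL; have [_ -> _] := eP N.
have [d dE [y xE]] := EP x; rewrite xE; apply: SD; first exact: SE.
apply: ST; apply: IH; have [->|y0] := eqVneq y 0; first by rewrite rmorph0 tau_size0.
have: (tau_size (phi (T * y)%R) <= n.+1)%N.
  have -> : T * y = x - d by rewrite xE addrC addKr.
  rewrite rmorphB (leq_trans (tau_sizeD _ _)) // tau_sizeN geq_max sx.
  apply: leq_trans sx; apply: ltnW; apply: leq_ltn_trans lt_Nx.
  exact: leq_bigmax_seq.
rewrite rmorphM tau_sizeM ?phi_eq0 // size_T /= => h.
by rewrite -ltnS (leq_trans _ h) // -add1n leq_add2r.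
Qed.

End FiniteDegree.

(** * Submodules of finite rank *)

Lemma exists_root_pow (F : closedFieldType) n (c : F) : (0 < n)%N ->
  exists d, d ^+ n = c.
Proof.
move=> n0; have /closed_rootP[d] : size ('X^n - c%:P) != 1.
  by rewrite size_XnsubC // eqSS -lt0n.
by rewrite /root !hornerE subr_eq0 => /eqP; exists d.
Qed.

(** Digit sets are closed under addition by means of this, so that T-adic expansions add without
    carries. *)
Lemma finite_add_closure (V : zmodType) p (ds : seq V) : (0 < p)%N ->
  (forall x : V, x *+ p = 0) ->
  exists G : seq V, [/\ 0 \in G, {subset ds <= G},
    {in G &, forall x y, x + y \in G}
    & forall P : V -> Prop, P 0 -> (forall x y, P x -> P y -> P (x + y)) ->
        (forall d, d \in ds -> P d) -> forall x, x \in G -> P x].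
Proof.
move=> p0 Vp; elim: ds => [|d ds [G [G0 Gds GD GP]]].
  exists [:: 0]; split=> //; first by rewrite inE.
    by move=> x y; rewrite !inE => /eqP-> /eqP->; rewrite addr0.
  by move=> P P0 _ _ x; rewrite inE => /eqP->.
exists [seq x + d *+ n | x <- G, n <- iota 0 p]; split.
- apply/allpairsP; exists (0, 0%N) => /=.
  by rewrite mem_iota add0r mulr0n; split.
- move=> x; rewrite inE => /predU1P[->|xds]; apply/allpairsP; last first.
    by exists (x, 0%N); rewrite /= mem_iota Gds // mulr0n addr0.
  (* For p = 1 the group V is trivial, and the only multiplier available is 0. *)
  have [p1|p1] := leqP p 1; last by exists (0, 1%N); rewrite /= mem_iota add0r.
  have := Vp d; have -> : p = 1%N by apply/eqP; rewrite eqn_leq p1.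
  rewrite mulr1n => ->; exists (0, 0%N) => /=.
  by rewrite inE add0r mulr0n; split.
- move=> x y /allpairsP[[x1 n1] /= [x1G _ ->]] /allpairsP[[x2 n2] /= [x2G _ ->]].
  apply/allpairsP; exists (x1 + x2, ((n1 + n2) %% p)%N) => /=; split.
  + exact: GD.
  + by rewrite mem_iota ltn_mod p0.
  + rewrite addrACA -mulrnDr {1}(divn_eq (n1 + n2) p) mulrnDr mulnC mulrnA Vp.
    by rewrite mul0rn add0r.
- move=> P P0 PD Pds x /allpairsP[[x1 n1] /= [x1G _ ->]]; apply: (PD).
    by apply: (GP P P0 PD _ x1 x1G) => e eds; apply: Pds; rewrite inE eds orbT.
  elim: n1 => [|n IH]; first by rewrite mulr0n.
  by rewrite mulrS; apply: PD => //; apply: Pds; rewrite inE eqxx.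
Qed.

(** * Left division by [phi T], T-adic digits, and finite generation *)

Section Tame.
Variables (Fq : finFieldType) (F : closedFieldType) (g : {rmorphism Fq -> F}).
Variables (A : comNzRingType) (phi : {rmorphism A -> twisted_poly g}).
Hypothesis phi_inj : injective phi.
Variables (T : A) (r : nat).
Hypotheses (r_gt0 : (0 < r)%N) (size_T : tau_size (phi T) = r.+1).
Local Notation D := (twisted_poly g).
Local Notation X := {poly D}.
Local Notation q := #|Fq|.

Definition bnd n (z : X) := forall i, (tau_size (z`_i)%R <= n)%N.

Lemma bnd0 n : bnd n 0.
Proof. by move=> i; rewrite coef0 tau_size0. Qed.

Lemma bndB n x y : bnd n x -> bnd n y -> bnd n (x - y).
Proof.
move=> hx hy i; rewrite coefB (leq_trans (tau_sizeD _ _)) // tau_sizeN geq_max.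
by rewrite hx hy.
Qed.

Lemma bndN n x : bnd n x -> bnd n (- x).
Proof. by move=> h; rewrite -sub0r; apply: bndB => //; apply: bnd0. Qed.

Lemma bndD n x y : bnd n x -> bnd n y -> bnd n (x + y).
Proof. by move=> hx hy; rewrite -[y]opprK; apply: bndB => //; apply: bndN. Qed.

Lemma bndW m n x : (m <= n)%N -> bnd m x -> bnd n x.
Proof. by move=> le_mn h i; apply: leq_trans le_mn. Qed.

Lemma bnd_exists x : exists n, bnd n x.
Proof.
exists (\max_(f <- (x : seq D)) tau_size f)%N => i.
have [lt_ix|le_xi] := ltnP i (size x).
  by apply: leq_bigmax_seq => //; apply: mem_nth.
by rewrite nth_default // tau_size0.
Qed.

Lemma bnd_eq0 x : bnd 0 x -> x = 0.
Proof.
move=> h; apply/polyP => i; rewrite coef0; apply/eqP.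
by rewrite -tau_size_eq0 -leqn0.
Qed.

Lemma phi_T_neq0 : phi T != 0.
Proof. by rewrite -tau_size_gt0 size_T. Qed.

Lemma phi_TX_neq0 u : phi (T ^+ u) != 0.
Proof.
elim: u => [|u IH]; first by rewrite rmorph1 -tau_size_gt0 tau_size1.
by rewrite exprS rmorphM tau_mulf_eq0 negb_or phi_T_neq0.
Qed.

Lemma size_TX u : tau_size (phi (T ^+ u)) = (u * r).+1.
Proof.
elim: u => [|u IH]; first by rewrite rmorph1 tau_size1.
by rewrite exprS rmorphM tau_sizeM ?phi_T_neq0 ?phi_TX_neq0 // size_T IH addnS mulSn.
Qed.

Lemma bnd_actX u n z : bnd n z -> bnd (u * r + n) (phi (T ^+ u) *: z).
Proof. by move=> h i; rewrite coefZ; apply: tau_sizeM_leq; rewrite ?size_TX. Qed.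

Lemma bnd_act n z : bnd n z -> bnd (r + n) (phi T *: z).
Proof. by move=> h; have := bnd_actX 1 h; rewrite expr1 mul1n. Qed.

Lemma bnd_actX_eq0 u d : bnd (u * r) (phi (T ^+ u) *: d) -> d = 0.
Proof.
move=> h; apply/polyP => i; rewrite coef0; apply/eqP.
apply: contraTT (h i) => d0; rewrite coefZ tau_sizeM ?phi_TX_neq0 // size_TX /=.
by rewrite -ltnNge -[X in (X < _)%N]addn0 ltn_add2l tau_size_gt0.
Qed.

(** The product of [phi T] and d tau^n has top coefficient l d^(q^r), so cancelling the top of f
    takes a q^r-th root, which F has. *)
Lemma tau_divT n (f : D) : (tau_size f <= r + n)%N ->
  exists y, (tau_size y <= n)%N /\ (tau_size (f - phi T * y)%R <= r)%N.
Proof.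
have sT : (tau_size (phi T) <= r.+1)%N by rewrite size_T.
elim: n f => [|n IH] f sf; first by exists 0; rewrite tau_size0 mulr0 subr0 -[r]addn0.
set l := tau_coef (phi T) r.
have l0 : l != 0 by have := tau_lead_neq0 phi_T_neq0; rewrite size_T.
have [d dP] := exists_root_pow (tau_coef f (r + n) / l) (cardX_gt0 Fq r).
pose y0 := tau_term g d n; have sy0 : (tau_size y0 <= n.+1)%N := tau_size_term _ _ _.
have [|y [sy yP]] := IH (f - phi T * y0).
  apply/tau_size_leP => m; rewrite leq_eqVlt => /predU1P[<-|lt_m].
    rewrite tau_coefB tau_coefM_top // tau_coef_term eqxx mulr1 qpowE dP -/l.
    by rewrite mulrCA divff // mulr1 subrr.
  rewrite tau_coefB [tau_coef f m]tau_coef_out ?sub0r ?(leq_trans sf) ?addnS //.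
  rewrite [tau_coef _ m]tau_coef_out ?oppr0 //.
  by apply: leq_trans lt_m; rewrite -addnS; apply: tau_sizeM_leq.
exists (y0 + y); split; last by rewrite mulrDr opprD addrA.
by rewrite (leq_trans (tau_sizeD _ _)) // geq_max sy0 ltnW.
Qed.

Lemma X_divT n z : bnd (r + n) z ->
  exists y, bnd n y /\ bnd r (z - phi T *: y).
Proof.
move=> hz; have /choice[f fP] := fun i => tau_divT (hz i).
have eq_y i : (\poly_(i < size z) f i : X)`_i = if (i < size z)%N then f i else 0.
  by rewrite coef_poly.
exists (\poly_(i < size z) f i); split=> i; rewrite ?coefB ?coefZ eq_y.
  by case: ifP => _; rewrite ?tau_size0 //; case: (fP i).
case: ltnP => [_|le_zi]; first by case: (fP i).
by rewrite mulr0 nth_default // subr0 tau_size0.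
Qed.

(* T-adic expansions; the digits of interest are elements z with [bnd r z]. *)
Inductive expansion (G : seq X) : X -> Prop :=
| expansion0 : expansion G 0
| expansionS d y : d \in G -> expansion G y -> expansion G (d + phi T *: y).

Lemma expansion_sub G G' z : {subset G <= G'} -> expansion G z -> expansion G' z.
Proof.
move=> sub; elim=> [|d y dG _ IH]; first exact: expansion0.
by apply: expansionS => //; apply: sub.
Qed.

Lemma expansion_exists z :
  exists2 G : seq X, (forall d, d \in G -> bnd r d) & expansion G z.
Proof.
have [n] := bnd_exists z; have [m] := ubnP n.
elim: m n z => // m IH n z lt_nm hz; have [le_nr|lt_rn] := leqP n r.
  exists [:: z] => [d|]; first by rewrite inE => /eqP->; apply: bndW hz.
  rewrite -[z]addr0 -(scaler0 _ (phi T)); apply: expansionS; last exact: expansion0.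
  by rewrite scaler0 addr0 inE.
have [|y [hy hd]] := @X_divT (n - r) z; first by rewrite subnKC // ltnW.
have [|G GP Gy] := IH (n - r)%N y _ hy.
  by rewrite -ltnS (leq_trans _ lt_nm) // ltnS -subn_gt0 subKn // ltnW.
exists ((z - phi T *: y) :: G) => [d|].
  by rewrite inE => /predU1P[->|/GP].
rewrite -[z in expansion _ z](subrK (phi T *: y)); apply: expansionS.
  by rewrite inE eqxx.
by apply: expansion_sub Gy => d dG; rewrite inE dG orbT.
Qed.

(** The leading T-adic digit and its place, expressed through sizes so as not to refer to a chosen
    expansion. *)
Definition top_digit z u d := [/\ bnd r d, d != 0 & bnd (u * r) (z - phi (T ^+ u) *: d)].

Lemma expansion_top G z : (forall d, d \in G -> bnd r d) -> expansion G z ->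
  z != 0 -> exists u d, d \in G /\ top_digit z u d.
Proof.
move=> Gr; elim=> [|d y dG _ IH]; first by rewrite eqxx.
have [->|/IH[u [d' [d'G [rd' d'0 hy]]]] _] := eqVneq y 0.
  rewrite scaler0 addr0 => d0; exists 0%N, d; split=> //; split=> //; first exact: Gr.
  by rewrite expr0 rmorph1 scale1r subrr; apply: bnd0.
exists u.+1, d'; split=> //; split=> //.
rewrite exprS rmorphM -scalerA -addrA -scalerBr; apply: bndD.
  by apply: bndW (Gr _ dG); rewrite leq_pmull.
by rewrite mulSn; apply: bnd_act.
Qed.

Lemma top_digit_bnd z u d : top_digit z u d -> bnd (u * r + r) z.
Proof.
case=> rd _ h; rewrite -(subrK (phi (T ^+ u) *: d) z); apply: bndD.
  by apply: bndW h; apply: leq_addr.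
exact: bnd_actX.
Qed.

Lemma top_digit_lt z u d n : top_digit z u d -> bnd (n * r) z -> (u < n)%N.
Proof.
case=> rd d0 h hz; rewrite ltnNge; apply/negP => le_nu; case/eqP: d0.
apply: (@bnd_actX_eq0 u).
rewrite (_ : _ *: d = z - (z - phi (T ^+ u) *: d)); last by rewrite opprB addrC subrK.
by apply: bndB => //; apply: bndW hz; rewrite leq_mul2r le_nu orbT.
Qed.

(** The size of z fixes the place; then T^u (d - d') has degree below u * r, which forces d = d'. *)
Lemma top_digit_uniq z u d u' d' :
  top_digit z u d -> top_digit z u' d' -> d = d'.
Proof.
wlog le_uu' : u d u' d' / (u <= u')%N => [hw|] t t'.
  by case/orP: (leq_total u u') => h; [apply: hw t t' | apply/esym; apply: hw t' t].
have : (u' <= u)%N.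
  by rewrite -ltnS; apply: top_digit_lt t' _; rewrite mulSn addnC; apply: top_digit_bnd t.
move=> le_u'u; have eu : u = u' by apply/eqP; rewrite eqn_leq le_uu'.
rewrite -eu in t'.
apply/eqP; rewrite -subr_eq0; apply/eqP; apply: (@bnd_actX_eq0 u).
case: t t' => [_ _ h] [_ _ h']; rewrite scalerBr.
by have := bndB h' h; rewrite opprB addrC addrA subrK.
Qed.

Lemma expansion_add G : {in G &, forall x y, x + y \in G} ->
  forall z z', expansion G z -> expansion G z' -> expansion G (z + z').
Proof.
move=> GD z z' hz; elim: hz z' => [|d y dG hy IH] z'; first by rewrite add0r.
case=> [|d' y' d'G hy']; first by rewrite addr0; apply: expansionS.
by rewrite addrACA -scalerDr; apply: expansionS; [apply: GD | apply: IH].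
Qed.

Lemma expansion_act G : 0 \in G -> forall z, expansion G z -> expansion G (phi T *: z).
Proof. by move=> G0 z hz; rewrite -[_ *: _]add0r; apply: expansionS. Qed.

(** As in Hilbert's basis theorem: if leading digits come from a finite set, it suffices to keep,
    for each digit, an element of I that has it at the lowest place. Multiples of these by powers of
    T lower the place of any z in I. *)
Lemma fin_gen_of_expansion (G : seq X) (I : X -> Prop) :
  (forall d, d \in G -> bnd r d) ->
  I 0 -> (forall x y, I x -> I y -> I (x - y)) -> (forall x, I x -> I (phi T *: x)) ->
  (forall z, I z -> exists i j, (i < j)%N /\
     expansion G (phi (T ^+ j) *: z - phi (T ^+ i) *: z)) ->
  exists L : seq X, (forall l, l \in L -> I l) /\
    forall z, I z -> forall S : X -> Prop, S 0 ->
     (forall x y, S x -> S y -> S (x + y)) -> (forall x, S x -> S (phi T *: x)) ->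
     (forall l, l \in L -> S l) -> S z.
Proof.
move=> Gr I0 IB IT IG.
(* [m d] has leading digit d at the least place possible in I; it is 0 when d never occurs. *)
have /choice[m mP] d : exists w, I w /\
    forall z u, I z -> top_digit z u d -> exists2 u0, (u0 <= u)%N & top_digit w u0 d.
  have [h|nh] := pselect (exists u, `[< exists2 z, I z & top_digit z u d >]).
    case: (ex_minnP h) => u0 /asboolP[w Iw w0] min; exists w; split=> // z u Iz zu.
    by exists u0 => //; apply: min; apply/asboolP; exists z.
  by exists 0; split=> // z u Iz zu; case: nh; exists u; apply/asboolP; exists z.
exists [seq m d | d <- G]; split=> [l /mapP[d _ ->]|]; first by case: (mP d).
move=> z0 Iz0 S S0 SD ST SL.
have ITX u x : I x -> I (phi (T ^+ u) *: x).
  move=> Ix; elim: u => [|u IH]; first by rewrite expr0 rmorph1 scale1r.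
  by rewrite exprS rmorphM -scalerA; apply: IT.
have STX u x : S x -> S (phi (T ^+ u) *: x).
  move=> Sx; elim: u => [|u IH]; first by rewrite expr0 rmorph1 scale1r.
  by rewrite exprS rmorphM -scalerA; apply: ST.
suff main n z : I z -> bnd (n * r) z -> S z.
  have [n hn] := bnd_exists z0; apply: (main n) => //.
  by apply: bndW hn; rewrite leq_pmulr.
elim: n z => [|n IH] z Iz hz; first by rewrite (bnd_eq0 hz).
have [->//|z0'] := eqVneq z 0.
have [G0 G0r G0z] := expansion_exists z.
have [u [d [_ zd]]] := expansion_top G0r G0z z0'.
have lt_un := top_digit_lt zd hz; case: (zd) => rd d0 hzd.
(* The digits of z itself may lie outside G, but (T^j - T^i) z expands over G and has the same
   leading digit d, now at place u + j, because i < j. *)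
have dG : d \in G.
  have [i [j [lt_ij]]] := IG z Iz; set z' := _ - _ => hz'.
  have tz' : top_digit z' (u + j) d.
    split=> //; rewrite /z' addrAC [(u + j)%N]addnC exprD rmorphM -scalerA -scalerBr.
    apply: bndB; first by rewrite mulnDl; apply: bnd_actX.
    apply: bndW (bnd_actX i (top_digit_bnd zd)).
    by rewrite -mulSnr -mulnDl leq_mul2r addnS -addSn leq_add2r lt_ij orbT.
  have z'0 : z' != 0.
    apply/eqP => e; have : (u + j < 0)%N by apply: top_digit_lt tz' _; rewrite e; apply: bnd0.
    by [].
  have [u1 [d1 [d1G t1]]] := expansion_top Gr hz' z'0.
  by rewrite (top_digit_uniq tz' t1).
have [Iw /(_ z u Iz zd)[u0 le_u0u [_ _ wd]]] := mP d.
rewrite -(subrK (phi (T ^+ (u - u0)) *: m d) z); apply: SD; last first.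
  by apply: STX; apply: SL; apply: map_f.
apply: IH; first by apply: IB => //; apply: ITX.
apply: (@bndW (u * r)); first by rewrite leq_mul2r -ltnS lt_un orbT.
have := bnd_actX (u - u0) wd; rewrite -mulnDl subnK // => /(bndB hzd).
rewrite scalerBr scalerA -rmorphM -exprD subnK //.
by rewrite opprB addrA subrK.
Qed.

Definition aspan (b : seq X) (z : X) : Prop :=
  exists c : nat -> A, z = \sum_(l < size b) phi (c l) *: b`_l.

Lemma aspan0 b : aspan b 0.
Proof. by exists (fun=> 0); rewrite big1 // => l _; rewrite rmorph0 scale0r. Qed.

Lemma aspanD b x y : aspan b x -> aspan b y -> aspan b (x + y).
Proof.
case=> c -> [c' ->]; exists (fun l => c l + c' l); rewrite -big_split /=.
by apply: eq_bigr => l _; rewrite rmorphD scalerDl.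
Qed.

Lemma aspanZ b a x : aspan b x -> aspan b (phi a *: x).
Proof.
case=> c ->; exists (fun l => a * c l); rewrite scaler_sumr.
by apply: eq_bigr => l _; rewrite rmorphM scalerA.
Qed.

Lemma aspanN b x : aspan b x -> aspan b (- x).
Proof. by move=> /(aspanZ (-1)); rewrite rmorphN1 scaleN1r. Qed.

Lemma aspanB b x y : aspan b x -> aspan b y -> aspan b (x - y).
Proof. by move=> hx hy; apply: aspanD => //; apply: aspanN. Qed.

Lemma aspan_mem b x : x \in b -> aspan b x.
Proof.
move=> xb; exists (fun l => (l == index x b)%:R).
have lt_xb : (index x b < size b)%N by rewrite index_mem.
rewrite (bigD1 (Ordinal lt_xb)) //= eqxx rmorph1.
rewrite scale1r nth_index // big1 ?addr0 // => l /eqP ne.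
case: eqP => [e|_]; last by rewrite rmorph0 scale0r.
by case: ne; apply: val_inj.
Qed.

Lemma aspan_ind b (S : X -> Prop) : S 0 -> (forall x y, S x -> S y -> S (x + y)) ->
  (forall a x, x \in b -> S (phi a *: x)) -> forall x, aspan b x -> S x.
Proof.
move=> S0 SD SZ _ [c ->]; elim/big_ind: _ => // l _.
by apply: SZ; apply: mem_nth.
Qed.

Lemma aspan_sub b b' : (forall x, x \in b -> aspan b' x) -> forall x, aspan b x -> aspan b' x.
Proof.
move=> h; apply: aspan_ind; [exact: aspan0 | exact: aspanD |].
by move=> a x xb; apply: aspanZ; apply: h.
Qed.

Lemma X_pchar : exists2 p, (0 < p)%N & forall x : X, x *+ p = 0.
Proof.
have [p pr_p charFq] := finPcharP Fq; exists p; first exact: prime_gt0.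
have pF : p \in [pchar F] by rewrite (fmorph_pchar g).
move=> x; apply/polyP => i; rewrite coefMn coef0; apply/polyP => l.
by rewrite [LHS](coefMn (x`_i : {poly F})) mulrn_pchar // coef0.
Qed.

Lemma common_expansion (zs : seq X) : exists2 G : seq X,
  (forall d, d \in G -> bnd r d) & forall z, z \in zs -> expansion G z.
Proof.
elim: zs => [|z zs [G Gr Gz]]; first by exists [::].
have [G' G'r G'z] := expansion_exists z; exists (G ++ G').
  by move=> d; rewrite mem_cat => /orP[/Gr|/G'r].
move=> z'; rewrite inE => /predU1P[->|/Gz Gz'].
  by apply: expansion_sub G'z => d dG; rewrite mem_cat dG orbT.
by apply: expansion_sub Gz' => d dG; rewrite mem_cat dG.
Qed.

(* Some (T^j - T^i) z with i < j lies in the span of ws, and z has the same   *)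
(* top digit; so the top digits of elements of I form a finite set.           *)
Lemma tame (ws : seq X) (I : X -> Prop) :
  I 0 -> (forall x y, I x -> I y -> I (x - y)) -> (forall x, I x -> I (phi T *: x)) ->
  (forall z, I z -> exists2 a, a != 0 & aspan ws (phi a *: z)) ->
  exists L : seq X, (forall l, l \in L -> I l) /\ forall z, I z -> aspan L z.
Proof.
move=> I0 IB IT Iws.
have [LA LAP] := A_fin_gen phi_inj r_gt0 size_T.
(* G0 expands the products of generators of A and of [ws]. Its additive closure G expands sums and
   multiples by T as well, hence the whole span of [ws]. *)
have [G0 G0r G0z] := common_expansion [seq phi a *: w | a <- LA, w <- ws].
have [p p0 Xp] := X_pchar.
have [G [G_0 G0G GD GP]] := finite_add_closure G0 p0 Xp.
have Gr d : d \in G -> bnd r d.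
  by move: d; apply: GP => // [|x y]; [apply: bnd0 | apply: bndD].
have Gaw w : w \in ws -> forall a, expansion G (phi a *: w).
  move=> wws; apply: LAP => [x y hx hy|x hx|x xL].
  - by rewrite rmorphD scalerDl; apply: expansion_add.
  - by rewrite rmorphM -scalerA; apply: expansion_act.
  - by apply: expansion_sub G0G _; apply: G0z; apply/allpairsP; exists (x, w).
have Gws : forall z, aspan ws z -> expansion G z.
  apply: aspan_ind; [exact: expansion0 | exact: expansion_add |].
  by move=> a x xws; apply: Gaw.
have [|L [LI LP]] := @fin_gen_of_expansion G I Gr I0 IB IT.
  move=> z Iz; have [a a0 az] := Iws z Iz.
  have [i [j [lt_ij [y yP]]]] := dvd_powB phi_inj r_gt0 size_T a0.
  exists i, j; split=> //; apply: Gws.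
  by rewrite -scalerBl -rmorphB yP mulrC rmorphM -scalerA; apply: aspanZ.
exists L; split=> // z Iz; apply: (LP z Iz); first exact: aspan0.
- exact: aspanD.
- by move=> x; apply: aspanZ.
- exact: aspan_mem.
Qed.

End Tame.

(** * Invertible ideals *)

Lemma count_lt (T : eqType) (a1 a2 : pred T) (s : seq T) x :
  subpred a1 a2 -> x \in s -> a2 x -> ~~ a1 x -> (count a1 s < count a2 s)%N.
Proof.
move=> sub; elim: s => //= y s IH; rewrite inE => /predU1P[<-|xs] a2x na1x.
  by rewrite a2x (negbTE na1x) add0n add1n ltnS sub_count.
rewrite -addnS leq_add ?IH //.
by case a1y: (a1 y) => //; rewrite (sub _ a1y).
Qed.

Section Dedekind.
Variables (A : comNzRingType) (k : fieldType) (v : {rmorphism A -> k}).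
Hypothesis v_inj : injective v.
Hypothesis A_closed : forall y, integralOver v y -> exists a, y = v a.
Hypothesis A_residues : forall a : A, a != 0 ->
  exists E : seq A, forall x, exists2 e, e \in E & exists y, x = e + a * y.

Lemma v_eq0 a : (v a == 0) = (a == 0).
Proof. by rewrite -(inj_eq v_inj) rmorph0. Qed.

(* Among the c congruent to 1 modulo I, take one for which the ideal of A / b *)
(* generated by c is minimal: a long product of c with elements of I is then  *)
(* zero in the finite ring A / b.                                             *)
Lemma ideal_annihilator (I : A -> Prop) (b : A) : b != 0 ->
  (forall x y, I x -> I y -> I (x + y)) -> (forall a x, I x -> I (a * x)) ->
  I b -> ~ I 1 ->
  exists c, ~ (exists z, c = b * z) /\ forall x, I x -> exists z, c * x = b * z.
Proof.
move=> b0 ID IM Ib I1; apply: contrapT => noc.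
have IN x : I x -> I (- x) by rewrite -mulN1r; apply: IM.
have next c : ~ (exists z, c = b * z) -> exists x, I x /\ ~ (exists z, c * x = b * z).
  move=> nc; apply: contrapT => nx; apply: noc; exists c; split=> // x Ix.
  by apply: contrapT => nz; apply: nx; exists x.
have /choice[h hP] c : exists x, ~ (exists z, c = b * z) ->
    I x /\ ~ (exists z, c * x = b * z).
  have [e|/next[x hx]] := pselect (exists z, c = b * z); first by exists 0.
  by exists x.
have [E EP] := A_residues b0.
pose S c : pred A := fun e => `[< exists d y, e = c * d + b * y >].
pose M n := `[< exists2 c, I (1 - c) & count (S c) E = n >].
have Mex : exists n, M n.
  exists (count (S 1) E); apply/asboolP; exists 1 => //.
  by rewrite subrr -(mul0r b); apply: IM.
case: (ex_minnP Mex) => n /asboolP[c0 Zc0 <-] cmin.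
(* Since no annihilator exists, [h] always finds an element of I that keeps the product outside
   bA. *)
pose p := fix p n := if n is m.+1 then p m * h (p m) else c0.
have pS m : p m.+1 = p m * h (p m) by [].
have nbp i : ~ exists z, p i = b * z.
  elim: i => [[z /= c0b]|i IH] /=; last by case: (hP _ IH).
  apply: I1; rewrite -(subrK c0 1); apply: ID => //.
  by rewrite c0b mulrC; apply: IM.
have pM i : exists w, p i = c0 * w.
  elim: i => [|i [w IH]]; first by exists 1; rewrite mulr1.
  by exists (w * h (p i)); rewrite /= {1}IH mulrA.
have pI i m : exists2 e, I e & p (i + m).+1 = p i * e.
  elim: m => [|m [e Ie IH]].
    by exists (h (p i)); [case: (hP _ (nbp i)) | rewrite addn0].
  exists (e * h (p (i + m).+1)); last by rewrite addnS pS {1}IH mulrA.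
  by rewrite mulrC; apply: IM.
(* Write p j = p i * e with e in I. Then c0 (1 - e) is still 1 modulo I, so by minimality it
   generates the same ideal as c0 in A/b. A congruence p i (1 - e) = 0 modulo b would therefore give
   p i = 0 modulo b. *)
have pE i j : (i < j)%N -> ~ exists z, p i - p j = b * z.
  move=> lt_ij; rewrite -(subnKC lt_ij) addSn; have [e Ie ->] := pI i (j - i.+1)%N.
  case=> z hz; pose c' := c0 * (1 - e).
  have Zc' : I (1 - c').
    rewrite /c' mulrBr mulr1 opprB addrCA addrC; apply: ID => //.
    exact: IM.
  have sub : subpred (S c') (S c0).
    move=> x /asboolP[d [y ->]]; apply/asboolP; exists ((1 - e) * d), y.
    by rewrite mulrA.
  have [e0 e0E [y0 e0P]] := EP c0.
  have Se0 : S c' e0.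
    apply: contraT => ne0; have Sc0 : S c0 e0.
      by apply/asboolP; exists 1, (- y0); rewrite mulr1 mulrN {1}e0P addrK.
    have := count_lt sub e0E Sc0 ne0; rewrite ltnNge cmin //.
    by apply/asboolP; exists c'.
  have [d [y hy]] : exists d y, e0 = c' * d + b * y by apply/asboolP.
  have c0E : c0 = c0 * (1 - e) * d + b * (y + y0) by rewrite {1}e0P hy /c'; ring.
  have [w pw] := pM i; apply: (nbp i); exists (z * d + (y + y0) * w).
  rewrite pw in hz *; rewrite {1}c0E [RHS]mulrDr mulrA -hz; ring.
(* The p i are pairwise incongruent, against the finiteness of A/b. *)
have /choice[f fP] i : exists e, e \in E /\ exists y, p i = e + b * y.
  by have [e eE h'] := EP (p i); exists e.
have same (i j : 'I_(size E).+1) : f i = f j -> exists z, p i - p j = b * z.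
  move=> fij; have [_ [y1 ->]] := fP i; have [_ [y2 ->]] := fP j.
  by exists (y1 - y2); rewrite fij; ring.
have [inj_f|/injectivePn[i [j ne_ij fij]]] :=
    boolP (injectiveb (fun i : 'I_(size E).+1 => f i)).
  suff: (size (codom (fun i : 'I_(size E).+1 => f i)) <= size E)%N.
    by rewrite size_codom card_ord ltnn.
  by apply: uniq_leq_size => // x /codomP[i ->]; case: (fP i).
have [lt_ij|lt_ji|eq_ij] := ltngtP i j.
- by apply: (pE i j lt_ij); apply: same.
- by apply: (pE j i lt_ji); apply: same.
- by case/eqP: ne_ij; apply: val_inj.
Qed.

Definition in_ideal (s : seq A) x := exists c : nat -> A, x = \sum_(l < size s) c l * s`_l.

Lemma in_idealD s x y : in_ideal s x -> in_ideal s y -> in_ideal s (x + y).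
Proof.
case=> c -> [d ->]; exists (fun l => c l + d l).
by rewrite -big_split; apply: eq_bigr => l _; rewrite mulrDl.
Qed.

Lemma in_idealM s a x : in_ideal s x -> in_ideal s (a * x).
Proof.
case=> c ->; exists (fun l => a * c l).
by rewrite mulr_sumr; apply: eq_bigr => l _; rewrite mulrA.
Qed.

Lemma in_ideal_nth s l : (l < size s)%N -> in_ideal s s`_l.
Proof.
move=> lt_ls; exists (fun m => (m == l)%:R); rewrite (bigD1 (Ordinal lt_ls)) //=.
rewrite eqxx mul1r big1 ?addr0 // => m /eqP ne; case: eqP => [e|_]; last by rewrite mul0r.
by case: ne; apply: val_inj.
Qed.

(** The determinant trick: y is an eigenvalue of M, hence a root of its characteristic
    polynomial. *)
Lemma integral_of_stable n (w : 'rV[k]_n) (M : 'M[A]_n) y :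
  w != 0 -> w *m map_mx v M = y *: w -> integralOver v y.
Proof.
move=> w0 wM; exists (char_poly M); first exact: char_poly_monic.
by rewrite map_char_poly -eigenvalue_root_char; apply/eigenvalueP; exists w.
Qed.

(** Induction on the number of residues modulo b outside the ideal I. If I is proper, an annihilator
    c gives y = c / b outside A with yI inside A. Since A is integrally closed, yI is not inside I,
    so I + yI is larger, and an inverse of it yields one of I. *)
Lemma ideal_invertible (s : seq A) (b : A) : b != 0 -> b \in s ->
  exists y : nat -> k,
    (forall l m, (l < size s)%N -> (m < size s)%N -> exists a, y l * v s`_m = v a) /\
    \sum_(l < size s) y l * v s`_l = 1.
Proof.
move=> b0; have [E EP] := A_residues b0.
pose N s := count (fun e => ~~ `[< in_ideal s e >]) E.
have [n] := ubnP (N s); elim: n s => // n IH s ltN bs.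
have Ib t : b \in t -> in_ideal t b.
  by move=> bt; rewrite -(nth_index 0 bt); apply: in_ideal_nth; rewrite index_mem.
have [[c c1]|I1] := pselect (in_ideal s 1).
  exists (v \o c); split=> [l m _ _|]; first by exists (c l * s`_m); rewrite rmorphM.
  by rewrite -(rmorph1 v) c1 rmorph_sum; apply: eq_bigr => l _; rewrite rmorphM.
have [c [nbc cI]] := ideal_annihilator b0 (@in_idealD s) (@in_idealM s) (Ib s bs) I1.
have vb0 : v b != 0 by rewrite v_eq0.
pose y := v c / v b.
have /choice[z zP] l : exists z, (l < size s)%N -> c * s`_l = b * z.
  have [lt_ls|] := boolP (l < size s)%N; last by exists 0.
  by have [z hz] := cI _ (in_ideal_nth lt_ls); exists z.
have yz l : (l < size s)%N -> y * v s`_l = v (z l).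
  by move=> lt_ls; rewrite /y mulrAC -rmorphM zP // rmorphM mulrC mulKf.
(* Otherwise y stabilizes I, is integral over A, hence lies in A, and b divides c. *)
have [l0 lt_l0s Iz] : exists2 l, (l < size s)%N & ~ in_ideal s (z l).
  apply: contrapT => nz.
  have /choice[M MP] l : exists c : nat -> A, (l < size s)%N ->
      z l = \sum_(m < size s) c m * s`_m.
    have [lt_ls|] := boolP (l < size s)%N; last by exists (fun=> 0).
    suff [d dP] : in_ideal s (z l) by exists d.
    by apply: contrapT => h; apply: nz; exists l.
  have lt_bs : (index b s < size s)%N by rewrite index_mem.
  suff /A_closed[a ya] : integralOver v y.
    apply: nbc; exists a; apply: v_inj; rewrite rmorphM -ya /y.
    by rewrite mulrC mulfVK.
  apply: (@integral_of_stable (size s) (\row_l v s`_l) (\matrix_(m, l) M l m)).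
    apply/eqP => /rowP/(_ (Ordinal lt_bs)); rewrite !mxE /= nth_index //.
    by apply/eqP.
  apply/rowP => l; rewrite !mxE yz // MP // rmorph_sum; apply: eq_bigr => m _.
  by rewrite !mxE rmorphM mulrC.
(* Generators of I + yI. *)
pose s' := s ++ [seq z l | l <- iota 0 (size s)].
have s'l l : (l < size s)%N -> s'`_l = s`_l by rewrite nth_cat => ->.
have s'r l : (l < size s)%N -> s'`_(size s + l) = z l.
  move=> lt_ls; rewrite nth_cat ltnNge leq_addr /= addKn.
  by rewrite (nth_map 0%N) ?size_iota // nth_iota.
have ss' : size s' = (size s + size s)%N by rewrite size_cat size_map size_iota.
have sub x : in_ideal s x -> in_ideal s' x.
  case=> d ->; elim/big_ind: _ => [|x1 x2|l _]; last 1 first.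
  - by apply: in_idealM; rewrite -s'l //; apply: in_ideal_nth; rewrite ss' ltn_addr.
  - by exists (fun=> 0); rewrite big1 // => l _; rewrite mul0r.
  - exact: in_idealD.
have bs' : b \in s' by rewrite mem_cat bs.
have [|y' [y'A y'1]] := IH s' _ bs'.
  have [e eE [x zx]] := EP (z l0).
  have I'e : in_ideal s' e.
    rewrite -(addrK (b * x) e) -zx; apply: in_idealD.
      by rewrite -s'r //; apply: in_ideal_nth; rewrite ss' ltn_add2l.
    by rewrite mulrC -mulNr; apply: in_idealM; apply: Ib.
  rewrite -ltnS; apply: leq_trans ltN; rewrite ltnS.
  apply: (count_lt (x := e)) => //; last by rewrite negbK; apply/asboolP.
    by move=> x0; apply: contra => /asboolP h; apply/asboolP; apply: sub.
  apply/asboolP => Ie; apply: Iz; rewrite zx; apply: in_idealD => //.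
  by rewrite mulrC; apply: in_idealM; apply: Ib.
(* Obtained by collecting the coefficient of s_l in the relation for [s'], where z_l = y s_l. *)
exists (fun l => y' l + y' (size s + l)%N * y); split=> [l m lt_l lt_m|].
  have lt_l' : (l < size s')%N by rewrite ss' ltn_addr.
  have lt_m' : (m < size s')%N by rewrite ss' ltn_addr.
  have [a1 h1] := y'A l m lt_l' lt_m'.
  have lt_l'' : (size s + l < size s')%N by rewrite ss' ltn_add2l.
  have lt_m'' : (size s + m < size s')%N by rewrite ss' ltn_add2l.
  have [a2 h2] := y'A _ _ lt_l'' lt_m''.
  exists (a1 + a2); rewrite rmorphD -h1 -h2 s'l // s'r // -yz //; ring.
rewrite -y'1 ss' big_split_ord /= -big_split /=; apply: eq_bigr => l _ /=.
by rewrite s'l // s'r // -yz //; ring.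
Qed.

(** After scaling by b, the entry 1 becomes the nonzero element b that [ideal_invertible] wants
    among the generators. *)
Lemma fractional_ideal_invertible (s : seq k) (b : A) : b != 0 -> 1 \in s ->
  (forall x, x \in s -> exists a, v b * x = v a) ->
  exists y : nat -> k,
    (forall l m, (l < size s)%N -> (m < size s)%N -> exists a, y l * s`_m = v a) /\
    \sum_(l < size s) y l * s`_l = 1.
Proof.
move=> b0 s1 sb.
have /choice[f fP] x : exists a, x \in s -> v b * x = v a.
  by have [/sb[a ha]|] := boolP (x \in s); [exists a | exists 0].
have fb : f 1 = b by apply: v_inj; rewrite -fP // mulr1.
have bs : b \in map f s by rewrite -fb map_f.
have [y [yA y1]] := ideal_invertible b0 bs; rewrite size_map in yA y1.
have fs l : (l < size s)%N -> v (map f s)`_l = v b * s`_l.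
  by move=> lt_ls; rewrite (nth_map 0) // fP // mem_nth.
exists (fun l => y l * v b); split=> [l m lt_l lt_m|].
  by have [a ha] := yA l m lt_l lt_m; exists a; rewrite -ha fs // mulrA.
by rewrite -y1; apply: eq_bigr => l _; rewrite fs // mulrA.
Qed.

End Dedekind.

(** * Rank one extensions of pure submodules *)

Section FreeOverA.
Variables (Fq : finFieldType) (F : closedFieldType) (g : {rmorphism Fq -> F}).
Variables (A : comNzRingType) (phi : {rmorphism A -> twisted_poly g}).
Hypothesis phi_inj : injective phi.
Variables (T : A) (r : nat).
Hypotheses (r_gt0 : (0 < r)%N) (size_T : tau_size (phi T) = r.+1).
Variables (k : fieldType) (v : {rmorphism A -> k}).
Hypothesis v_inj : injective v.
Hypothesis A_closed : forall y, integralOver v y -> exists a, y = v a.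
Local Notation D := (twisted_poly g).
Local Notation X := {poly D}.
Local Notation aspan := (@aspan _ _ _ _ phi).

Lemma phi_mulf_neq0 (a c : A) : a != 0 -> c != 0 -> a * c != 0.
Proof.
by move=> a0 c0; rewrite -(phi_eq0 phi_inj) rmorphM tau_mulf_eq0 !phi_eq0 // negb_or a0.
Qed.

Lemma act_eq0 a (w : X) : a != 0 -> phi a *: w = 0 -> w = 0.
Proof.
move=> a0 /polyP h; apply/polyP => i; have := h i; rewrite coefZ !coef0 => /eqP.
by rewrite tau_mulf_eq0 phi_eq0 // (negbTE a0) => /eqP.
Qed.

Definition pure b := forall a w, a != 0 -> aspan b (phi a *: w) -> aspan b w.

Definition independent (b : seq X) := forall c : nat -> A,
  \sum_(l < size b) phi (c l) *: b`_l = 0 -> forall l, (l < size b)%N -> c l = 0.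

Section Ratio.
Variables (b : seq X) (u0 : X).
Hypotheses (b_pure : pure b) (u0_out : ~ aspan b u0).

(* The pure closure of <b, u0>; modulo <b> it is isomorphic to a fractional   *)
(* ideal, through the ratio c / a.                                            *)
Definition ratio_of z a c := a != 0 /\ aspan b (phi a *: z - phi c *: u0).
Definition pclosure z := exists a c, ratio_of z a c.

(** If the fractions differed, a nonzero multiple of u0 would lie in the span of b, and u0 itself by
    purity. *)
Lemma ratio_uniq z a c a' c' : ratio_of z a c -> ratio_of z a' c' ->
  v c / v a = v c' / v a'.
Proof.
move=> [a0 h] [a'0 h']; apply/eqP; rewrite eqr_div ?v_eq0 // -!rmorphM.
rewrite (inj_eq v_inj) -subr_eq0; apply: contraT => ne; case: u0_out.
apply: (b_pure ne); rewrite rmorphB scalerBl.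
have := aspanB (aspanZ a h') (aspanZ a' h); rewrite !scalerBr !scalerA -!rmorphM.
by rewrite [a * a']mulrC opprB addrC addrA subrK [a * c']mulrC [a' * c]mulrC.
Qed.

(** Choice extracts one representation; outside the pure closure the value is 0. *)
Definition pratio z : k :=
  if pselect (pclosure z) is left h then
    let a := projT1 (cid h) in let c := projT1 (cid (projT2 (cid h))) in v c / v a
  else 0.

Lemma ratioE z a c : ratio_of z a c -> pratio z = v c / v a.
Proof.
move=> h; rewrite /pratio; case: pselect => [h'|[]]; last by exists a, c.
by apply: ratio_uniq h; case: (cid h') => a' h'' /=; case: cid.
Qed.

Lemma ratio_ofD z z' a c a' c' : ratio_of z a c -> ratio_of z' a' c' ->
  ratio_of (z + z') (a * a') (a' * c + a * c').
Proof.
move=> [a0 h] [a'0 h']; split; first exact: phi_mulf_neq0.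
have := aspanD (aspanZ a' h) (aspanZ a h').
rewrite !scalerBr !scalerA -!rmorphM addrACA -opprD -scalerDl -rmorphD.
by rewrite [a' * a]mulrC -scalerDr.
Qed.

Lemma ratio_ofZ z a c e : ratio_of z a c -> ratio_of (phi e *: z) a (e * c).
Proof.
move=> [a0 h]; split=> //; have := aspanZ e h.
by rewrite scalerBr !scalerA -!rmorphM [e * a]mulrC.
Qed.

Lemma ratio_of_span z : aspan b z -> ratio_of z 1 0.
Proof.
move=> h; split; first exact: oner_neq0.
by rewrite rmorph1 rmorph0 scale1r scale0r subr0.
Qed.

Lemma ratio_of_u0 : ratio_of u0 1 1.
Proof. by split; [exact: oner_neq0 | rewrite subrr; apply: aspan0]. Qed.

Lemma closure_span z : aspan b z -> pclosure z.
Proof. by move=> h; exists 1, 0; apply: ratio_of_span. Qed.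

Lemma closureD x y : pclosure x -> pclosure y -> pclosure (x + y).
Proof.
by move=> [a [c h]] [a' [c' h']]; do 2!eexists; apply: ratio_ofD h h'.
Qed.

Lemma closureZ e x : pclosure x -> pclosure (phi e *: x).
Proof. by move=> [a [c h]]; do 2!eexists; apply: ratio_ofZ h. Qed.

Lemma closureB x y : pclosure x -> pclosure y -> pclosure (x - y).
Proof.
by move=> hx hy; apply: closureD => //; rewrite -scaleN1r -(rmorphN1 phi); apply: closureZ.
Qed.

Lemma closure_pure a z : a != 0 -> pclosure (phi a *: z) -> pclosure z.
Proof.
move=> a0 [a' [c [a'0 h]]]; exists (a' * a), c; split; first exact: phi_mulf_neq0.
by rewrite rmorphM -scalerA.
Qed.

Lemma ratioD x y : pclosure x -> pclosure y -> pratio (x + y) = pratio x + pratio y.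
Proof.
move=> [a [c h]] [a' [c' h']].
rewrite (ratioE (ratio_ofD h h')) (ratioE h) (ratioE h') !rmorphD !rmorphM.
have a0 : v a != 0 by rewrite v_eq0 //; case: h.
have a'0 : v a' != 0 by rewrite v_eq0 //; case: h'.
by field; rewrite a0 a'0.
Qed.

Lemma ratioZ e x : pclosure x -> pratio (phi e *: x) = v e * pratio x.
Proof.
by move=> [a [c h]]; rewrite (ratioE (ratio_ofZ e h)) (ratioE h) rmorphM mulrA.
Qed.

Lemma ratio_span x : aspan b x -> pratio x = 0.
Proof. by move=> /ratio_of_span/ratioE->; rewrite rmorph0 mul0r. Qed.

Lemma ratio_u0 : pratio u0 = 1.
Proof. by rewrite (ratioE ratio_of_u0) rmorph1 divr1. Qed.

Lemma ratio_eq0 x : pclosure x -> pratio x = 0 -> aspan b x.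
Proof.
move=> [a [c h]]; rewrite (ratioE h) => /eqP.
case: h => a0 h; rewrite mulf_eq0 invr_eq0 !v_eq0 // (negbTE a0) orbF => /eqP c0.
by apply: (b_pure a0); move: h; rewrite c0 rmorph0 scale0r subr0.
Qed.

Lemma ratioN x : pclosure x -> pratio (- x) = - pratio x.
Proof. by move=> hx; rewrite -scaleN1r -(rmorphN1 phi) ratioZ // rmorphN1 mulN1r. Qed.

Lemma ratio_sum n (c : nat -> A) (L : seq X) : (forall l, (l < n)%N -> pclosure L`_l) ->
  pclosure (\sum_(l < n) phi (c l) *: L`_l) /\
  pratio (\sum_(l < n) phi (c l) *: L`_l) = \sum_(l < n) v (c l) * pratio L`_l.
Proof.
elim: n => [|n IH] hL.
  rewrite !big_ord0; split; last exact/ratio_span/aspan0.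
  exact/closure_span/aspan0.
have [cl rl] := IH (fun l lt => hL l (ltnW lt)).
have cn : pclosure (phi (c n) *: L`_n) by apply: closureZ; apply: hL.
rewrite !big_ord_recr /=; split; first exact: closureD.
by rewrite ratioD // rl ratioZ //; apply: hL.
Qed.

(** A dual basis for the ideal of ratios: each z |-> y l * pratio z is an A-valued functional
    vanishing on the span of b, and the last clause makes these functionals recover the ratio from
    the generators L. *)
Lemma closure_dual : exists (L : seq X) (y : nat -> k),
  [/\ forall l, (l < size L)%N -> pclosure L`_l,
      forall z, pclosure z -> aspan L z,
      forall l z, (l < size L)%N -> pclosure z -> exists a, y l * pratio z = v a
    & \sum_(l < size L) y l * pratio L`_l = 1].
Proof.
have [||||L0 [L0c L0P]] := @tame _ _ _ _ phi phi_inj T r r_gt0 size_T (u0 :: b) pclosure.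
- exact/closure_span/aspan0.
- exact: closureB.
- by move=> x; apply: closureZ.
- move=> z [a [c [a0 h]]]; exists a => //.
  rewrite -[_ *: z](subrK (phi c *: u0)); apply: aspanD.
    by apply: aspan_sub h => x xb; apply: aspan_mem; rewrite inE xb orbT.
  by apply: aspanZ; apply: aspan_mem; rewrite inE eqxx.
(* u0 is put in because its ratio 1 must be among the generators of the fractional ideal. *)
pose L := u0 :: L0.
have Lc x : x \in L -> pclosure x.
  by rewrite inE => /predU1P[->|/L0c//]; exists 1, 1; apply: ratio_of_u0.
have Lcn l : (l < size L)%N -> pclosure L`_l by move=> lt; apply/Lc/mem_nth.
have LP z : pclosure z -> aspan L z.
  by move=> /L0P; apply: aspan_sub => x xL; apply: aspan_mem; rewrite inE xL orbT.
have [d d0 dP] : exists2 d, d != 0 &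
    forall x, x \in L -> exists a, v d * pratio x = v a.
  elim: L Lc {LP Lcn} => [|x s IH] Ls; first by exists 1; rewrite ?oner_neq0.
  have [|d d0 dP] := IH; first by move=> y ys; apply: Ls; rewrite inE ys orbT.
  have [a [c h]] : pclosure x by apply: Ls; rewrite inE eqxx.
  have a0 : a != 0 by case: h.
  exists (a * d); first exact: phi_mulf_neq0.
  move=> y; rewrite inE => /predU1P[->|/dP[e he]].
    exists (d * c); rewrite (ratioE h) !rmorphM; have va0 : v a != 0 by rewrite v_eq0.
    by field.
  by exists (a * e); rewrite !rmorphM -he mulrA.
have [||y [yA y1]] := @fractional_ideal_invertible _ _ v v_inj A_closed
   (fun a a0 => residues phi_inj r_gt0 size_T a0) (map pratio L) d d0.
- by apply/mapP; exists u0; rewrite ?ratio_u0 // inE eqxx.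
- by move=> _ /mapP[x xL ->]; apply: dP.
rewrite size_map in yA y1.
have rL l : (l < size L)%N -> (map pratio L)`_l = pratio L`_l.
  by move=> lt; rewrite (nth_map 0).
exists L, y; split=> // [l z lt_l /LP[c ->]|]; last first.
  by rewrite -[RHS]y1; apply: eq_bigr => l _; rewrite rL.
have [_ ->] := ratio_sum c Lcn; rewrite mulr_sumr.
have /choice[e eP] : forall m, exists a, (m < size L)%N -> y l * pratio L`_m = v a.
  move=> m; have [lt_m|] := boolP (m < size L)%N; last by exists 0.
  by have [a ha] := yA _ _ lt_l lt_m; exists a; rewrite -ha rL.
exists (\sum_(m < size L) c m * e m); rewrite rmorph_sum; apply: eq_bigr => m _.
by rewrite rmorphM -eP // mulrCA.
Qed.

End Ratio.

Lemma aspan_nil z : aspan [::] z <-> z = 0.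
Proof. by split=> [[c ->]|->]; [rewrite big_ord0 | apply: aspan0]. Qed.

Lemma pure_nil : pure [::].
Proof. by move=> a w a0 /aspan_nil/(act_eq0 a0)->; apply: aspan0. Qed.

(** Right multiplication by z commutes with the action of A, preserves the pure closure of A in
    [{poly D}], and multiplies ratios by c / a. As this closure is finitely generated, c / a is
    integral over A. *)
Lemma phi_image_pure (a c : A) (z : D) : a != 0 -> phi a * z = phi c ->
  exists e, z = phi e.
Proof.
move=> a0 az.
have out : ~ aspan [::] 1 by move=> /aspan_nil/eqP; rewrite oner_eq0.
have [L [y [Lc LP _ y1]]] := closure_dual pure_nil out.
have rz w : pclosure [::] 1 w -> pclosure [::] 1 (w * z%:P) /\
    pratio [::] 1 (w * z%:P) = v c / v a * pratio [::] 1 w.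
  move=> [f [e h]]; have h' : ratio_of [::] 1 (w * z%:P) (a * f) (e * c).
    case: h => f0 /aspan_nil/eqP; rewrite subr_eq0 => /eqP h.
    split; first exact: phi_mulf_neq0.
    apply/aspan_nil/eqP; rewrite subr_eq0 rmorphM -scalerA scalerAl h.
    have e1 : phi a *: z%:P = phi c *: 1 :> X by rewrite -mul_polyC -polyCM az alg_polyC.
    by rewrite -scalerAl mul1r scalerA -rmorphM [a * e]mulrC !rmorphM -!scalerA e1.
  split; first by exists (a * f), (e * c).
  rewrite (ratioE pure_nil out h') (ratioE pure_nil out h) !rmorphM.
  have va : v a != 0 by rewrite v_eq0.
  have vf : v f != 0 by rewrite v_eq0 //; case: h.
  by field; rewrite va vf.
suff /A_closed[e ye] : integralOver v (v c / v a).
  have ce : c = a * e.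
    by apply: v_inj; rewrite rmorphM -ye mulrC divfK // v_eq0.
  exists e; move: az; rewrite ce rmorphM => /tau_mulfI; apply.
  by rewrite phi_eq0.
have /choice[M MP] l : exists m : nat -> A, (l < size L)%N ->
    L`_l * z%:P = \sum_(j < size L) phi (m j) *: L`_j.
  have [lt_l|] := boolP (l < size L)%N; last by exists (fun=> 0).
  by have [m mP] := LP _ (rz _ (Lc _ lt_l)).1; exists m.
apply: (@integral_of_stable _ _ v (size L) (\row_l pratio [::] 1 L`_l) (\matrix_(m, l) M l m)).
  apply/eqP => /rowP w0; move/eqP: y1; rewrite big1 1?eq_sym ?oner_eq0 // => l _.
  by have := w0 l; rewrite !mxE => ->; rewrite mulr0.
apply/rowP => l; rewrite !mxE.
have [_ <-] := rz _ (Lc l (ltn_ord l)); rewrite MP //.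
have [_ ->] := ratio_sum pure_nil out (M l) Lc.
by apply: eq_bigr => m _; rewrite !mxE mulrC.
Qed.

End FreeOverA.

(** * An A-basis of {poly F{tau}} *)

Section Basis.
Variables (Fq : finFieldType) (F : closedFieldType) (g : {rmorphism Fq -> F}).
Variables (A : comNzRingType) (phi : {rmorphism A -> twisted_poly g}).
Hypothesis phi_inj : injective phi.
Variables (T : A) (r : nat).
Hypotheses (r_gt0 : (0 < r)%N) (size_T : tau_size (phi T) = r.+1).
Variables (k : fieldType) (v : {rmorphism A -> k}).
Hypothesis v_inj : injective v.
Hypothesis A_closed : forall y, integralOver v y -> exists a, y = v a.
Local Notation D := (twisted_poly g).
Local Notation X := {poly D}.
Local Notation aspan := (@aspan _ _ _ _ phi).
Local Notation pure := (@pure _ _ _ _ phi).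
Local Notation independent := (@independent _ _ _ _ phi).

(* An ideal I is a direct summand of A^N, with a complement I' such that      *)
(* I + I' = A^N. Here I is the pure closure of <b, u0> modulo <b>, and I' is  *)
(* taken inside the span of 'X^M, ..., 'X^(M+N-1), where M is so large that   *)
(* these are independent of everything considered before.                     *)
Lemma extend_basis_out (b : seq X) (u0 : X) : independent b -> pure b ->
  ~ aspan b u0 ->
  exists b', [/\ independent (b ++ b'), pure (b ++ b') & aspan (b ++ b') u0].
Proof.
move=> b_ind b_pure u0_out.
have [L [y [Lc LP yA y1]]] :=
  closure_dual phi_inj r_gt0 size_T v_inj A_closed b_pure u0_out.
(* Everything built from b and L lives in degrees below M, so the coefficients from M on can be read
   off separately. *)
pose N := size L; pose M := \max_(z <- b ++ L) size z.
pose rho := pratio phi v b u0; pose cl := pclosure phi b u0.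
have /choice[f0 f0P] (lz : nat * X) : exists a,
    (lz.1 < N)%N -> cl lz.2 -> y lz.1 * rho lz.2 = v a.
  have [lt_l|] := boolP (lz.1 < N)%N; last by exists 0.
  have [h|nh] := pselect (cl lz.2); last by exists 0.
  by have [a ha] := yA _ _ lt_l h; exists a.
pose f l z := f0 (l, z).
have fP l z : (l < N)%N -> cl z -> y l * rho z = v (f l z) by move=> lt_l hz; apply: (f0P (l, z)).
have szb l : (size (b`_l)%R <= M)%N.
  have [lt_l|le_l] := ltnP l (size b); last by rewrite nth_default // size_poly0.
  by apply: leq_bigmax_seq => //; rewrite mem_cat mem_nth.
have szL l : (size (L`_l)%R <= M)%N.
  have [lt_l|le_l] := ltnP l (size L); last by rewrite nth_default // size_poly0.
  by apply: leq_bigmax_seq => //; rewrite mem_cat orbC mem_nth.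
have sz_sum n (c : nat -> A) (s : seq X) : (forall l, (size (s`_l)%R <= M)%N) ->
    (size (\sum_(l < n) phi (c l) *: s`_l)%R <= M)%N.
  move=> hs; apply: (leq_trans (size_sum _ _ _)); apply/bigmax_leqP => l _.
  by apply: leq_trans (size_scale_leq _ _) _.
pose fresh (c : nat -> A) : X := \sum_(m < N) phi (c m) *: 'X^(M + m).
have coef_fresh c m : (m < N)%N -> (fresh c)`_(M + m) = phi (c m).
  move=> lt_m; rewrite coef_sum (bigD1 (Ordinal lt_m)) //= coefZ coefXn eqxx mulr1.
  rewrite big1 ?addr0 // => l /eqP ne; rewrite coefZ coefXn eqn_add2l.
  case: eqP => [e|_]; last by rewrite mulr0.
  by case: ne; apply: val_inj.
have coef_fresh0 c i : (i < M)%N -> (fresh c)`_i = 0.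
  move=> lt_i; rewrite coef_sum big1 // => m _; rewrite coefZ coefXn.
  by rewrite ltn_eqF ?mulr0 // (leq_trans lt_i) ?leq_addr.
(* On A^N the map c |-> (f m (Lsum c))_m is idempotent, with image a copy of I. The new vectors are
   the images of the standard basis under c |-> [Lsum c] plus the I'-part of c, written in fresh
   coordinates. *)
pose b'_ l : X := L`_l + 'X^(M + l) - \sum_(m < N) phi (f m L`_l) *: 'X^(M + m).
pose b' := mkseq b'_ N.
have sb' : size b' = N by rewrite size_mkseq.
pose Lsum (c : nat -> A) : X := \sum_(l < N) phi (c l) *: L`_l.
have Lsum_cl c : cl (Lsum c) by have [] := ratio_sum phi_inj v_inj b_pure u0_out c Lc.
have rho_Lsum c : rho (Lsum c) = \sum_(l < N) v (c l) * rho L`_l.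
  by have [] := ratio_sum phi_inj v_inj b_pure u0_out c Lc.
have f_Lsum c m : (m < N)%N -> f m (Lsum c) = \sum_(l < N) c l * f m L`_l.
  move=> lt_m; apply: v_inj; rewrite -fP // rho_Lsum rmorph_sum mulr_sumr.
  by apply: eq_bigr => l _; rewrite rmorphM -fP //; [rewrite mulrCA | apply: Lc].
have sum_b' (c : nat -> A) : \sum_(l < N) phi (c l) *: b'`_l =
    Lsum c + fresh (fun m => c m - f m (Lsum c)).
  transitivity (\sum_(l < N) phi (c l) *: b'_ l).
    by apply: eq_bigr => l _; rewrite nth_mkseq.
  transitivity (Lsum c + (fresh c - \sum_(l < N) \sum_(m < N)
      phi (c l * f m L`_l) *: 'X^(M + m))).
    rewrite -sumrB -big_split; apply: eq_bigr => l _ /=.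
    rewrite scalerBr scalerDr addrA scaler_sumr; congr (_ - _).
    by apply: eq_bigr => m _; rewrite rmorphM scalerA.
  congr (_ + _); rewrite exchange_big -sumrB; apply: eq_bigr => m _ /=.
  by rewrite f_Lsum // rmorphB rmorph_sum scalerBl scaler_suml.
have spanE w : aspan (b ++ b') w <-> exists2 x, aspan b x & exists c : nat -> A,
    w = x + (Lsum c + fresh (fun m => c m - f m (Lsum c))).
  split=> [[c ->]|[_ [d ->] [c ->]]].
    rewrite size_cat big_split_ord /=; exists (\sum_(l < size b) phi (c l) *: b`_l).
      by exists c.
    exists (fun l => c (size b + l)%N); rewrite -sum_b' -sb'; congr (_ + _).
      by apply: eq_bigr => l _; rewrite nth_cat ltn_ord.
    by apply: eq_bigr => l _; rewrite nth_cat ltnNge leq_addr /= addKn.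
  exists (fun l => if (l < size b)%N then d l else c (l - size b)%N).
  rewrite size_cat big_split_ord /= -sum_b' -sb'; congr (_ + _).
    by apply: eq_bigr => l _; rewrite nth_cat ltn_ord.
  by apply: eq_bigr => l _; rewrite nth_cat ltnNge leq_addr /= addKn.
have rho_span x z : aspan b x -> cl z -> rho (x + z) = rho z.
  move=> hx hz; rewrite /rho ratioD //; last exact: closure_span.
  by rewrite ratio_span // add0r.
(* The coordinates [f l z] are fixed by the idempotent, so their fresh part vanishes; by [y1],
   [Lsum c] has the ratio of z, and the two differ by an element of the span of b. *)
have span_cl z : cl z -> aspan (b ++ b') z.
  move=> hz; apply/spanE; pose c l := f l z.
  have rc : rho (Lsum c) = rho z.
    rewrite rho_Lsum -[RHS]mul1r -y1 mulr_suml; apply: eq_bigr => l _.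
    by rewrite -fP // mulrAC.
  exists (z - Lsum c); last first.
    exists c; rewrite addrA subrK /fresh big1 ?addr0 // => m _.
    suff -> : c m = f m (Lsum c) by rewrite subrr rmorph0 scale0r.
    by apply: v_inj; rewrite -!fP // rc.
  apply: (ratio_eq0 v_inj b_pure u0_out); first by apply: closureB => //; apply: Lsum_cl.
  rewrite ratioD // ?ratioN //; try exact: Lsum_cl; last first.
    rewrite -[- _]add0r; apply: closureB => //; last exact: Lsum_cl.
    by apply: closure_span; apply: aspan0.
  by move: rc; rewrite /rho => ->; rewrite subrr.
exists b'; split; last 1 first.
- by apply: span_cl; exists 1, 1; apply: ratio_of_u0.
- move=> c; rewrite size_cat big_split_ord /=.
  pose c' l := c (size b + l)%N; pose x := \sum_(l < size b) phi (c l) *: b`_l.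
  have -> : \sum_(l < size b) phi (c l) *: (b ++ b')`_l = x.
    by apply: eq_bigr => l _; rewrite nth_cat ltn_ord.
  have -> : \sum_(l < size b') phi (c (size b + l)%N) *: (b ++ b')`_(size b + l) =
      \sum_(l < N) phi (c' l) *: b'`_l.
    by rewrite -sb'; apply: eq_bigr => l _; rewrite nth_cat ltnNge leq_addr /= addKn.
  rewrite sum_b' addrA => h.
  have sxz : (size (x + Lsum c')%R <= M)%N.
    by rewrite (leq_trans (size_polyD _ _)) // geq_max !sz_sum.
  (* The coefficients from M on give this; those below M then give x + Lsum c' = 0, so the ratio of
     [Lsum c'] is 0 and with it every c' m. *)
  have c'f m : (m < N)%N -> c' m = f m (Lsum c').
    move=> lt_m; apply/eqP; rewrite -subr_eq0 -(phi_eq0 phi_inj).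
    rewrite -(coef_fresh (fun m => c' m - f m (Lsum c'))) //.
    have /polyP/(_ (M + m)%N) := h; rewrite coefD coef0 nth_default ?add0r => [->//|].
    by rewrite (leq_trans sxz) ?leq_addr.
  have xz0 : x + Lsum c' = 0.
    move: h; rewrite [fresh _]big1 ?addr0 // => m _.
    by rewrite -c'f // subrr rmorph0 scale0r.
  have c'0 m : (m < N)%N -> c' m = 0.
    move=> lt_m; rewrite c'f //; apply: v_inj; rewrite -fP // rmorph0.
    have bx : aspan b x by exists c.
    rewrite -(rho_span x) // xz0 /rho ratio_span ?mulr0 //; exact: aspan0.
  have x0 : x = 0.
    by move: xz0; rewrite [Lsum _]big1 ?addr0 // => l _; rewrite c'0 // rmorph0 scale0r.
  move=> l lt_l; have [lt_lb|le_bl] := ltnP l (size b); first exact: b_ind x0 l lt_lb.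
  rewrite -(subnKC le_bl); apply: c'0.
  by rewrite -sb' -(ltn_add2l (size b)) subnKC.
- move=> a w a0 /spanE[x bx [c hc]].
  (* Truncation splits the problem. The part below M lies in the pure closure, so f m z = a * f m
     w0; above M, divisibility by [phi a] in D becomes divisibility by a in A. Hence a divides all c
     m. *)
  pose z := Lsum c; pose w0 := take_poly M w.
  have sxz : (size (x + z)%R <= M)%N.
    by rewrite (leq_trans (size_polyD _ _)) // geq_max sz_sum // andbT; case: bx => d ->; rewrite sz_sum.
  have aw0 : phi a *: w0 = x + z.
    apply/polyP => i; rewrite coefZ coef_take_poly.
    case: ltnP => [lt_i|le_i]; last by rewrite mulr0 nth_default // (leq_trans sxz).
    by rewrite -coefZ hc addrA coefD coef_fresh0 ?addr0.
  have cl_z : cl z by exact: Lsum_cl.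
  have cl_xz : cl (x + z) by apply: closureD => //; exact: closure_span.
  have cl_w0 : cl w0 by apply: (closure_pure phi_inj a0); rewrite aw0.
  have rz : rho z = v a * rho w0.
    by rewrite -(rho_span x z) // -aw0 /rho ratioZ.
  have fz m : (m < N)%N -> f m z = a * f m w0.
    by move=> lt_m; apply: v_inj; rewrite rmorphM -!fP // rz mulrCA.
  have /choice[e eP] m : exists e, (m < N)%N -> c m - f m z = a * e.
    have [lt_m|] := boolP (m < N)%N; last by exists 0.
    have : phi a * w`_(M + m) = phi (c m - f m z).
      rewrite -coefZ hc addrA coefD coef_fresh // nth_default ?add0r //.
      by rewrite (leq_trans sxz) ?leq_addr.
    move=> h; have [e he] := phi_image_pure phi_inj r_gt0 size_T v_inj A_closed a0 h.
    by exists e => _; apply: phi_inj; rewrite -h he rmorphM.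
  pose c1 m := e m + f m w0.
  have cE m : (m < N)%N -> c m = a * c1 m.
    by move=> lt_m; rewrite mulrDr -fz // -eP // subrK.
  pose s := \sum_(l < N) phi (c1 l) *: b'`_l.
  have hs : phi a *: s = Lsum c + fresh (fun m => c m - f m (Lsum c)).
    rewrite -sum_b' scaler_sumr; apply: eq_bigr => l _.
    by rewrite scalerA -rmorphM -cE.
  have bws : aspan b (w - s).
    by apply: (b_pure a) => //; rewrite scalerBr hs hc addrK.
  by apply/spanE; exists (w - s) => //; exists c1; rewrite -sum_b' subrK.
Qed.

Lemma extend_basis (b : seq X) (u : X) : independent b -> pure b ->
  exists b', [/\ (0 < size b')%N, independent (b ++ b'), pure (b ++ b') & aspan (b ++ b') u].
Proof.
move=> b_ind b_pure.
have [u0 [u0_out h]] : exists u0, ~ aspan b u0 /\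
    forall b', aspan (b ++ b') u0 -> aspan (b ++ b') u.
  have [hu|nu] := pselect (aspan b u); last by exists u.
  (* When u is already in the span, a fresh power of 'X is adjoined instead, so that every stage
     grows and the final basis is infinite. *)
  exists 'X^(\max_(z <- b) size z); split; last first.
    by move=> b' _; apply: aspan_sub hu => x xb; apply: aspan_mem; rewrite mem_cat xb.
  case=> c /polyP/(_ (\max_(z <- b) size z)); rewrite coefXn eqxx coef_sum big1 => [/eqP|l _].
    by rewrite oner_eq0.
  by rewrite coefZ [_`_ _]nth_default ?mulr0 //; apply: leq_bigmax_seq => //; apply: mem_nth.
have [b' [hi hp hu]] := extend_basis_out b_ind b_pure u0_out.
exists b'; split=> //; last exact: h.
by case: b' hu {hi hp} => //; rewrite cats0.
Qed.

Lemma A_basis (e : nat -> X) : (forall x, exists n, x = e n) ->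
  exists beta : nat -> X,
    (forall n (c : nat -> A), \sum_(l < n) phi (c l) *: beta l = 0 ->
       forall l, (l < n)%N -> c l = 0) /\
    (forall x, exists n (c : nat -> A), x = \sum_(l < n) phi (c l) *: beta l).
Proof.
move=> e_surj.
have /choice[nx nxP] (bn : seq X * nat) : exists b', independent bn.1 -> pure bn.1 ->
    [/\ (0 < size b')%N, independent (bn.1 ++ b'), pure (bn.1 ++ b')
      & aspan (bn.1 ++ b') (e bn.2)].
  have [[hi hp]|nh] := pselect (independent bn.1 /\ pure bn.1).
    by have [b' hb'] := extend_basis (e bn.2) hi hp; exists b'.
  by exists [::] => hi hp; case: nh.
pose B := fix B n := if n is m.+1 then B m ++ nx (B m, m) else [::].
have BP n : independent (B n) /\ pure (B n).
  elim: n => [|n [hi hp]]; first by split; [| apply: pure_nil].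
  by have [] := nxP (B n, n) hi hp.
have Bsize n : (n <= size (B n))%N.
  elim: n => // n IH /=; have [hi hp] := BP n; have [h _ _ _] := nxP (B n, n) hi hp.
  by rewrite size_cat -addn1 leq_add.
have Bnth n m i : (n <= m)%N -> (i < size (B n))%N -> (B m)`_i = (B n)`_i.
  move=> le_nm lt_i; rewrite -(subnKC le_nm); elim: (m - n)%N => [|d IH]; first by rewrite addn0.
  rewrite addnS /= nth_cat; case: ifP => // /negbT; rewrite -leqNgt => le_di.
  have: (size (B n) <= size (B (n + d)))%N.
    elim: d {IH le_di} => [|d IH]; first by rewrite addn0.
    by rewrite addnS /= size_cat (leq_trans IH) ?leq_addr.
  by move=> /(leq_trans lt_i); rewrite ltnNge le_di.
(* Stage i + 1 has at least i + 1 vectors, and later stages only append. *)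
pose beta i := (B i.+1)`_i.
have betaE n i : (i < size (B n))%N -> (B n)`_i = beta i.
  move=> lt_i; have [le_n|/ltnW le_n] := leqP n i.+1; first by rewrite /beta (Bnth n).
  by rewrite (Bnth i.+1).
exists beta; split=> [n c h l lt_l|x].
  have [hi _] := BP n; pose c' l := if (l < n)%N then c l else 0.
  have := hi c' _ l (leq_trans lt_l (Bsize n)); rewrite /c' lt_l; apply.
  rewrite -[RHS]h [RHS](big_ord_widen _ (fun l => phi (c l) *: beta l) (Bsize n)).
  rewrite [RHS]big_mkcond /=; apply: eq_bigr => m _.
  by case: ifP => _; rewrite ?rmorph0 ?scale0r // betaE.
have [n ->] := e_surj x; have [hi hp] := BP n.
have [c ->] : aspan (B n.+1) (e n) by have [_ _ _] := nxP (B n, n) hi hp.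
by exists (size (B n.+1)), c; apply: eq_bigr => l _; rewrite betaE.
Qed.

End Basis.

(** * An F{tau}-basis of K modulo F *)

Lemma enum_infinite (P : nat -> Prop) : (forall N, exists m, (N <= m)%N /\ P m) ->
  exists e : nat -> nat, [/\ injective e, forall i, P (e i)
    & forall m, P m -> exists i, e i = m].
Proof.
move=> Pinf.
have /choice[nx nxP] N : exists m, [/\ (N <= m)%N, P m
    & forall m', (N <= m')%N -> P m' -> (m <= m')%N].
  have ex : exists m, (N <= m)%N && `[< P m >].
    by have [m [le Pm]] := Pinf N; exists m; rewrite le; apply/asboolP.
  case: (ex_minnP ex) => m /andP[le /asboolP Pm] min; exists m; split=> // m' le' Pm'.
  by apply: min; rewrite le'; apply/asboolP.
pose e := fix e i := if i is i'.+1 then nx (e i').+1 else nx 0%N.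
have eS i : (e i < e i.+1)%N by case: (nxP (e i).+1).
have e_mono i d : (e i < e (i + d).+1)%N.
  elim: d => [|d IH]; first by rewrite addn0.
  by rewrite addnS; apply: ltn_trans IH (eS _).
have e_lt i l : (i < l)%N -> (e i < e l)%N.
  by move=> lt; rewrite -(subnKC lt) addSn.
exists e; split=> [i l eil|i|m Pm].
- by have [/e_lt|/e_lt|//] := ltngtP i l; rewrite eil ltnn.
- by case: i => [|i] /=; [case: (nxP 0%N) | case: (nxP (e i).+1)].
apply: contrapT => ne; have lt_em i : (e i < m)%N.
  elim: i => [|i IH]; rewrite ltn_neqAle; apply/andP; split.
  - by apply/eqP => h; apply: ne; exists 0%N.
  - by case: (nxP 0%N) => _ _; apply.
  - by apply/eqP => h; apply: ne; exists i.+1.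
  - by case: (nxP (e i).+1) => _ _; apply.
have le_e i : (i <= e i)%N by elim: i => // i IH; apply: leq_ltn_trans IH (eS i).
by have := lt_em m; rewrite ltnNge le_e.
Qed.

Lemma algebraic_in_closed (F : closedFieldType) (K : fieldType) (j : {rmorphism F -> K})
  (t : K) (P : {poly F}) : P != 0 -> root (map_poly j P) t -> exists c, t = j c.
Proof.
move=> P0; have [rs ->] := closed_field_poly_normal P.
rewrite map_polyZ rootZ ?fmorph_eq0 ?lead_coef_eq0 //= rmorph_prod /=.
elim: rs => [|c rs IH]; first by rewrite big_nil (negbTE (root1 _)).
rewrite big_cons rootM => /orP[|/IH//].
by rewrite map_polyXsubC root_XsubC => /eqP->; exists c.
Qed.

Lemma linear_dependence (F : fieldType) N (C : nat -> nat -> F) :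
  exists u : nat -> F, (exists2 i, (i < N.+1)%N & u i != 0) /\
    forall l, (l < N)%N -> \sum_(i < N.+1) u i * C i l = 0.
Proof.
pose M : 'M[F]_(N.+1, N) := \matrix_(i, l) C i l.
have: kermx M != 0.
  by rewrite -mxrank_eq0 mxrank_ker subn_eq0 -ltnNge ltnS rank_leq_col.
case/rowV0Pn => w /sub_kermxP wM w0.
pose u i := w 0 (inord i); exists u; split; last first.
  move=> l lt_l; have /rowP/(_ (Ordinal lt_l)) := wM; rewrite !mxE => h.
  by rewrite -[RHS]h; apply: eq_bigr => i _; rewrite !mxE /u inord_val.
apply: contrapT => nu; case/negP: w0; apply/eqP/rowP => i; rewrite mxE.
apply/eqP; apply: contrapT => /negP wi; apply: nu; exists (nat_of_ord i); first exact: ltn_ord.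
by rewrite /u inord_val.
Qed.

Section TauBasis.
Variables (Fq : finFieldType) (F : closedFieldType) (g : {rmorphism Fq -> F}).
Variables (K : fieldType) (j : {rmorphism F -> K}).
Local Notation D := (twisted_poly g).
Local Notation X := {poly D}.
Local Notation q := #|Fq|.
Local Notation fr := (@qpow Fq K (j \o g) 1).
Local Notation ev1 := (@tau_eval Fq F g K j).

Lemma frE (z : K) : fr z = z ^+ q. Proof. by rewrite qpowE expn1. Qed.

Lemma tau_eval0l x : ev1 0 x = 0.
Proof. by apply: (addrI (ev1 0 x)); rewrite -tau_evalDl !addr0. Qed.

Lemma tau_eval0r f : ev1 f 0 = 0.
Proof. by apply: (addrI (ev1 f 0)); rewrite -tau_evalDr !addr0. Qed.

Lemma tau_eval_sumr f n (x : nat -> K) :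
  ev1 f (\sum_(i < n) x i) = \sum_(i < n) ev1 f (x i).
Proof. exact: (big_morph _ (tau_evalDr j f) (tau_eval0r f)). Qed.

Lemma tau_eval_term c n x : ev1 (tau_term g c n) x = j c * @qpow Fq K (j \o g) n x.
Proof.
have [->|c0] := eqVneq c 0.
  have -> : tau_term g 0 n = 0 by apply: scale0r.
  by rewrite tau_eval0l rmorph0 mul0r.
rewrite /tau_eval; have -> : tau_size (tau_term g c n) = n.+1.
  by rewrite /tau_size /tau_term size_scale // size_polyXn.
rewrite big_ord_recr /= big1 ?add0r => [|i _]; rewrite tau_coef_term.
  by rewrite eqxx mulr1.
by rewrite ltn_eqF // mulr0 rmorph0 mul0r.
Qed.

(** Moving tau to the left of the coefficients takes q-th roots: this is where perfectness of F is
    used. *)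
Lemma tau_split n (f : D) : (tau_size f <= n.+1)%N ->
  exists f', (tau_size f' <= n)%N /\
    f = tau_term g (tau_coef f 0) 0 + tau_term g 1 1 * f'.
Proof.
move=> sf; have /choice[rt rtP] i := exists_root_pow (tau_coef f i.+1) (cardX_gt0 Fq 1).
pose f' : D := \poly_(i < n) rt i : {poly F}.
have cf' i : tau_coef f' i = if (i < n)%N then rt i else 0 by rewrite /tau_coef coef_poly.
exists f'; split; first exact: size_poly.
have st1 : (tau_size (tau_term g 1 1) <= 2)%N := tau_size_term _ _ _.
apply/polyP => i; rewrite -[LHS]/(tau_coef f i).
rewrite -[RHS]/(tau_coef (tau_term g (tau_coef f 0) 0 + tau_term g 1 1 * f') i).
rewrite tau_coefD tau_coef_term tau_coefM.
case: i => [|i]; rewrite ?mulr1 ?mulr0 ?add0r.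
  by rewrite big_ord1 tau_coef_term mulr0 mul0r addr0.
rewrite !big_ord_recl big1 ?addr0 /= => [|l _]; rewrite !tau_coef_term ?mulr0 ?mul0r //.
rewrite add0r !mul1r subSS subn0 cf' qpowE.
case: ifP => [_|/negbT]; first by rewrite rtP.
rewrite -leqNgt => le_ni; rewrite tau_coef_out ?(leq_trans sf) //.
by rewrite expr0n expn_eq0 -leqn0 leqNgt ltnW ?card_gt1.
Qed.

Section Evaluation.
Variable b : nat -> K.

(** The D-linear map from the free left module [{poly D}] to K that sends 'X^i to b i. *)
Definition ev (p : X) : K := \sum_(i < size p) ev1 p`_i (b i).

Lemma evE n (p : X) : (size p <= n)%N -> ev p = \sum_(i < n) ev1 p`_i (b i).
Proof.
move=> le_pn; rewrite /ev (big_ord_widen n (fun i => ev1 p`_i (b i)) le_pn).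
rewrite big_mkcond; apply: eq_bigr => i _; case: ltnP => // le.
by rewrite nth_default // tau_eval0l.
Qed.

Lemma evD p1 p2 : ev (p1 + p2) = ev p1 + ev p2.
Proof.
pose n := maxn (size p1) (size p2).
rewrite (@evE n) ?size_polyD // (@evE n p1) ?leq_maxl // (@evE n p2) ?leq_maxr //.
by rewrite -big_split; apply: eq_bigr => i _; rewrite coefD tau_evalDl.
Qed.

Lemma evZ f p : ev (f *: p) = ev1 f (ev p).
Proof.
rewrite (@evE (size p)) ?size_scale_leq // /ev.
rewrite (tau_eval_sumr f _ (fun i => ev1 p`_i (b i))).
by apply: eq_bigr => i _; rewrite coefZ tau_evalM.
Qed.

Lemma ev0 : ev 0 = 0.
Proof. by rewrite /ev size_poly0 big_ord0. Qed.

Lemma evXn i : ev 'X^i = b i.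
Proof.
rewrite (@evE i.+1) ?size_polyXn // big_ord_recr /= coefXn eqxx tau_eval1.
by rewrite big1 ?add0r // => l _; rewrite coefXn ltn_eqF // tau_eval0l.
Qed.

End Evaluation.

Variable x : nat -> K.
Hypothesis x_surj : forall z, exists m, z = x m.
Variable W : nat -> K -> Prop.
Hypothesis WD : forall n y z, W n y -> W n z -> W n (y + z).
Hypothesis WZ : forall n c z, W n z -> W n (j c * z).
Hypothesis W0 : forall z, W 0 z <-> exists c, z = j c.
Hypothesis WS : forall n z, W n z -> W n.+1 z.
Hypothesis Wall : forall z, exists n, W n z.
Hypothesis Wfrob : forall n z, W n.+1 (z ^+ q) -> W n z.
Hypothesis nontrivial : exists z, ~ exists c, z = j c.

Lemma W_mono m n z : (m <= n)%N -> W m z -> W n z.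
Proof.
by move=> /subnKC <-; elim: (n - m)%N => [|d IH] h; rewrite ?addn0 // addnS; apply/WS/IH.
Qed.

Lemma W_zero n : W n 0.
Proof. by apply: (@W_mono 0) => //; apply/W0; exists 0; rewrite rmorph0. Qed.

Definition redundant n m z := exists w y (c : nat -> F), W n w /\
  z = w + y ^+ q + \sum_(l < m | `[< W n.+1 (x l) >]) j (c l) * x l.

(** The greedy choice of a basis of W n.+1 modulo W n and q-th powers. [redundant] lets y range over
    all of K; [Wfrob] brings it into W n when needed. *)
Definition basis_index n m :=
  [/\ W n.+1 (x m), ~ W n (x m) & ~ redundant n m (x m)].

Lemma redundantD n m z z' : redundant n m z -> redundant n m z' -> redundant n m (z + z').
Proof.
move=> [w [y [c [Ww ->]]]] [w' [y' [c' [Ww' ->]]]].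
exists (w + w'), (y + y'), (fun l => c l + c' l); split; first exact: WD.
rewrite -[in RHS]frE rmorphD /= !frE addrACA -big_split /=; congr (_ + _).
  by rewrite addrACA.
by apply: eq_bigr => l _; rewrite rmorphD mulrDl.
Qed.

Lemma redundantZ n m a z : redundant n m z -> redundant n m (j a * z).
Proof.
move=> [w [y [c [Ww ->]]]]; have [a' a'P] := exists_root_pow a (ltnW (card_gt1 Fq)).
exists (j a * w), (j a' * y), (fun l => a * c l); split; first exact: WZ.
rewrite exprMn -rmorphXn a'P !mulrDr mulr_sumr; congr (_ + _).
by apply: eq_bigr => l _; rewrite rmorphM mulrA.
Qed.

Lemma redundantW n m w : W n w -> redundant n m w.
Proof.
move=> Ww; exists w, 0, (fun=> 0); split=> //.
rewrite expr0n -leqn0 leqNgt ltnW ?card_gt1 //= addr0 big1 ?addr0 // => l _.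
by rewrite rmorph0 mul0r.
Qed.

Lemma redundantX n m y : redundant n m (y ^+ q).
Proof.
exists 0, y, (fun=> 0); split; first exact: W_zero.
by rewrite add0r big1 ?addr0 // => l _; rewrite rmorph0 mul0r.
Qed.

Lemma redundant_prev n m l : (l < m)%N -> W n.+1 (x l) -> redundant n m (x l).
Proof.
move=> lt_lm Wl; exists 0, 0, (fun i => (i == l)%:R); split; first exact: W_zero.
rewrite expr0n -leqn0 leqNgt ltnW ?card_gt1 //= !add0r.
rewrite (bigD1 (Ordinal lt_lm)) /=; last exact/asboolP.
rewrite eqxx rmorph1 mul1r big1 ?addr0 // => i /andP[_ /eqP ne].
case: eqP => [e|_]; last by rewrite rmorph0 mul0r.
by case: ne; apply: val_inj.
Qed.

Lemma redundant_sum n m I (s : seq I) (P : pred I) (f : I -> K) :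
  (forall i, P i -> redundant n m (f i)) -> redundant n m (\sum_(i <- s | P i) f i).
Proof.
move=> h; elim/big_ind: _ => // [|y z]; last exact: redundantD.
exact/redundantW/W_zero.
Qed.

(** Induction on the level n, then on the position in the enumeration: a redundant x m reduces to W
    n, to the q-th power of an element of W n, and to earlier elements of the same level. *)
Lemma basis_generates (S : K -> Prop) :
  (forall c, S (j c)) -> (forall y z, S y -> S z -> S (y + z)) ->
  (forall c z, S z -> S (j c * z)) -> (forall z, S z -> S (z ^+ q)) ->
  (forall n m, basis_index n m -> S (x m)) -> forall z, S z.
Proof.
move=> Sj SD SZ SX Sb z; have [n] := Wall z.
elim: n z => [|n IH] z; first by move=> /W0[c ->].
have [m ->] := x_surj z; have [N] := ubnP m; elim: N m {z} => // N IHN m lt_mN Wm.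
have [Wn|nWn] := pselect (W n (x m)); first exact: IH.
have [hb|nb] := pselect (basis_index n m); first exact: Sb hb.
have [w [y [c [Ww xE]]]] : redundant n m (x m) by apply: contrapT => h; apply: nb.
have Wsum : W n.+1 (\sum_(l < m | `[< W n.+1 (x l) >]) j (c l) * x l).
  by elim/big_ind: _ => [|a b|l /asboolP]; [exact: W_zero | exact: WD | exact: WZ].
have Wy : W n y.
  apply: Wfrob; have -> : y ^+ q = x m + j (-1) * (w + \sum_(l < m | `[< W n.+1 (x l) >]) j (c l) * x l).
    by rewrite {1}xE rmorphN1; ring.
  by apply: WD => //; apply: WZ; apply: WD => //; apply: WS.
rewrite xE; apply: (SD); first by apply: (SD); [exact: IH | apply/SX/IH].
elim/big_ind: _ => [|a b|l /asboolP Wl].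
- by rewrite -(rmorph0 j).
- exact: SD.
- by apply: SZ; apply: IHN => //; apply: leq_trans (ltn_ord l) _; rewrite -ltnS.
Qed.

(** Otherwise K is spanned over F by N elements modulo K^q. For t outside K^q, the N + 1 elements t
    * t^(qi) are then dependent modulo K^q, which gives t s^q in K^q with s a nonzero polynomial in
    t. *)
Lemma basis_infinite N : exists m, (N <= m)%N /\ exists n, basis_index n m.
Proof.
apply: contrapT => fin.
have q0 : (0 < q)%N := ltnW (card_gt1 Fq).
pose S z := exists (c : nat -> F) y, z = \sum_(l < N) j (c l) * x l + y ^+ q.
have SX y : S (y ^+ q).
  by exists (fun=> 0), y; rewrite big1 ?add0r // => l _; rewrite rmorph0 mul0r.
have Sall z : S z.
  move: z; apply: basis_generates.
  - by move=> c; have [c' <-] := exists_root_pow c q0; rewrite rmorphXn; apply: SX.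
  - move=> _ _ [c [y ->]] [c' [y' ->]]; exists (fun l => c l + c' l), (y + y').
    rewrite -[in RHS]frE rmorphD /= !frE addrACA -big_split /=; congr (_ + _).
    by apply: eq_bigr => l _; rewrite rmorphD mulrDl.
  - move=> a _ [c [y ->]]; have [a' <-] := exists_root_pow a q0.
    exists (fun l => a' ^+ q * c l), (j a' * y); rewrite mulrDr mulr_sumr; congr (_ + _).
      by apply: eq_bigr => l _; rewrite rmorphM mulrA.
    by rewrite exprMn rmorphXn.
  - by move=> z _; apply: SX.
  move=> n m hb; have lt_mN : (m < N)%N.
    by rewrite ltnNge; apply/negP => le; apply: fin; exists m; split=> //; exists n.
  exists (fun l => (l == m)%:R), 0; rewrite expr0n gtn_eqF // addr0.
  rewrite (bigD1 (Ordinal lt_mN)) //= eqxx rmorph1 mul1r big1 ?addr0 // => i /eqP ne.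
  case: eqP => [e|_]; last by rewrite rmorph0 mul0r.
  by case: ne; apply: val_inj.
(* If all elements were q-th powers, [Wfrob] would take each of them down to W 0 = F. *)
have [t nt] : exists t : K, ~ exists y, t = y ^+ q.
  apply: contrapT => nt; have [z nz] := nontrivial; apply: nz.
  have [n] := Wall z; elim: n z => [|n IH] z; first by move=> /W0.
  have [y ->] : exists y, z = y ^+ q by apply: contrapT => h; apply: nt; exists z.
  by move=> /Wfrob/IH[c ->]; exists (c ^+ q); rewrite rmorphXn.
(* An algebraic t would lie in F, where everything is a q-th power. *)
have t_tr (P : {poly F}) : P != 0 -> (map_poly j P).[t] != 0.
  move=> P0; apply/negP => h; have [c tc] := algebraic_in_closed P0 h.
  by apply: nt; have [c' c'P] := exists_root_pow c q0; exists (j c'); rewrite tc -c'P rmorphXn.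
have /choice[C CP] i : exists cy : (nat -> F) * K,
    t * t ^+ (q * i) = \sum_(l < N) j (cy.1 l) * x l + cy.2 ^+ q.
  by have [c [y ->]] := Sall (t * t ^+ (q * i)); exists (c, y).
have [u [[i0 lt_i0 ui0] uC]] := linear_dependence N (fun i l => (C i).1 l).
have /choice[u' u'P] i := exists_root_pow (u i) q0.
pose P : {poly F} := \poly_(i < N.+1) u' i.
have P0 : P != 0.
  apply/eqP => /polyP/(_ i0); rewrite coef_poly lt_i0 coef0 => h.
  by move/eqP: ui0; rewrite -u'P h expr0n gtn_eqF.
pose s := (map_poly j P).[t].
have s0 : s != 0 by apply: t_tr.
have sE : s ^+ q = \sum_(i < N.+1) j (u i) * t ^+ (q * i).
  rewrite /s (@horner_coef_wide _ N.+1) ?size_map_poly ?size_poly // -frE rmorph_sum.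
  apply: eq_bigr => i _; rewrite /= frE exprMn coef_map coef_poly ltn_ord -rmorphXn u'P.
  by rewrite -exprM mulnC.
apply: nt; exists ((\sum_(i < N.+1) j (u' i) * (C i).2) / s).
rewrite expr_div_n; apply: (canRL (mulfK _)); first by rewrite expf_neq0.
rewrite sE mulr_sumr -[in RHS]frE rmorph_sum /=.
transitivity (\sum_(i < N.+1) (j (u i) * (\sum_(l < N) j ((C i).1 l) * x l) + j (u i) * (C i).2 ^+ q)).
  by apply: eq_bigr => i _; rewrite mulrCA CP mulrDr.
rewrite big_split /= [X in X + _](_ : _ = 0) ?add0r; last first.
  transitivity (\sum_(i < N.+1) \sum_(l < N) j (u i * (C i).1 l) * x l).
    by apply: eq_bigr => i _; rewrite mulr_sumr; apply: eq_bigr => l _; rewrite rmorphM mulrA.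
  rewrite exchange_big big1 // => l _ /=.
  by rewrite -mulr_suml -rmorph_sum uC // rmorph0 mul0r.
by apply: eq_bigr => i _; rewrite frE exprMn -rmorphXn u'P.
Qed.

(** Induction on the degree in tau. Write p as its constant coefficients plus tau p'. If the
    constants vanish, the value of p' lies in F too, F being perfect. Otherwise a dominant term
    would be redundant. *)
Lemma basis_independent (e : nat -> nat) : injective e ->
  (forall i, exists n, basis_index n (e i)) ->
  forall p : X, (exists y, ev (x \o e) p = j y) -> p = 0.
Proof.
move=> e_inj eP p; set b := x \o e.
have q0 : (0 < q)%N := ltnW (card_gt1 Fq).
have [N] := bnd_exists p; elim: N p => [|N IH] p hp [y hy]; first exact: bnd_eq0.
have /choice[f fP] i := tau_split (hp i).
pose p' : X := \poly_(i < size p) f i.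
pose c i := tau_coef p`_i 0.
have p'i i : (i < size p)%N -> p'`_i = f i by move=> lt; rewrite coef_poly lt.
have hp' : bnd N p'.
  by move=> i; rewrite coef_poly; case: ifP => _; rewrite ?tau_size0 //; case: (fP i).
have evp : ev b p = \sum_(i < size p) j (c i) * b i + ev b p' ^+ q.
  rewrite -frE -[X in _ = _ + X]mul1r -(rmorph1 j) -tau_eval_term -evZ.
  rewrite (@evE _ (size p) (_ *: p')) ?(leq_trans (size_scale_leq _ _)) ?size_poly //.
  rewrite /ev -big_split; apply: eq_bigr => i _.
  rewrite coefZ p'i // [in LHS](fP i).2 tau_evalDl tau_eval_term.
  by rewrite qpowE expn0 expr1.
have [c0|/existsNP[i0 /not_implyP[lt_i0 ci0]]] :=
    pselect (forall i, (i < size p)%N -> c i = 0).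
  have p'0 : p' = 0.
    apply: IH => //; have [y' y'P] := exists_root_pow y q0; exists y'.
    apply: (@qpow_inj Fq K (j \o g) 1); rewrite !frE -rmorphXn y'P -hy evp.
    by rewrite big1 ?add0r // => i _; rewrite c0 // rmorph0 mul0r.
  apply/polyP => i; rewrite coef0; have [lt_i|le] := ltnP i (size p); last by rewrite nth_default.
  rewrite (fP i).2 -/(c i) c0 // -p'i // p'0 coef0 mulr0 addr0.
  by apply: scale0r.
exfalso; have /choice[n nP] := eP.
(* Among the nonzero constants, the highest level wins, ties being broken by the position in the
   enumeration. All other terms then lie in W (n i1) or come earlier at the same level. *)
have [i1 [lt_i1 ci1 hmax]] : exists i1, [/\ (i1 < size p)%N, c i1 <> 0 &
    forall i, (i < size p)%N -> c i <> 0 -> i <> i1 ->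
      (n i < n i1)%N \/ (n i = n i1 /\ (e i < e i1)%N)].
  pose I := 'I_(size p).
  pose Q := [pred i : I | c i != 0].
  have Qi0 : Q (Ordinal lt_i0) by apply/eqP.
  case: (arg_maxnP (fun i : I => n i) Qi0) => i2 Qi2 max2.
  pose Q' := [pred i : I | (c i != 0) && (n i == n i2)].
  have Q'i2 : Q' i2 by rewrite /= eqxx andbT.
  case: (arg_maxnP (fun i : I => e i) Q'i2) => i3 /andP[/eqP ci3 /eqP n3] max3.
  exists i3; split=> // i lt_i /eqP ci ne.
  have := max2 (Ordinal lt_i) ci; rewrite /= n3 leq_eqVlt => /orP[/eqP ni|->]; last by left.
  right; split=> //; rewrite ltn_neqAle (inj_eq e_inj); apply/andP; split; first exact/eqP.
  by apply: (max3 (Ordinal lt_i)); rewrite /= ci; apply/eqP.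
have [_ _] := nP i1; apply.
have : redundant (n i1) (e i1) (j (c i1) * b i1).
  have -> : j (c i1) * b i1 = j y + j (-1) * (ev b p' ^+ q +
      \sum_(i < size p | i != Ordinal lt_i1) j (c i) * b i).
    rewrite -hy evp (bigD1 (Ordinal lt_i1)) //= rmorphN1; ring.
  apply: redundantD; first by apply: redundantW; apply: (@W_mono 0) => //; apply/W0; exists y.
  apply: redundantZ; apply: redundantD; first exact: redundantX.
  apply: redundant_sum => i ne; have [->|/eqP ci] := eqVneq (c i) 0.
    by rewrite rmorph0 mul0r; apply/redundantW/W_zero.
  apply: redundantZ; have ne' : val i <> i1 by move=> h; case/eqP: ne; apply: val_inj.
  have [Wi _ _] := nP i.
  case: (hmax i (ltn_ord i) ci ne') => [lt|[ni lt]].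
    by apply: redundantW; apply: W_mono Wi.
  by apply: redundant_prev => //; rewrite -ni.
move=> /(redundantZ (c i1)^-1); rewrite mulrA -rmorphM mulVf; last exact/eqP.
by rewrite rmorph1 mul1r.
Qed.

Lemma tau_basis : exists b : nat -> K,
  (forall z, exists y p, z = j y + ev b p) /\
  (forall p, (exists y, ev b p = j y) -> p = 0).
Proof.
have [e [e_inj eP e_surj]] := enum_infinite basis_infinite.
exists (x \o e); split; last exact: basis_independent.
have q0 : (0 < q)%N := ltnW (card_gt1 Fq).
apply: basis_generates.
- by move=> c; exists c, 0; rewrite ev0 addr0.
- move=> _ _ [y [p ->]] [y' [p' ->]]; exists (y + y'), (p + p').
  by rewrite rmorphD evD addrACA.
- move=> c _ [y [p ->]]; exists (c * y), (tau_term g c 0 *: p).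
  by rewrite evZ tau_eval_term qpowE expn0 expr1 mulrDr rmorphM.
- move=> _ [y [p ->]]; exists (y ^+ q), (tau_term g 1 1 *: p).
  by rewrite evZ tau_eval_term rmorph1 mul1r -frE rmorphD /= !frE rmorphXn.
- move=> n m hb; have [i <-] : exists i, e i = m by apply: e_surj; exists n.
  by exists 0, 'X^i; rewrite rmorph0 add0r evXn.
Qed.

End TauBasis.

(** * Pole orders over k(t) *)

Section PolyFacts.
Variable k : fieldType.

Lemma irreducible_factor (h : {poly k}) : (1 < size h)%N ->
  exists2 f, irreducible_poly f & f %| h.
Proof.
have [n] := ubnP (size h); elim: n h => // n IH h; rewrite ltnS => le_hn h1.
have [hi|nhi] := pselect (irreducible_poly h); first by exists h.
have [d [d1 dh nd]] : exists d : {poly k}, [/\ size d != 1%N, d %| h & ~~ (d %= h)].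
  apply: contrapT => nd; apply: nhi; split=> // d d1 dh; apply: contraT => ndh.
  by case: nd; exists d.
have h0 : h != 0 by rewrite -size_poly_gt0 ltnW.
have sd : (size d < size h)%N.
  by rewrite ltn_neqAle dvdp_leq // andbT dvdp_size_eqp.
have d_gt1 : (1 < size d)%N.
  rewrite ltn_neqAle eq_sym d1 size_poly_gt0; apply: contraNneq h0 => d0.
  by move: dh; rewrite d0 dvd0p.
have [f fi fd] := IH d (leq_trans sd le_hn) d_gt1.
by exists f => //; apply: dvdp_trans dh.
Qed.

Lemma irreducible_ndvdM (f h h' : {poly k}) : irreducible_poly f ->
  ~~ (f %| h) -> ~~ (f %| h') -> ~~ (f %| h * h').
Proof.
move=> fi fh fh'; rewrite Gauss_dvdpr //.
rewrite coprimep_def; apply/negPn/negP => ne.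
case/negP: fh; rewrite -(eqp_dvdl _ (fi _ ne (dvdp_gcdl _ _))).
exact: dvdp_gcdr.
Qed.

Lemma irreducible_ndvd1 (f : {poly k}) : irreducible_poly f -> ~~ (f %| 1).
Proof. by case=> f1 _; rewrite dvdp1; apply/negP => /eqP e; rewrite e in f1. Qed.

Lemma multiplicity (f a : {poly k}) : (1 < size f)%N -> a != 0 ->
  exists E h, [/\ a = f ^+ E * h, ~~ (f %| h) & (E <= size a)%N].
Proof.
move=> f1; have [n] := ubnP (size a); elim: n a => // n IH a; rewrite ltnS => le_an a0.
have [/dvdpP[b ab]|nfa] := boolP (f %| a); last first.
  by exists 0%N, a; rewrite expr0 mul1r.
have b0 : b != 0 by apply: contraNneq a0 => b0; rewrite ab b0 mul0r.
have f0 : f != 0 by rewrite -size_poly_gt0 ltnW.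
have sba : (size b < size a)%N.
  by rewrite ab size_mul // -(subnK f1) addnA addn2 /= ltnS leq_addr.
have [E [h [bE fh Eb]]] := IH b (leq_trans sba le_an) b0.
exists E.+1, h; split=> //; last exact: leq_ltn_trans sba.
by rewrite ab bE exprSr mulrAC.
Qed.

End PolyFacts.

Section LocalFiltration.
Variables (k K : fieldType) (e : {rmorphism {poly k} -> K}).
Hypothesis e_inj : injective e.
Variable q : nat.
Hypothesis q_gt1 : (1 < q)%N.
Hypothesis frob : forall x y : K, (x + y) ^+ q = x ^+ q + y ^+ q.
Variable n : nat.
Hypothesis deg_bound : forall x : K, exists p : nat -> {poly k},
  (exists2 l, (l < n.+1)%N & p l != 0) /\ \sum_(l < n.+1) e (p l) * x ^+ l = 0.

Local Notation Int := (integralOver e).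

Lemma e_eq0 p : (e p == 0) = (p == 0).
Proof. by rewrite -(inj_eq e_inj) rmorph0. Qed.

Lemma frobX m (x y : K) : (x + y) ^+ (q ^ m) = x ^+ (q ^ m) + y ^+ (q ^ m).
Proof. by elim: m => [|m IH]; rewrite ?expr1 // expnSr !exprM IH frob. Qed.

Lemma integral_exp x m : Int x -> Int (x ^+ m).
Proof.
move=> hx; elim: m => [|m IH]; first exact: integral1.
by rewrite exprS; apply: integral_mul.
Qed.

(** Multiply the equation by H^d: the coefficient H^(d-l) o l keeps at least one factor H, since l <
    d. *)
Lemma integral_clear d (H x : K) (o : nat -> K) : Int H ->
  (forall l, (l < d)%N -> Int (H * o l)) ->
  x ^+ d + \sum_(l < d) o l * x ^+ l = 0 -> Int (H * x).
Proof.
move=> HI oI hx; pose P : {poly K} := \poly_(l < d) (H ^+ (d - l) * o l).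
have sP : (size P < size ('X^d : {poly K}))%N by rewrite size_polyXn ltnS size_poly.
apply: (@integral_root_monic _ _ e _ ('X^d + P)).
- by rewrite monicE lead_coefDl // lead_coefXn.
- rewrite /root hornerD hornerXn (@horner_coef_wide _ d P) ?size_poly //.
  have -> : \sum_(l < d) P`_l * (H * x) ^+ l = H ^+ d * \sum_(l < d) o l * x ^+ l.
    rewrite mulr_sumr; apply: eq_bigr => l _; rewrite coef_poly ltn_ord exprMn.
    have -> : H ^+ d = H ^+ (d - l) * H ^+ l by rewrite -exprD subnK // ltnW.
    by rewrite mulrACA.
  by rewrite exprMn -mulrDr hx mulr0.
apply/integral_poly => l; rewrite coefD coefXn coef_poly.
have [lt_l|le_dl] := ltnP l d; last by rewrite addr0; apply: integral_nat.
rewrite ltn_eqF // add0r -(subnK (_ : 1 <= d - l)%N) ?subn_gt0 // addn1 exprSr -mulrA.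
by apply: integral_mul; [apply: integral_exp | apply: oI].
Qed.

Section OnePrime.
Variable f : {poly k}.
Hypothesis f_irr : irreducible_poly f.

(* x is regular at all places above f. *)
Definition loc x := exists2 h, ~~ (f %| h) & Int (e h * x).

Lemma f_neq0 : f != 0. Proof. exact: irredp_neq0. Qed.
Lemma ef_neq0 : e f != 0. Proof. by rewrite e_eq0 f_neq0. Qed.

Lemma loc_int x : Int x -> loc x.
Proof.
by exists 1; [apply: irreducible_ndvd1 | rewrite rmorph1 mul1r].
Qed.

Lemma loc_e p : loc (e p).
Proof. exact/loc_int/integral_id. Qed.

Lemma loc1 : loc 1.
Proof. by rewrite -(rmorph1 e); apply: loc_e. Qed.

Lemma loc_inv h : ~~ (f %| h) -> loc (e h)^-1.
Proof.
move=> fh; exists h => //; rewrite divff; first exact: integral1.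
by rewrite e_eq0; apply: contraNneq fh => ->; rewrite dvdp0.
Qed.

Lemma locM x y : loc x -> loc y -> loc (x * y).
Proof.
move=> [h fh hx] [h' fh' hy]; exists (h * h'); first exact: irreducible_ndvdM.
by rewrite rmorphM mulrACA; apply: integral_mul.
Qed.

Lemma locD x y : loc x -> loc y -> loc (x + y).
Proof.
move=> [h fh hx] [h' fh' hy]; exists (h * h'); first exact: irreducible_ndvdM.
rewrite rmorphM mulrDr; apply: integral_add.
  by rewrite mulrAC; apply: integral_mul => //; apply: integral_id.
by rewrite -mulrA; apply: integral_mul => //; apply: integral_id.
Qed.

Lemma locN x : loc x -> loc (- x).
Proof. by move=> hx; rewrite -mulN1r -(rmorphN1 e); apply: locM => //; apply: loc_e. Qed.

Lemma locX x m : loc x -> loc (x ^+ m).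
Proof.
by move=> hx; elim: m => [|m IH]; [exact: loc1 | rewrite exprS; apply: locM].
Qed.

Lemma loc_sum I (s : seq I) (P : pred I) (x : I -> K) :
  (forall i, P i -> loc (x i)) -> loc (\sum_(i <- s | P i) x i).
Proof.
by move=> h; elim/big_ind: _ => // [|a b]; [rewrite -(rmorph0 e); apply: loc_e | apply: locD].
Qed.

Lemma loc_root d x (o : nat -> K) : (forall l, (l < d)%N -> loc (o l)) ->
  x ^+ d + \sum_(l < d) o l * x ^+ l = 0 -> loc x.
Proof.
move=> ho; have [h fh hP] : exists2 h, ~~ (f %| h) &
    forall l, (l < d)%N -> Int (e h * o l).
  elim: d ho => [|d IH] ho; first by exists 1; rewrite ?irreducible_ndvd1.
  have [|h fh hP] := IH; first by move=> l lt; apply/ho/ltnW.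
  have [h' fh' hd] := ho d (ltnSn d); exists (h * h'); first exact: irreducible_ndvdM.
  move=> l; rewrite ltnS leq_eqVlt rmorphM => /predU1P[->|/hP hl].
    by rewrite -mulrA; apply: integral_mul => //; apply: integral_id.
  by rewrite mulrAC; apply: integral_mul => //; apply: integral_id.
by exists h => //; apply: integral_clear hP _ => //; apply: integral_id.
Qed.

Lemma loc_pow_root m x : (0 < m)%N -> loc (x ^+ m) -> loc x.
Proof.
move=> m0 hx; apply: (@loc_root m _ (fun l => (l == 0%N)%:R * - x ^+ m)).
  by move=> l _; apply: locM; [rewrite -(rmorph_nat e); apply: loc_e | apply: locN].
rewrite (bigD1 (Ordinal m0)) //= expr0 mulr1 mul1r addrA subrr add0r.
rewrite big1 // => i /eqP ne; case: eqP => [i0|_]; last by rewrite !mul0r.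
by case: ne; apply: val_inj.
Qed.

(* The pole order of x at f, normalized by that of 1/f, is at most q^s / q^n. *)
Definition pole_le s x := loc (e f ^+ (q ^ s) * x ^+ (q ^ n)).

Lemma primitive_relation x : exists (p : nat -> {poly k}) l,
  [/\ (l < n.+1)%N, ~~ (f %| p l) & \sum_(l < n.+1) e (p l) * x ^+ l = 0].
Proof.
have [p [[l lt_l pl0] hp]] := deg_bound x.
have [m] := ubnP (size (p l)); elim: m p pl0 hp => // m IH p pl0 hp; rewrite ltnS => le_pm.
have [[i [lt_i fi]]|nf] := pselect (exists i, (i < n.+1)%N /\ ~~ (f %| p i)).
  by exists p, i.
have /choice[p' p'P] i : exists p', (i < n.+1)%N -> p i = p' * f.
  have [lt_i|] := boolP (i < n.+1)%N; last by exists 0.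
  have /dvdpP[p' hp'] : f %| p i by apply: contraT => fi; case: nf; exists i.
  by exists p'.
have p'l0 : p' l != 0.
  by apply: contraNneq pl0 => h; rewrite p'P // h mul0r.
apply: (IH p') => //.
  apply: (mulfI ef_neq0); rewrite mulr0 -[RHS]hp mulr_sumr; apply: eq_bigr => i _.
  by rewrite p'P // rmorphM mulrA [e f * _]mulrC.
apply: leq_trans le_pm; rewrite p'P // size_mul ?f_neq0 //.
by have [f1 _] := f_irr; rewrite -(subnK f1) addnA addn2 /= ltnS leq_addr.
Qed.

(* This is where the bound n on the degree of x is used: it makes the value   *)
(* group at f discrete.                                                       *)
Lemma pole_le0 x : pole_le 0 x <-> loc x.
Proof.
split=> [|hx]; last by apply: locM; [exact/locX/loc_e | exact: locX].
rewrite /pole_le expn0 expr1 => hx.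
have n1q : (n.+1 <= q ^ n)%N by apply: ltn_expl.
(* The hypothesis bounds the pole order of x by 1 / q^n, hence that of x^m by 1. *)
have low m : (m <= q ^ n)%N -> loc (e f * x ^+ m).
  move=> le_m; apply: (@loc_pow_root (q ^ n)); first by rewrite expn_gt0 ltnW.
  have -> : (e f * x ^+ m) ^+ (q ^ n) = e f ^+ (q ^ n - m) * (e f * x ^+ (q ^ n)) ^+ m.
    rewrite !exprMn -!exprM -{1}(subnK le_m) exprD [(m * _)%N]mulnC.
    by rewrite -mulrA.
  by apply: locM; apply: locX => //; apply: loc_e.
have [p [l0 [lt_l0 fl0 hp]]] := primitive_relation x.
have ex : exists l, (l < n.+1)%N && ~~ (f %| p l) by exists l0; rewrite lt_l0.
have bd l : (l < n.+1)%N && ~~ (f %| p l) -> (l <= n)%N by case/andP.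
case: (ex_maxnP ex bd) => l /andP[lt_l fl] max_l {l0 lt_l0 fl0 ex bd}.
have epl : e (p l) != 0.
  by rewrite e_eq0; apply: contraNneq fl => ->; rewrite dvdp0.
(* Beyond l each coefficient contains a factor f, which absorbs the pole of x^(i+1) because i + 1 <=
   n + 1 <= q^n. The relation is multiplied by x so that, after division by p l, it is monic of
   positive degree l + 1 with o in its constant term. *)
pose o := \sum_(i < n.+1 | (l < i)%N) e (p i) * x ^+ i.+1.
have lo : loc o.
  apply: loc_sum => i lt_li; have /dvdpP[r ->] : f %| p i.
    by apply: contraT => fi; have := max_l i; rewrite ltn_ord fi leqNgt lt_li => /(_ isT).
  by rewrite rmorphM -mulrA; apply: locM; [exact: loc_e | apply: low; apply: leq_trans n1q].
apply: (@loc_root l.+1 _ (fun i => if i is i'.+1 then e (p i') / e (p l) else o / e (p l))).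
  by case=> [|i] _; apply: locM => //; first [exact: loc_inv | exact: loc_e | (apply: loc_e)]; exact: loc_inv.
apply: (mulfI epl); rewrite mulr0 mulrDr big_ord_recl /= expr0 mulr1 mulrDr.
rewrite [e (p l) * (o / _)]mulrC divfK // mulr_sumr.
have -> : \sum_(i < l) e (p l) * (e (p i) / e (p l) * x ^+ i.+1) =
    \sum_(i < n.+1 | (i < l)%N) e (p i) * x ^+ i.+1.
  rewrite (big_ord_widen n.+1 (fun i => e (p l) * (e (p i) / e (p l) * x ^+ i.+1))) //; last exact: ltnW.
  by apply: eq_bigr => i _; rewrite mulrA [e (p l) * _]mulrC divfK.
have := congr1 ( *%R x) hp; rewrite mulr0 mulr_sumr => hx0.
rewrite -[RHS]hx0 [RHS](bigD1 (Ordinal lt_l)) //= exprS mulrCA; congr (_ + _).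
rewrite [RHS](bigID (fun i : 'I_n.+1 => (l < i)%N)) /=; congr (_ + _).
  apply: eq_big => [i|i _]; last by rewrite exprS mulrCA.
  by rewrite andbC andb_idr // => lt; apply/eqP => h; rewrite h ltnn in lt.
apply: eq_big => [i|i _]; last by rewrite exprS mulrCA.
by rewrite -leqNgt ltn_neqAle; congr (_ && _).
Qed.

Lemma pole_leD s x y : pole_le s x -> pole_le s y -> pole_le s (x + y).
Proof. by move=> hx hy; rewrite /pole_le frobX mulrDr; apply: locD. Qed.

Lemma pole_leM s x y : loc y -> pole_le s x -> pole_le s (y * x).
Proof.
by move=> hy hx; rewrite /pole_le exprMn mulrCA; apply: locM => //; apply: locX.
Qed.

Lemma pole_le_mono s s' x : (s <= s')%N -> pole_le s x -> pole_le s' x.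
Proof.
move=> le; have le' : (q ^ s <= q ^ s')%N by rewrite leq_exp2l.
by rewrite /pole_le -(subnK le') exprD -mulrA => h; apply: locM => //; apply/locX/loc_e.
Qed.

Lemma loc_pole_le s x : loc x -> pole_le s x.
Proof. by move=> hx; apply: (@pole_le_mono 0) => //; apply/pole_le0. Qed.

Lemma pole_le_frob s x : pole_le s.+1 (x ^+ q) -> pole_le s x.
Proof.
move=> h; apply: (@loc_pow_root q); first exact: ltnW.
by rewrite exprMn -!exprM -expnSr mulnC exprM.
Qed.

End OnePrime.

Lemma denominator x : exists2 a, a != 0 & Int (e a * x).
Proof.
have [p [[l0 lt_l0 pl0] hp]] := deg_bound x.
have ex : exists l, (l < n.+1)%N && (p l != 0) by exists l0; rewrite lt_l0.
have bd l : (l < n.+1)%N && (p l != 0) -> (l <= n)%N by case/andP.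
case: (ex_maxnP ex bd) => l /andP[lt_l pl] max_l.
have epl : e (p l) != 0 by rewrite e_eq0.
exists (p l) => //; apply: (@integral_clear l _ _ (fun i => e (p i) / e (p l))).
- exact: integral_id.
- by move=> i _; rewrite mulrC divfK //; apply: integral_id.
apply: (mulfI epl); rewrite mulr0 mulrDr mulr_sumr -[RHS]hp.
rewrite (bigD1 (Ordinal lt_l)) //=; congr (_ + _).
rewrite (big_ord_widen n.+1 (fun i => e (p l) * (e (p i) / e (p l) * x ^+ i))); last exact: ltnW.
rewrite big_mkcond [RHS]big_mkcond; apply: eq_bigr => i _.
case: ifP => [lt_il|/negbT]; first by rewrite ifT; [rewrite mulrA [e (p l) * _]mulrC divfK | apply/eqP => h; rewrite h ltnn in lt_il].
rewrite -leqNgt leq_eqVlt => /orP[/eqP li|lt_li].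
  by rewrite ifF //; apply/negbTE; rewrite negbK; apply/eqP/val_inj.
case: ifP => // _; have [->|pi0] := eqVneq (p i) 0; first by rewrite rmorph0 mul0r.
by have := max_l i; rewrite ltn_ord pi0 leqNgt lt_li => /(_ isT).
Qed.

(** Descent on the size of a denominator a. If a prime f divides a, then x also has a denominator h
    prime to f, and by Bezout gcd(a, h) is a smaller denominator. *)
Lemma integral_of_loc x : (forall f, irreducible_poly f -> loc f x) -> Int x.
Proof.
move=> hx; have [a a0 ha] := denominator x.
have [m] := ubnP (size a); elim: m a a0 ha => // m IH a a0 ha; rewrite ltnS => le_am.
have [sa|] := boolP (1 < size a)%N; last first.
  rewrite -leqNgt => /size1_polyC a_c; rewrite a_c polyC_eq0 in a0.
  have := integral_mul (integral_id e (a`_0)^-1%:P) ha.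
  by rewrite {2}a_c mulrA -rmorphM -polyCM mulVf // rmorph1 mul1r.
have [f fi fa] := irreducible_factor sa.
have [h fh hI] := hx f fi.
have [u hu] := Bezoutp a h; pose d := gcdp a h.
have hd : Int (e d * x).
  have /eqpP[[c1 c2] /= /andP[c10 c20] hc] := hu.
  have -> : d = (c2^-1 * c1)%:P * (u.1 * a + u.2 * h).
    by rewrite mul_polyC -scalerA hc scalerA mulVf // scale1r.
  rewrite rmorphM -mulrA; apply: integral_mul; first exact: integral_id.
  rewrite rmorphD mulrDl !rmorphM -!mulrA; apply: integral_add;
    by apply: integral_mul => //; apply: integral_id.
have d0 : d != 0 by rewrite gcdp_eq0 negb_and a0.
apply: (IH d) => //; apply: leq_trans le_am.
rewrite ltn_neqAle dvdp_leq ?dvdp_gcdl // andbT dvdp_size_eqp ?dvdp_gcdl //.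
apply: contra fh => da; apply: (dvdp_trans fa).
by rewrite -(eqp_dvdl _ da) dvdp_gcdr.
Qed.

Variable xs : nat -> K.
Hypothesis xs_surj : forall x, exists m, x = xs m.

(* The place f gets as its index the first element of K with a pole there. *)
Definition first_pole f i := ~ loc f (xs i) /\ forall m, (m < i)%N -> loc f (xs m).

Definition filtration N x := forall f, irreducible_poly f ->
  forall i, first_pole f i -> pole_le f (N - i) x.

Lemma filtrationD N x y : filtration N x -> filtration N y -> filtration N (x + y).
Proof. by move=> hx hy f fi i hi; apply: pole_leD (hx f fi i hi) (hy f fi i hi). Qed.

Lemma filtrationM N p x : filtration N x -> filtration N (e p * x).
Proof. by move=> hx f fi i hi; apply: pole_leM (hx f fi i hi) => //; apply: loc_e. Qed.

Lemma filtrationS N x : filtration N x -> filtration N.+1 x.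
Proof.
move=> hx f fi i hi; apply: (pole_le_mono fi) (hx f fi i hi).
by rewrite leq_sub2r.
Qed.

Lemma filtration_const N c : filtration N (e c).
Proof. by move=> f fi i hi; apply: loc_pole_le => //; apply: loc_e. Qed.

Lemma filtration0_integral x : filtration 0 x -> Int x.
Proof.
move=> hx; apply: integral_of_loc => f fi; apply: contrapT => nl.
have [m xm] := xs_surj x.
have ex : exists m, `[< ~ loc f (xs m) >] by exists m; apply/asboolP; rewrite -xm.
case: (ex_minnP ex) => i /asboolP ni min; apply: nl; apply/pole_le0 => //.
apply: (hx f fi i); split=> // m' lt; apply: contrapT => nm'.
by have /asboolP/min := nm'; rewrite leqNgt lt.
Qed.

Lemma filtration_all x : exists N, filtration N x.
Proof.
have [m xm] := xs_surj x; have [a a0 ha] := denominator x.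
(* The pole order of x at f is at most the multiplicity E <= size a of f in a, and E q^n <= s < q^s.
   For i <= m, the index m + s - i is still at least s. *)
pose s := (q ^ n * size a)%N; exists (m + s)%N => f fi i [ni hi].
have [lt_mi|le_im] := ltnP m i; first by apply: loc_pole_le => //; rewrite xm; apply: hi.
have [f1 _] := fi; have [E [h [aE fh le_E]]] := multiplicity f1 a0.
have hE : loc f (e f ^+ E * x) by exists h => //; rewrite mulrA -rmorphXn -rmorphM mulrC -[h * _]mulrC -aE mulrC.
apply: (@pole_le_mono _ fi s); first by rewrite -addnBAC // leq_addl.
have le : (E * q ^ n <= q ^ s)%N.
  apply: leq_trans (ltnW (ltn_expl s q_gt1)).
  by rewrite /s mulnC leq_mul2l le_E orbT.
rewrite /pole_le -(subnK le) exprD exprM -mulrA -exprMn.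
by apply: locM => //; apply: locX => //; apply: loc_e.
Qed.

Lemma filtration_frob N x : filtration N.+1 (x ^+ q) -> filtration N x.
Proof.
move=> hx f fi i hi; have := hx f fi i hi; have [le_iN|lt_Ni] := leqP i N.
  by rewrite subSn //; apply: pole_le_frob.
(* Both truncated differences are 0, so the shift by one is lost here; being regular is instead
   insensitive to q-th powers. *)
have /eqP -> : (N.+1 - i == 0)%N by rewrite subn_eq0.
have /eqP -> : (N - i == 0)%N by rewrite subn_eq0 ltnW.
move=> /(pole_le0 fi) h; apply/(pole_le0 fi); apply: (loc_pow_root fi _ h).
exact: ltnW.
Qed.

End LocalFiltration.

(** * Elements integral over k[t] and over k[1/t] *)

Definition evalp (k K : fieldType) (iota : {rmorphism k -> K}) (t : K) :=
  horner_eval t \o map_poly iota.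

HB.instance Definition _ (k K : fieldType) (iota : {rmorphism k -> K}) (t : K) :=
  GRing.RMorphism.on (evalp iota t).

Section BothIntegral.
Variables (k K : fieldType) (iota : {rmorphism k -> K}).

Lemma evalpE t p : evalp iota t p = (map_poly iota p).[t].
Proof. by []. Qed.

Lemma evalpC t c : evalp iota t c%:P = iota c.
Proof. by rewrite evalpE map_polyC hornerC. Qed.

Lemma evalpX t : evalp iota t 'X = t.
Proof. by rewrite evalpE map_polyX hornerX. Qed.

Lemma evalp_wide n t (p : {poly k}) : (size p <= n)%N ->
  evalp iota t p = \sum_(i < n) iota p`_i * t ^+ i.
Proof.
move=> sp; rewrite evalpE (@horner_coef_wide _ n) ?size_map_poly //.
by apply: eq_bigr => i _; rewrite coef_map.
Qed.

Section Descent.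
Variables (t y : K).
Hypothesis t0 : t != 0.

(* The outer variable is evaluated at t, the inner one at y; [red] is          *)
(* reduction modulo the inner variable.                                       *)
Let eval2 (P : {poly {poly k}}) := (map_poly (evalp iota y) P).[t].
Let red (P : {poly {poly k}}) : {poly k} := map_poly (horner_eval 0) P.

Let eval2B P Q : eval2 (P - Q) = eval2 P - eval2 Q.
Proof. by rewrite /eval2 rmorphB hornerD hornerN. Qed.
Let eval2M P Q : eval2 (P * Q) = eval2 P * eval2 Q.
Proof. by rewrite /eval2 rmorphM hornerM. Qed.
Let eval2X : eval2 'X = t.
Proof. by rewrite /eval2 map_polyX hornerX. Qed.
Let eval2C u : eval2 u%:P = evalp iota y u.
Proof. by rewrite /eval2 map_polyC hornerC. Qed.
Let coef_red P i : (red P)`_i = (P`_i).[0].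
Proof. by rewrite /red coef_map. Qed.

(** Euclidean elimination of t, preserving the shapes 1 and 'X^m modulo the inner variable. It ends
    with a polynomial in y alone whose value at 0 is 1, so it is nonzero. *)
Lemma coprime_reduction_algebraic N (P Q : {poly {poly k}}) m :
  (size P + m <= N)%N -> (size Q <= m.+1)%N -> red P = 1 -> red Q = 'X^m ->
  eval2 P = 0 -> eval2 Q = 0 ->
  exists u : {poly k}, u.[0] = 1 /\ evalp iota y u = 0.
Proof.
elim: N P Q m => [|N IH] P Q m le_N sQ rP rQ eP eQ.
  have P0 : P = 0 by apply/eqP; rewrite -size_poly_leq0; apply: leq_trans le_N; apply: leq_addr.
  by move/eqP: rP; rewrite P0 /red rmorph0 eq_sym oner_eq0.
have P00 : (P`_0).[0] = 1 by rewrite -coef_red rP coef1.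
have Qm0 : (Q`_m).[0] = 1 by rewrite -coef_red rQ coefXn eqxx.
have [sP|sP] := leqP (size P) 1.
  by exists P`_0; split=> //; rewrite -eval2C -size1_polyC.
have [m0|m_gt0] := posnP m.
  rewrite m0 in Qm0 sQ.
  by exists Q`_0; split=> //; rewrite -eval2C -size1_polyC.
pose n := (size P).-1; have sPn : size P = n.+1 by rewrite prednK // ltnW.
have n0 : (0 < n)%N by rewrite -ltnS -sPn.
have Pn0 : (P`_n).[0] = 0 by rewrite -coef_red rP coef1 gtn_eqF.
have Q00 : (Q`_0).[0] = 0 by rewrite -coef_red rQ coefXn eq_sym gtn_eqF.
have [le_mn|lt_nm] := leqP m n.
  (* The top of P is cancelled. Its coefficient reduces to 0 and that of Q to 1, so the reduction of
     P is unchanged. *)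
  pose P' := (Q`_m)%:P * P - (P`_n)%:P * 'X^(n - m) * Q.
  have sP' : (size P' <= n)%N.
    apply/leq_sizeP => i le_ni; rewrite coefB coefCM -mulrA coefCM.
    rewrite ['X^_ * Q]mulrC coefMXn.
    have [le_in|lt_ni] := leqP i n; last first.
      rewrite [P`_i]nth_default ?sPn // mulr0 sub0r; case: ifP => _; rewrite ?mulr0 ?oppr0 //.
      by rewrite [Q`_ _]nth_default ?mulr0 ?oppr0 // (leq_trans sQ) // ltn_subRL subnK.
    have -> : i = n by apply/eqP; rewrite eqn_leq le_ni le_in.
    by rewrite ltnNge leq_subr /= subKn // mulrC subrr.
  apply: (IH P' Q m) => //.
  - by rewrite -ltnS (leq_trans _ le_N) // ltn_add2r sPn ltnS.
  - rewrite /red rmorphB !rmorphM /= !map_polyC /= /horner_eval Qm0 Pn0.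
    by rewrite polyC0 !mul0r subr0 mul1r.
  - by rewrite eval2B !eval2M eP eQ !mulr0 subrr.
(* The constant term of Q is cancelled, and then t is divided out, which lowers m by one. *)
pose Q1 := (P`_0)%:P * Q - (Q`_0)%:P * P.
pose Q' := \poly_(i < m) Q1`_i.+1.
have Q1E : Q1 = 'X * Q'.
  apply/polyP => i; rewrite coefXM coef_poly; case: i => [|i] /=.
    by rewrite coefB !coefCM mulrC subrr.
  case: ltnP => // le_mi; have hQ : (size Q <= i.+1)%N by apply: leq_trans sQ _.
  have hP : (size P <= i.+1)%N by rewrite sPn; apply: leq_trans lt_nm (leqW le_mi).
  by rewrite coefB !coefCM [P`_i.+1]nth_default // [Q`_i.+1]nth_default // !mulr0 subrr.
have eQ' : eval2 Q' = 0.
  apply: (mulfI t0); rewrite mulr0 -{1}eval2X -eval2M -Q1E eval2B !eval2M eP eQ.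
  by rewrite !mulr0 subrr.
case: m => [//|m] in le_N sQ rQ Qm0 m_gt0 lt_nm Q' Q1E eQ' *.
apply: (IH P Q' m) => //.
- by rewrite -ltnS -addnS.
- exact: size_poly.
have : red Q1 = 'X^(m.+1).
  rewrite /red rmorphB !rmorphM /= !map_polyC /= /horner_eval P00 Q00.
  by rewrite polyC0 !mul0r subr0 mul1r.
rewrite Q1E /red rmorphM /= map_polyX exprS => /mulfI; apply.
by rewrite polyX_eq0.
Qed.

End Descent.

Definition rev_poly d (a : {poly k}) : {poly k} := \poly_(i < d.+1) a`_(d - i).

Lemma evalp_rev d (a : {poly k}) t : t != 0 -> (size a <= d.+1)%N ->
  evalp iota t (rev_poly d a) = t ^+ d * evalp iota t^-1 a.
Proof.
move=> t0 sa; rewrite (@evalp_wide d.+1) ?size_poly // (@evalp_wide d.+1) //.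
rewrite mulr_sumr (reindex_inj rev_ord_inj); apply: eq_bigr => i _ /=.
rewrite subSS coef_poly ltnS leq_subr subKn -1?ltnS // mulrCA; congr (_ * _).
have le_id : (i <= d)%N by rewrite -ltnS.
have -> : t ^+ d = t ^+ (d - i) * t ^+ i by rewrite -exprD subnK.
by rewrite exprVn mulfK // expf_neq0.
Qed.

(** A function without poles is constant. With y = 1 / x, the equation over k[t] becomes 1 modulo y
    after multiplication by a power of y; the one over k[1/t] becomes a power of t after also
    clearing 1/t. These are the inputs of the elimination. *)
Lemma integral_both_algebraic (t x : K) : t != 0 ->
  integralOver (evalp iota t) x -> integralOver (evalp iota t^-1) x ->
  algebraicOver iota x.
Proof.
move=> t0 [P Pm Px] [Q Qm Qx]; have [->|x0] := eqVneq x 0; first exact: algebraic0.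
pose y := x^-1.
pose bi M (a : nat -> {poly k}) : {poly {poly k}} :=
  \sum_(l < M.+1) map_poly polyC (a l) * ('X^(M - l))%:P.
have bi_eval M a : (map_poly (evalp iota y) (bi M a)).[t] =
    y ^+ M * \sum_(l < M.+1) evalp iota t (a l) * x ^+ l.
  rewrite /bi rmorph_sum horner_sum mulr_sumr; apply: eq_bigr => l _ /=.
  rewrite rmorphM hornerM /= map_polyC hornerC /= -map_poly_comp.
  have -> : map_poly (evalp iota y \o polyC) (a l) = map_poly iota (a l).
    by apply: eq_map_poly => c /=; rewrite evalpC.
  rewrite rmorphXn /= evalpX mulrCA; congr (_ * _).
  have le_l : (l <= M)%N by rewrite -ltnS.
  have -> : y ^+ M = y ^+ (M - l) * y ^+ l by rewrite -exprD subnK.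
  by rewrite -mulrA -exprMn mulVf // expr1n mulr1.
have bi_red M a : map_poly (horner_eval 0) (bi M a) = a M.
  rewrite /bi rmorph_sum big_ord_recr big1 /= => [|l _].
    rewrite add0r subnn expr0 polyC1 mulr1 -map_poly_comp map_poly_id // => c _ /=.
    exact: hornerC.
  rewrite rmorphM /= map_polyC /= /horner_eval hornerXn expr0n.
  by rewrite subn_eq0 leqNgt ltn_ord mulr0.
have root_sum (R : {poly {poly k}}) s (RP : R \is monic) :
    root (map_poly (evalp iota s) R) x ->
    \sum_(l < (size R).-1.+1) evalp iota s R`_l * x ^+ l = 0.
  move=> /rootP h; rewrite -[RHS]h (@horner_coef_wide _ (size R).-1.+1).
    by apply: eq_bigr => l _; rewrite coef_map.
  by apply: leq_trans (size_poly _ _) _; apply: leqSpred.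
pose MP := (size P).-1; pose MQ := (size Q).-1.
pose d := \max_(l < MQ.+1) size (Q`_l)%R.
have sQd l : (size (Q`_l)%R <= d.+1)%N.
  have [le_l|lt_l] := leqP l MQ.
    by apply: leqW; apply: (leq_bigmax (Ordinal (le_l : l < MQ.+1)%N)).
  by rewrite nth_default ?size_poly0 // (leq_trans (leqSpred _)).
pose PP := bi MP (fun l => P`_l); pose QQ := bi MQ (fun l => rev_poly d Q`_l).
have [|||||u [u0 uy]] := @coprime_reduction_algebraic t y t0 _ PP QQ d (leqnn _).
- apply: (leq_trans (size_sum _ _ _)); apply/bigmax_leqP => l _.
  rewrite (leq_trans (size_polyMleq _ _)) // size_polyC.
  apply: leq_trans (_ : ((d.+1 + 1).-1 <= _)%N); last by rewrite addn1.
  rewrite -!subn1 leq_sub2r // leq_add ?leq_b1 //.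
  by rewrite (leq_trans (size_poly _ _)) // size_poly.
- by rewrite bi_red -lead_coefE (monicP Pm).
- rewrite bi_red -lead_coefE (monicP Qm); apply/polyP => i.
  rewrite coef_poly coef1 coefXn; case: ltnP => [lt|le]; last by rewrite gtn_eqF.
  by rewrite subn_eq0 eqn_leq (ltnSE lt).
- by rewrite bi_eval root_sum // mulr0.
- rewrite bi_eval; under eq_bigr => l _ do rewrite evalp_rev // -mulrA.
  by rewrite -mulr_sumr root_sum // !mulr0.
rewrite -[x]invrK; apply: algebraic_inv; exists u; last exact/rootP.
by apply/eqP => u_0; move/eqP: u0; rewrite u_0 horner0 eq_sym oner_eq0.
Qed.

End BothIntegral.

Section CurveFiltration.
Variables (k K : fieldType) (iota : {rmorphism k -> K}) (t : K).
Hypothesis t_tr : forall p, evalp iota t p = 0 -> p = 0.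
Variables (q n : nat).
Hypothesis q_gt1 : (1 < q)%N.
Hypothesis frob : forall x y : K, (x + y) ^+ q = x ^+ q + y ^+ q.
Hypothesis deg_bound : forall x : K, exists p : nat -> {poly k},
  (exists2 l, (l < n.+1)%N & p l != 0) /\
  \sum_(l < n.+1) evalp iota t (p l) * x ^+ l = 0.
Variable xs : nat -> K.
Hypothesis xs_surj : forall x, exists m, x = xs m.

(** The two affine charts of the line: pole orders are bounded over k[t] and over k[1/t], so level 0
    is integral over both. *)
Lemma curve_filtration : exists W : nat -> K -> Prop,
  [/\ forall N x y, W N x -> W N y -> W N (x + y),
      forall N c x, W N x -> W N (iota c * x),
      forall N x, W N x -> W N.+1 x,
      forall x, exists N, W N x
    & forall N x, W N.+1 (x ^+ q) -> W N x] /\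
  (forall x, W 0%N x -> algebraicOver iota x) /\ (forall c, W 0%N (iota c)).
Proof.
have t0 : t != 0.
  by apply/eqP => h; have := t_tr (etrans (evalpX iota t) h) => /eqP; rewrite polyX_eq0.
have inj : injective (evalp iota t).
  by move=> p p' /eqP; rewrite -subr_eq0 -rmorphB => /eqP/t_tr/eqP; rewrite subr_eq0 => /eqP.
have rev_eq0 (d : nat) (p : {poly k}) : (size p <= d.+1)%N -> rev_poly d p = 0 -> p = 0.
  move=> sp /polyP h; apply/polyP => i; rewrite coef0.
  have [le|lt] := leqP i d; last by rewrite nth_default // (leq_trans sp).
  by have := h (d - i)%N; rewrite coef_poly ltnS leq_subr subKn // coef0.
have inj' : injective (evalp iota t^-1).
  move=> p p' /eqP; rewrite -subr_eq0 -rmorphB => /eqP h; apply/eqP; rewrite -subr_eq0.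
  apply/eqP/(rev_eq0 _ _ (leqSpred _))/t_tr; rewrite evalp_rev ?h ?mulr0 //.
  exact: leqSpred.
have deg_bound' x : exists p : nat -> {poly k},
    (exists2 l, (l < n.+1)%N & p l != 0) /\
    \sum_(l < n.+1) evalp iota t^-1 (p l) * x ^+ l = 0.
  have [p [[l lt_l pl] hp]] := deg_bound x.
  pose d := \max_(l < n.+1) size (p l).
  have sp i : (i < n.+1)%N -> (size (p i) <= d.+1)%N.
    by move=> lt; apply: leqW; apply: (leq_bigmax (Ordinal lt)).
  exists (fun l => rev_poly d (p l)); split.
    by exists l => //; apply: contra_neq pl => /rev_eq0; apply; apply: sp.
  transitivity (t^-1 ^+ d * \sum_(l < n.+1) evalp iota t (p l) * x ^+ l).
    rewrite mulr_sumr; apply: eq_bigr => i _.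
    by rewrite evalp_rev ?invr_eq0 ?sp // invrK mulrA.
  by rewrite hp mulr0.
pose F1 := @filtration k K (evalp iota t) q n xs.
pose F2 := @filtration k K (evalp iota t^-1) q n xs.
exists (fun N x => F1 N x /\ F2 N x); split; last split.
- split.
  + by move=> N x y [h1 h2] [h1' h2']; split; apply: filtrationD.
  + move=> N c x [h1 h2]; split.
      by rewrite -(evalpC iota t); apply: filtrationM.
    by rewrite -(evalpC iota t^-1); apply: filtrationM.
  + by move=> N x [h1 h2]; split; apply: filtrationS.
  + move=> x.
    have [N1 h1] := filtration_all inj q_gt1 deg_bound xs_surj x.
    have [N2 h2] := filtration_all inj' q_gt1 deg_bound' xs_surj x.
    have mono e M N z : (M <= N)%N -> @filtration k K e q n xs M z -> filtration e q n xs N z.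
      by move=> /subnKC <-; elim: (N - M)%N => [|m IH] hz; rewrite ?addn0 // addnS; apply/filtrationS/IH.
    by exists (maxn N1 N2); split; [apply: mono h1; apply: leq_maxl | apply: mono h2; apply: leq_maxr].
  + by move=> N x [h1 h2]; split; [apply: (filtration_frob inj q_gt1 deg_bound) | apply: (filtration_frob inj' q_gt1 deg_bound')].
- move=> x [h1 h2]; apply: (@integral_both_algebraic _ _ iota t) => //.
    exact: (filtration0_integral inj q_gt1 deg_bound xs_surj).
  exact: (filtration0_integral inj' q_gt1 deg_bound' xs_surj).
- move=> c; split.
    by rewrite -(evalpC iota t); apply: filtration_const.
  by rewrite -(evalpC iota t^-1); apply: filtration_const.
Qed.

End CurveFiltration.

(** * Algebraic independence *)

Section MpolyLast.
Variables (R : fieldType) (n : nat).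

Definition mnm_init (m : 'X_{1..n.+1}) : 'X_{1..n} :=
  [multinom m (widen_ord (leqnSn n) i) | i < n].

Lemma mnm_last_inj (m m' : 'X_{1..n.+1}) :
  mnm_init m = mnm_init m' -> m ord_max = m' ord_max -> m = m'.
Proof.
move=> /mnmP hi hl; apply/mnmP => i; have [lt_in|le_ni] := ltnP i n.
  have := hi (Ordinal lt_in); rewrite !mnmE.
  by have -> : widen_ord (leqnSn n) (Ordinal lt_in) = i by apply: val_inj.
suff -> : i = ord_max by [].
by apply/val_inj/eqP; rewrite eqn_leq le_ni andbT -ltnS ltn_ord.
Qed.

Lemma muni_eq0 (P : {mpoly R[n.+1]}) : muni P = 0 -> P = 0.
Proof.
move=> h; apply/mpolyP => m; rewrite mcoeff0.
have := congr1 (fun Q : {poly {mpoly R[n]}} => (Q`_(m ord_max))@_(mnm_init m)) h.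
rewrite muniE coef0 mcoeff0 coef_sum raddf_sum /= => <-.
rewrite [in LHS](mpolyE P) raddf_sum /=; apply: eq_big_seq => m' _.
rewrite mcoeffZ mcoeffX coefZ coefXn -/(mnm_init m').
have [->|ne] := eqVneq m' m; first by rewrite !eqxx !mulr1 mcoeffZ mcoeffX eqxx mulr1.
case: eqP => [el|_]; last by rewrite !mulr0 mcoeff0.
rewrite mulr1 mcoeffZ mcoeffX; case: eqP => // ei.
by case/eqP: ne; apply: mnm_last_inj.
Qed.

Lemma muni_eval (L : fieldType) (j : {rmorphism R -> L}) (h : 'I_n.+1 -> L)
    (P : {mpoly R[n.+1]}) :
  mmap j h P = (map_poly (mmap j (fun i => h (widen_ord (leqnSn n) i))) (muni P)).[h ord_max].
Proof.
set h' := fun i => _; rewrite muniE rmorph_sum horner_sum /mmap.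
apply: eq_bigr => m _; rewrite -/(mnm_init m) -mul_polyC rmorphM hornerM /=.
rewrite map_polyXn hornerXn map_polyC hornerC /= mmapZ -mulrA; congr (_ * _).
rewrite mmapX /mmap1 big_ord_recr /=; congr (_ * _).
by apply: eq_bigr => i _; rewrite mnmE.
Qed.

End MpolyLast.

Section Independence.
Variables (k L : fieldType) (j : {rmorphism k -> L}).

Lemma indep_nil : algebraically_independent j [tuple].
Proof.
move=> P; rewrite [P]nvar0_mpolyC mmapC => /eqP.
by rewrite fmorph_eq0 => /eqP->; rewrite mpolyC0.
Qed.

Lemma indep_rcons n (t : n.-tuple L) (x : L) : algebraically_independent j t ->
  (forall Q : {poly L}, (forall i, exists P, Q`_i = mmap j (tnth t) P) ->
     Q.[x] = 0 -> Q = 0) ->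
  exists t' : n.+1.-tuple L, algebraically_independent j t' /\
    forall y, y \in t' -> y = x \/ y \in t.
Proof.
move=> t_ind x_tr.
pose t' : n.+1.-tuple L := [tuple of rcons t x].
have t'x : tnth t' ord_max = x.
  by rewrite (tnth_nth x) /= nth_rcons size_tuple ltnn eqxx.
have t't i : tnth t' (widen_ord (leqnSn n) i) = tnth t i.
  by rewrite !(tnth_nth x) /= nth_rcons size_tuple ltn_ord.
exists t'; split=> [P hP|y]; last by rewrite mem_rcons inE => /predU1P.
apply: muni_eq0; have mE : mmap j (fun i => tnth t' (widen_ord (leqnSn n) i)) =1 mmap j (tnth t).
  by move=> Q; apply: eq_bigr => m _; congr (_ * _); apply: eq_bigr => i _; rewrite t't.
have /polyP Q0 : map_poly (mmap j (tnth t)) (muni P) = 0.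
  apply: x_tr; first by move=> i; exists (muni P)`_i; rewrite coef_map.
  by rewrite -[RHS]hP muni_eval t'x (eq_map_poly mE).
by apply/polyP => i; rewrite coef0; apply: t_ind; have := Q0 i; rewrite coef_map coef0.
Qed.

End Independence.

(** * Degrees in finitely generated algebraic extensions *)

(** Bundling the predicate with its closure lets the subtype be inferred as a field, since the
    results on k(t) take their base field as a type. *)
Record subfield (K : fieldType) :=
  Subfield { sf_mem : {pred K}; sf_closed : divring_closed sf_mem }.

HB.instance Definition _ (K : fieldType) (S : subfield K) :=
  GRing.isDivringClosed.Build K (sf_mem S) (sf_closed S).

Definition subfield_type (K : fieldType) (S : subfield K) : Type :=
  {x : K | x \in sf_mem S}.

HB.instance Definition _ (K : fieldType) (S : subfield K) :=
  SubType.on (subfield_type S).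
HB.instance Definition _ (K : fieldType) (S : subfield K) :=
  Choice.on (subfield_type S).
HB.instance Definition _ (K : fieldType) (S : subfield K) :=
  [SubChoice_isSubComUnitRing of subfield_type S by <:].
HB.instance Definition _ (K : fieldType) (S : subfield K) :=
  [SubComUnitRing_isSubIntegralDomain of subfield_type S by <:].
HB.instance Definition _ (K : fieldType) (S : subfield K) :=
  [SubIntegralDomain_isSubField of subfield_type S by <:].

Definition sf_val (K : fieldType) (S : subfield K) : subfield_type S -> K := val.
HB.instance Definition _ (K : fieldType) (S : subfield K) :=
  GRing.RMorphism.on (@sf_val K S).

Section FiniteExtension.
Variables (E K : fieldType) (iota : {rmorphism E -> K}).

Definition span (w : seq K) x := exists c : nat -> E,
  x = \sum_(i < size w) iota (c i) * w`_i.

Lemma spanD w x y : span w x -> span w y -> span w (x + y).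
Proof.
case=> c -> [d ->]; exists (fun i => c i + d i); rewrite -big_split.
by apply: eq_bigr => i _; rewrite rmorphD mulrDl.
Qed.

Lemma spanZ w a x : span w x -> span w (iota a * x).
Proof.
case=> c ->; exists (fun i => a * c i); rewrite mulr_sumr.
by apply: eq_bigr => i _; rewrite rmorphM mulrA.
Qed.

Lemma span0 w : span w 0.
Proof. by exists (fun=> 0); rewrite big1 // => i _; rewrite rmorph0 mul0r. Qed.

Lemma span_mem w x : x \in w -> span w x.
Proof.
move=> xw; have lt_x : (index x w < size w)%N by rewrite index_mem.
exists (fun i => (i == index x w)%:R); rewrite (bigD1 (Ordinal lt_x)) //= eqxx.
rewrite rmorph1 mul1r nth_index // big1 ?addr0 // => i /eqP ne.
case: eqP => [e|_]; last by rewrite rmorph0 mul0r.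
by case: ne; apply: val_inj.
Qed.

Definition is_subring (S : K -> Prop) :=
  [/\ S 1, forall x y, S x -> S y -> S (x - y) & forall x y, S x -> S y -> S (x * y)].

Lemma subring0 S : is_subring S -> S 0.
Proof. by case=> S1 SB _; rewrite -(subrr 1); apply: SB. Qed.

Lemma subringD S : is_subring S -> forall x y, S x -> S y -> S (x + y).
Proof.
move=> hS x y hx hy; case: (hS) => _ SB _; rewrite -[y]opprK; apply: (SB) => //.
by rewrite -[- y]add0r; apply: SB => //; apply: subring0.
Qed.

Lemma subringX S : is_subring S -> forall x m, S x -> S (x ^+ m).
Proof.
by move=> [S1 _ SM] x m hx; elim: m => [|m IH] //; rewrite exprS; apply: SM.
Qed.

Lemma adjoin_finite S w u : is_subring S -> (forall a, S (iota a)) ->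
  (forall x, S x -> span w x) -> algebraicOver iota u ->
  exists S' w', [/\ is_subring S', forall x, S x -> S' x, S' u & forall x, S' x -> span w' x].
Proof.
move=> hS Siota Sw /integral_algebraic[P Pm Pu].
have [S1 SB SM] := hS.
pose d := (size P).-1; pose a i := - P`_i.
have uE : u ^+ d = \sum_(i < d) iota (a i) * u ^+ i.
  move/rootP: Pu; rewrite (@horner_coef_wide _ d.+1); last first.
    by rewrite size_map_poly; apply: leqSpred.
  have cd : (map_poly iota P)`_d = 1 by rewrite coef_map /= [P`_d](monicP Pm) rmorph1.
  rewrite big_ord_recr /= cd mul1r.
  move/eqP; rewrite addrC addr_eq0 => /eqP ->; rewrite -sumrN; apply: eq_bigr => i _.
  by rewrite coef_map /a rmorphN mulNr.
have d_gt0 : (0 < d)%N.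
  rewrite lt0n; apply/eqP => d0; move: uE; rewrite d0 big_ord0 expr0.
  by move/eqP; rewrite oner_eq0.
pose S' x := exists r : nat -> K, (forall i, S (r i)) /\ x = \sum_(i < d) r i * u ^+ i.
have S'B x y : S' x -> S' y -> S' (x - y).
  move=> [r [hr ->]] [s [hs ->]]; exists (fun i => r i - s i); split; first by move=> i; apply: SB.
  by rewrite -sumrB; apply: eq_bigr => i _; rewrite mulrBl.
have S'Z x y : S x -> S' y -> S' (x * y).
  move=> hx [r [hr ->]]; exists (fun i => x * r i); split; first by move=> i; apply: SM.
  by rewrite mulr_sumr; apply: eq_bigr => i _; rewrite mulrA.
have S'S x : S x -> S' x.
  move=> hx; exists (fun i => if i is 0 then x else 0); split.
    by case=> // _; apply: subring0.
  rewrite (bigD1 (Ordinal d_gt0)) //= mulr1 big1 ?addr0 // => -[[|i] lt] // _.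
  by rewrite mul0r.
have S'0 : S' 0 by apply: S'S; apply: subring0.
have S'D x y : S' x -> S' y -> S' (x + y).
  by move=> hx hy; rewrite -[y]opprK; apply: (S'B) => //; rewrite -[- y]add0r; apply: S'B.
have S'u y : S' y -> S' (u * y).
  move=> [r [hr ->]]; have [d' dE] : exists d', d = d'.+1 by exists d.-1; rewrite prednK.
  have sumE (f : nat -> K) : \sum_(i < d) f i = \sum_(i < d'.+1) f i by rewrite dE.
  rewrite (sumE (fun i => r i * u ^+ i)) big_ord_recr /= mulrDr; apply: S'D.
    exists (fun i => if i is i'.+1 then r i' else 0); split.
      by case=> [|i]; [apply: subring0 | apply: hr].
    rewrite (sumE (fun i => (if i is i'.+1 then r i' else 0) * u ^+ i)).
    rewrite big_ord_recl mul0r add0r mulr_sumr; apply: eq_bigr => i _ /=.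
    by rewrite mulrCA exprS.
  rewrite mulrCA -exprS -dE uE; apply: S'Z => //.
  by exists (fun i => iota (a i)).
have S'uX m y : S' y -> S' (u ^+ m * y).
  by move=> hy; elim: m => [|m IH]; rewrite ?expr0 ?mul1r // exprS -mulrA; apply: S'u.
exists S', [seq x * y | x <- w, y <- [seq u ^+ i | i <- seq.iota 0 d]]; split=> //.
- split=> [| |x y [r [hr ->]] hy]; [exact: S'S | exact: S'B |].
  rewrite mulr_suml; elim/big_ind: _ => // i _; rewrite -mulrA.
  by apply: S'Z => //; apply: S'uX.
- by rewrite -[u]mulr1; apply/S'u/S'S.
move=> _ [r [hr ->]]; elim/big_ind: _ => [|x y|i _]; [exact: span0 | exact: spanD |].
have [c ->] := Sw _ (hr i); rewrite mulr_suml.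
elim/big_ind: _ => [|x y|l _]; [exact: span0 | exact: spanD |].
rewrite -mulrA; apply/spanZ/span_mem/allpairsP; exists (w`_l, u ^+ i); split=> //=.
  exact: mem_nth.
by apply: map_f; rewrite mem_iota /=.
Qed.

Definition degree_bound n := forall x : K, exists c : nat -> E,
  (exists2 l, (l < n.+1)%N & c l != 0) /\ \sum_(l < n.+1) iota (c l) * x ^+ l = 0.

Lemma span_degree_bound w S : (forall x, S x -> span w x) -> is_subring S ->
  forall x, S x -> exists c : nat -> E, (exists2 l, (l < (size w).+1)%N & c l != 0) /\
    \sum_(l < (size w).+1) iota (c l) * x ^+ l = 0.
Proof.
move=> Sw hS x hx.
have /choice[C CP] i : exists c : nat -> E, x ^+ i = \sum_(l < size w) iota (c l) * w`_l.
  by apply: Sw; apply: subringX.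
have [u [u0 uC]] := linear_dependence (size w) C.
exists u; split=> //.
transitivity (\sum_(i < (size w).+1) \sum_(l < size w) iota (u i * C i l) * w`_l).
  apply: eq_bigr => i _; rewrite CP mulr_sumr; apply: eq_bigr => l _.
  by rewrite rmorphM mulrA.
rewrite exchange_big big1 // => l _ /=.
by rewrite -mulr_suml -rmorph_sum uC // rmorph0 mul0r.
Qed.

(** Adjoining the generators one by one gives a finitely spanned ring. Algebraic relations make it
    closed under inverses, so it is all of K, and the number of its spanning elements bounds the
    degrees. *)
Lemma fin_gen_degree_bound (s : seq K) : (forall x, x \in s -> algebraicOver iota x) ->
  (forall S : {pred K}, divring_closed S -> (forall a, iota a \in S) ->
     {subset s <= S} -> forall x, x \in S) ->
  exists n, degree_bound n.
Proof.
move=> s_alg s_gen.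
have [S [w [hS Siota Ss Sw]]] : exists S w, [/\ is_subring S, forall a, S (iota a),
    forall x, x \in s -> S x & forall x, S x -> span w x].
  elim: s s_alg {s_gen} => [|u s IH] s_alg.
    exists (fun x => exists a, x = iota a), [:: 1]; split=> //.
    - split=> [|_ _ [a ->] [b ->]|_ _ [a ->] [b ->]]; first by exists 1; rewrite rmorph1.
        by exists (a - b); rewrite rmorphB.
      by exists (a * b); rewrite rmorphM.
    - by move=> a; exists a.
    - by move=> _ [a ->]; exists (fun=> a); rewrite big_ord1 mulr1.
  have [|S [w [hS Siota Ss Sw]]] := IH.
    by move=> x xs; apply: s_alg; rewrite inE xs orbT.
  have [|S' [w' [hS' SS' S'u S'w]]] := adjoin_finite hS Siota Sw (u := u).
    by apply: s_alg; rewrite inE eqxx.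
  exists S', w'; split=> // [a|x]; first exact: SS'.
  by rewrite inE => /predU1P[->|/Ss/SS'].
have bound := span_degree_bound Sw hS; have [S1 SB SM] := hS.
exists (size w) => x; apply: (bound).
suff: x \in [pred z | `[< S z >]] by move=> /asboolP.
apply: s_gen => [|a|z zs]; try (apply/asboolP; first [exact: Siota | exact: Ss]).
split=> [|y z /asboolP hy /asboolP hz|y z /asboolP hy /asboolP hz]; apply/asboolP => //.
  exact: SB.
apply: (SM) => //; have [->|z0] := eqVneq z 0; first by rewrite invr0; apply: subring0.
have [c [[l0 lt_l0 cl0] hc]] := bound z hz.
have ex : exists l, (l < (size w).+1)%N && (c l != 0) by exists l0; rewrite lt_l0.
(* Dividing the relation by z^l for the lowest nonzero coefficient leaves c_l + z T = 0, which
   exhibits the inverse of z in S. *)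
case: (ex_minnP ex) => l /andP[lt_l cl] min.
pose T := \sum_(i < (size w).+1 | (l < i)%N) iota (c i) * z ^+ (i - l.+1).
have ST : S T.
  rewrite /T; elim/big_ind: _ => [|a b|i _]; [exact: subring0 | exact: subringD |].
  by apply: (SM) => //; apply: subringX.
have icl : iota (c l) != 0 by rewrite fmorph_eq0.
have e : z ^+ l * (iota (c l) + z * T) = 0.
  rewrite -[RHS]hc (bigD1 (Ordinal lt_l)) //= mulrDr mulrC; congr (_ + _).
  rewrite !mulr_sumr big_mkcond [RHS]big_mkcond; apply: eq_bigr => i _.
  case: ifP => [lt_li|/negbT].
    rewrite ifT; last by apply/eqP => h; rewrite h ltnn in lt_li.
    have -> : z ^+ i = z ^+ l * (z * z ^+ (i - l.+1)).
      by rewrite -exprS -exprD; congr (_ ^+ _); rewrite -subSn // subSS subnKC // ltnW.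
    ring. 
  rewrite -leqNgt leq_eqVlt => /orP[/eqP li|lt_il].
    have -> : i = Ordinal lt_l by apply: val_inj; exact: li.
    by rewrite eqxx.
  case: ifP => // _; have [->|ci] := eqVneq (c i) 0; first by rewrite rmorph0 mul0r.
  by have := min i; rewrite ltn_ord ci leqNgt lt_il => /(_ isT).
move/eqP: e; rewrite mulf_eq0 expf_eq0 (negbTE z0) andbF /= addr_eq0 => /eqP e.
have -> : z^-1 = iota (- (c l)^-1) * T.
  apply: (mulfI z0); rewrite divff // mulrCA -[z * T]opprK -e rmorphN fmorphV mulrNN.
  by rewrite mulVf.
exact: SM.
Qed.

End FiniteExtension.

(** * Maximal subfields over which an element is transcendental *)

Section Subfields.
Variable K : fieldType.

Definition is_subfield (A : K -> Prop) :=
  [/\ A 1, forall x y, A x -> A y -> A (x - y) & forall x y, A x -> A y -> A (x / y)].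

Lemma subfield_pred_closed A : is_subfield A -> divring_closed [pred x | `[< A x >]].
Proof.
case=> A1 AB AD; split=> [|x y /asboolP hx /asboolP hy|x y /asboolP hx /asboolP hy];
  apply/asboolP => //; [exact: AB | exact: AD].
Qed.

Definition to_subfield A (hA : is_subfield A) : subfield K :=
  Subfield (subfield_pred_closed hA).

Definition sub_in A (hA : is_subfield A) x (hx : A x) : subfield_type (to_subfield hA) :=
  exist _ x (introT (asboolP _) hx).

Lemma sub_inE A (hA : is_subfield A) x (hx : A x) : sf_val (sub_in hA hx) = x.
Proof. by []. Qed.

Lemma sf_valP A (hA : is_subfield A) (x : subfield_type (to_subfield hA)) : A (sf_val x).
Proof. by case: x => x hx; apply/asboolP. Qed.

Lemma is_subfield_ring A : is_subfield A -> is_subring A.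
Proof.
case=> A1 AB AD; split=> // x y hx hy; rewrite -[y]invrK; apply: (AD) => //.
by rewrite -[y^-1]mul1r; apply: AD.
Qed.

Definition transcendental (A : K -> Prop) x :=
  forall p : {poly K}, (forall i, A p`_i) -> p.[x] = 0 -> p = 0.

Section Adjoin.
Variables (k : fieldType) (iota : {rmorphism k -> K}) (t : K).

Definition adjoin x := exists p r, evalp iota t r != 0 /\
  x = evalp iota t p / evalp iota t r.

Lemma adjoin_evalp p : adjoin (evalp iota t p).
Proof. by exists p, 1; rewrite rmorph1 oner_neq0 divr1. Qed.

Lemma adjoin_base c : adjoin (iota c).
Proof. by rewrite -(evalpC iota t); apply: adjoin_evalp. Qed.

Lemma adjoin_gen : adjoin t.
Proof. by rewrite -{1}(evalpX iota t); apply: adjoin_evalp. Qed.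

Lemma adjoin_subfield : is_subfield adjoin.
Proof.
split=> [|_ _ [p [r [r0 ->]]] [p' [r' [r'0 ->]]]|_ _ [p [r [r0 ->]]] [p' [r' [r'0 ->]]]].
- by rewrite -(rmorph1 iota); apply: adjoin_base.
- exists (p * r' - p' * r), (r * r'); rewrite rmorphB !rmorphM mulf_neq0 //; split=> //.
  by field; rewrite r0 r'0.
have [p'0|p'0] := eqVneq (evalp iota t p') 0.
  exists 0, 1; rewrite p'0 mul0r invr0 mulr0 rmorph0 rmorph1 oner_neq0.
  by rewrite mul0r.
exists (p * r'), (r * p'); rewrite !rmorphM mulf_neq0 //; split=> //.
by field; rewrite r0 r'0 p'0.
Qed.

Lemma adjoin_common n (x : nat -> K) : (forall i, adjoin (x i)) ->
  exists (p : nat -> {poly k}) r, evalp iota t r != 0 /\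
    forall i, (i < n)%N -> evalp iota t r * x i = evalp iota t (p i).
Proof.
move=> hx; elim: n => [|n [p [r [r0 IH]]]].
  by exists (fun=> 0), 1; rewrite rmorph1 oner_neq0.
have [p' [r' [r'0 xE]]] := hx n.
exists (fun i => if i == n then r * p' else r' * p i), (r * r').
rewrite rmorphM mulf_neq0 //; split=> // i; rewrite ltnS leq_eqVlt.
case: eqVneq => [->|ne] /= => [_|lt]; first by rewrite xE rmorphM; field.
by rewrite rmorphM /= -IH //; ring.
Qed.

End Adjoin.

Section Maximal.
Variables (F : fieldType) (j : {rmorphism F -> K}) (x0 : K).

Definition admissible (A : K -> Prop) :=
  [/\ is_subfield A, forall c, A (j c) & transcendental A x0].

Lemma range_subfield : is_subfield (fun x => exists c, x = j c).
Proof.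
split=> [|_ _ [c ->] [d ->]|_ _ [c ->] [d ->]]; first by exists 1; rewrite rmorph1.
  by exists (c - d); rewrite rmorphB.
by exists (c / d); rewrite fmorph_div.
Qed.

Lemma maximal_admissible : transcendental (fun x => exists c, x = j c) x0 ->
  exists A, admissible A /\
    forall B, admissible B -> (forall x, A x -> B x) -> forall x, B x -> A x.
Proof.
move=> j_tr.
pose P (A : classical_sets.set K) := (forall x, ~ A x) \/ admissible A.
have [|A [PA Amax]] := @classical_sets.Zorn_bigcup K P.
  move=> C CP Ctot; set U := classical_sets.bigcup _ _.
  have UP x : U x <-> exists2 X, C X & X x by split=> [[X]|[X]]; exists X.
  have [[X0 CX0 X0ne]|ne] := pselect (exists2 X, C X & exists x, X x); last first.
    by left=> x /UP[X CX Xx]; apply: ne; exists X => //; exists x.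
  right; have adm X x : C X -> X x -> admissible X.
    by move=> CX Xx; case: (CP X CX) => // nX; case: (nX x).
  have [z0 X0z] := X0ne; have [[X01 _ _] X0j _] := adm _ _ CX0 X0z.
  have two x y : U x -> U y -> exists X, [/\ C X, X x, X y & admissible X].
    move=> /UP[X CX Xx] /UP[Y CY Yy]; case: (Ctot X Y CX CY) => h.
      by exists Y; split=> //; [apply: h | apply: adm Yy].
    by exists X; split=> //; [apply: h | apply: adm Xx].
  split.
  - split=> [|x y hx hy|x y hx hy]; first by apply/UP; exists X0.
      by have [X [CX Xx Xy [[_ XB _] _ _]]] := two x y hx hy; apply/UP; exists X => //; apply: XB.
    by have [X [CX Xx Xy [[_ _ XD] _ _]]] := two x y hx hy; apply/UP; exists X => //; apply: XD.
  - by move=> c; apply/UP; exists X0.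
  move=> p hp px0.
  have [X [CX Xp aX]] : exists X, [/\ C X, forall i, (i < size p)%N -> X p`_i & admissible X].
    elim: (size p) => [|n [X [CX Xp aX]]]; first by exists X0; split=> //; apply: adm X0z.
    have /UP[Y CY Yp] := hp n; case: (Ctot X Y CX CY) => h.
      exists Y; split=> //; last exact: adm Yp.
      by move=> i; rewrite ltnS leq_eqVlt => /predU1P[->//|/Xp/h].
    exists X; split=> // i; rewrite ltnS leq_eqVlt => /predU1P[->|/Xp//]; exact: h.
  case: aX => hX _; apply=> // i; have [/Xp//|le] := ltnP i (size p).
  by rewrite nth_default //; apply: subring0; apply: is_subfield_ring.
have adj : admissible (fun x => exists c, x = j c).
  by split=> //; [exact: range_subfield | move=> c; exists c].
have aA : admissible A.
  case: PA => // A0; exfalso; apply: (Amax (fun x => exists c, x = j c)); last by right.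
  by split=> [x /A0//|h]; apply: (A0 1); apply: h; exists 1; rewrite rmorph1.
exists A; split=> // B aB AB x Bx; apply: contrapT => nAx.
by apply: (Amax B); [split=> // h; apply: nAx; apply: h | right].
Qed.

Variable A : K -> Prop.
Hypothesis A_adm : admissible A.
Hypothesis A_max : forall B, admissible B -> (forall x, A x -> B x) -> forall x, B x -> A x.

Let A_sub : is_subfield A. Proof. by case: A_adm. Qed.
Let k := subfield_type (to_subfield A_sub).
Let iota : {rmorphism k -> K} := @sf_val K (to_subfield A_sub).

Lemma evalp_transcendental p : evalp iota x0 p = 0 -> p = 0.
Proof.
move=> hp; have [_ _ A_tr] := A_adm.
have /A_tr h : forall i, A (map_poly iota p)`_i by move=> i; rewrite coef_map; apply: sf_valP.
by apply/eqP; rewrite -(map_poly_eq0 iota) h.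
Qed.

Lemma adjoin_not_transcendental y : ~ A y -> exists p : {poly K},
  [/\ p != 0, forall i, adjoin iota y p`_i & p.[x0] = 0].
Proof.
move=> nAy; apply: contrapT => np; apply: nAy.
apply: (A_max (B := adjoin iota y)).
- split; first exact: adjoin_subfield.
    move=> c; have [_ Aj _] := A_adm; rewrite -(sub_inE A_sub (Aj c)).
    exact: (adjoin_base iota).
  move=> p hp px0; apply/eqP; apply: contrapT => /negP p0; apply: np.
  by exists p.
- by move=> x Ax; rewrite -(sub_inE A_sub Ax); apply: (adjoin_base iota).
exact: adjoin_gen.
Qed.

(** If y were outside A, then x0 would be algebraic over A(y) by maximality, hence over A by
    transitivity. *)
Lemma maximal_algebraically_closed y : algebraicOver iota y -> A y.
Proof.
move=> y_alg; apply: contrapT => nAy.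
have [p [p0 hp px0]] := adjoin_not_transcendental nAy.
have: integralOver iota x0.
  apply: (integral_root p0); first exact/rootP.
  apply/integral_poly => i; have [a [b [_ ->]]] := hp i.
  have ev_int a' : integralOver iota (evalp iota y a').
    apply: integral_horner; last exact/integral_algebraic.
    by apply/integral_poly => l; rewrite coef_map; apply: integral_id.
  by apply: integral_div.
move=> /integral_algebraic[r r0 /rootP rx0].
by move/eqP: r0; apply; apply: evalp_transcendental.
Qed.

Let E := to_subfield (adjoin_subfield iota x0).

(** The exchange argument: for y outside A, a relation for x0 over A(y), cleared of denominators and
    sorted by powers of y, is a relation for y over A[x0]. *)
Lemma algebraic_over_adjoin y : algebraicOver (@sf_val K E) y.
Proof.
have inE x : adjoin iota x0 x -> exists e : subfield_type E, x = sf_val e.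
  by move=> hx; exists (sub_in (adjoin_subfield iota x0) hx).
have [Ay|nAy] := pselect (A y).
  have [e ->] : exists e : subfield_type E, y = sf_val e.
    by apply: inE; rewrite -(sub_inE A_sub Ay); apply: (adjoin_base iota).
  exact: algebraic_id.
have [p [p0 hp px0]] := adjoin_not_transcendental nAy.
have [Q [r [r0 QE]]] := adjoin_common (size p) hp.
pose N := \max_(i < size p) size (Q i).
have sQ i : (i < size p)%N -> (size (Q i) <= N)%N.
  by move=> lt; apply: (leq_bigmax (Ordinal lt)).
pose R l : {poly k} := \poly_(i < size p) (Q i)`_l.
have /choice[e eP] l := inE _ (adjoin_evalp iota x0 (R l)).
exists (\poly_(l < N) e l).
  apply/eqP => h0.
  have R0 l : R l = 0.
    have [lt|le] := ltnP l N; last first.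
      apply/polyP => i; rewrite coef_poly coef0; case: ifP => // lt.
      by rewrite nth_default // (leq_trans (sQ _ lt)).
    apply: evalp_transcendental; rewrite eP.
    by have /polyP/(_ l) := h0; rewrite coef_poly lt coef0 => ->; rewrite rmorph0.
  have lt_p : ((size p).-1 < size p)%N by rewrite prednK // size_poly_gt0.
  have Qp0 : Q (size p).-1 = 0.
    apply/polyP => l; have /polyP/(_ (size p).-1) := R0 l.
    by rewrite coef_poly lt_p !coef0.
  have := QE _ lt_p; rewrite Qp0 rmorph0 => /eqP; rewrite mulf_eq0 (negbTE r0) /=.
  by rewrite -lead_coefE lead_coef_eq0 (negbTE p0).
apply/rootP; rewrite (@horner_coef_wide _ N); last by rewrite size_map_poly size_poly.
transitivity (\sum_(l < N) \sum_(i < size p) iota (Q i)`_l * x0 ^+ i * y ^+ l).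
  apply: eq_bigr => l _; rewrite coef_map coef_poly ltn_ord /= -eP.
  rewrite (@evalp_wide _ _ _ (size p)) ?size_poly // mulr_suml; apply: eq_bigr => i _.
  by rewrite coef_poly ltn_ord.
rewrite exchange_big /=.
transitivity (evalp iota y r * p.[x0]); last by rewrite px0 mulr0.
rewrite horner_coef mulr_sumr; apply: eq_bigr => i _.
rewrite mulrA QE // (@evalp_wide _ _ _ N) ?sQ // mulr_suml; apply: eq_bigr => l _.
by rewrite mulrAC.
Qed.

Lemma adjoin_degree_bound : finitely_generated_extension j ->
  exists n, forall x : K, exists p : nat -> {poly k},
    (exists2 l, (l < n.+1)%N & p l != 0) /\
    \sum_(l < n.+1) evalp iota x0 (p l) * x ^+ l = 0.
Proof.
move=> [s s_gen].
have [||n nP] := @fin_gen_degree_bound _ K (@sf_val K E) s.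
- by move=> x _; apply: algebraic_over_adjoin.
- move=> S hS SE Ss; apply: s_gen => // a.
  have [_ Aj _] := A_adm.
  have hx : adjoin iota x0 (j a).
    by rewrite -(sub_inE A_sub (Aj a)); apply: (adjoin_base iota).
  exact: (SE (sub_in (adjoin_subfield iota x0) hx)).
exists n => x; have [c [[l lt_l cl] hc]] := nP x.
have [p [r [r0 pE]]] := adjoin_common n.+1 (fun i => sf_valP (c i)).
exists p; split.
  exists l => //; apply: contraNneq cl => pl0; have := pE l lt_l.
  rewrite pl0 rmorph0 => /eqP; rewrite mulf_eq0 (negbTE r0) /= => h.
  by rewrite -(fmorph_eq0 (@sf_val K E)).
transitivity (evalp iota x0 r * \sum_(l < n.+1) @sf_val K E (c l) * x ^+ l).
  by rewrite mulr_sumr; apply: eq_bigr => i _; rewrite mulrA pE.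
by rewrite hc mulr0.
Qed.

End Maximal.

End Subfields.

(** * The filtration of K *)

Section Enumeration.
Variables (F : countClosedFieldType) (K : fieldType) (j : {rmorphism F -> K}).

(** Trees encode field expressions: labels 0 and 1 with two children are subtraction and division,
    and label i + 2 is the generator s_i. Countability of trees over F thus passes to K. *)
Fixpoint term_value (s : seq K) (t : GenTree.tree F) : K :=
  match t with
  | GenTree.Leaf a => j a
  | GenTree.Node 0 [:: t1; t2] => term_value s t1 - term_value s t2
  | GenTree.Node 1 [:: t1; t2] => term_value s t1 / term_value s t2
  | GenTree.Node n _ => s`_n.-2
  end.

Lemma countable_extension : finitely_generated_extension j ->
  exists xs : nat -> K, forall x, exists m, x = xs m.
Proof.
move=> [s s_gen]; exists (fun n => if unpickle n is Some t then term_value s t else 0) => x.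
suff [t ->] : exists t, x = term_value s t by exists (pickle t); rewrite pickleK.
suff: x \in [pred y | `[< exists t, y = term_value s t >]] by move=> /asboolP.
apply: s_gen => [|a|y ys]; last 2 first.
- by apply/asboolP; exists (GenTree.Leaf a).
- by apply/asboolP; exists (GenTree.Node (index y s).+2 [::]); rewrite /= nth_index.
split=> [|y z /asboolP[t ->] /asboolP[u ->]|y z /asboolP[t ->] /asboolP[u ->]]; apply/asboolP.
- by exists (GenTree.Leaf 1); rewrite /= rmorph1.
- by exists (GenTree.Node 0 [:: t; u]).
- by exists (GenTree.Node 1 [:: t; u]).
Qed.

End Enumeration.

Lemma mmap_subring (k K : fieldType) (j : {rmorphism k -> K}) n (t : n.-tuple K) (S : K -> Prop) P : is_subring S ->
  (forall c, S (j c)) -> (forall y, y \in t -> S y) -> S (mpoly.mmap j (tnth t) P).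
Proof.
move=> hS Sj St; have [S1 SB SM] := hS; rewrite /mpoly.mmap.
elim/big_ind: _ => [|x y|m _]; [exact: subring0 | exact: subringD |].
apply: (SM) => //; rewrite /mpoly.mmap1; elim/big_ind: _ => // i _.
by apply: subringX => //; apply/St/mem_tnth.
Qed.

Section GlobalFiltration.
Variables (F : closedFieldType) (K : fieldType) (j : {rmorphism F -> K}).
Variable q : nat.
Hypothesis q_gt1 : (1 < q)%N.
Hypothesis frob : forall x y : K, (x + y) ^+ q = x ^+ q + y ^+ q.
Hypothesis K_fingen : finitely_generated_extension j.
Variable xs : nat -> K.
Hypothesis xs_surj : forall x, exists m, x = xs m.

(** Level 0 is only required to lie between F and A, so that filtrations can be intersected. *)
Definition filtered_over (A : K -> Prop) := exists W : nat -> K -> Prop,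
  [/\ forall N x y, W N x -> W N y -> W N (x + y),
      forall N c x, W N x -> W N (j c * x),
      forall N x, W N x -> W N.+1 x,
      forall x, exists N, W N x
    & forall N x, W N.+1 (x ^+ q) -> W N x] /\
  (forall x, W 0%N x -> A x) /\ (forall c, W 0%N (j c)).

Lemma filtered_overI A B : filtered_over A -> filtered_over B ->
  filtered_over (fun x => A x /\ B x).
Proof.
move=> [W [[WD WZ WS Wall Wf] [W0 Wj]]] [W' [[WD' WZ' WS' Wall' Wf'] [W0' Wj']]].
exists (fun N x => W N x /\ W' N x); split; last split.
- split.
  + by move=> N x y [h1 h2] [h1' h2']; split; [exact: WD | exact: WD'].
  + by move=> N c x [h1 h2]; split; [exact: WZ | exact: WZ'].
  + by move=> N x [h1 h2]; split; [exact: WS | exact: WS'].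
  + move=> x; have [N hN] := Wall x; have [N' hN'] := Wall' x.
    have mono (V : nat -> K -> Prop) M M' z : (forall N x, V N x -> V N.+1 x) ->
        (M <= M')%N -> V M z -> V M' z.
      by move=> VS /subnKC <-; elim: (M' - M)%N => [|m IH] hz; rewrite ?addn0 // addnS; apply/VS/IH.
    by exists (maxn N N'); split; [apply: mono hN; rewrite ?leq_maxl | apply: mono hN'; rewrite ?leq_maxr].
  + by move=> N x [h1 h2]; split; [exact: Wf | exact: Wf'].
- by move=> x [h1 h2]; split; [exact: W0 | exact: W0'].
- by [].
Qed.

Lemma range_transcendental x0 : ~ (exists c, x0 = j c) ->
  transcendental (fun x => exists c, x = j c) x0.
Proof.
move=> nx0 p /choice[f fP] px0; apply/eqP; apply: contrapT => /negP p0; apply: nx0.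
have pE : p = map_poly j (\poly_(i < size p) f i).
  apply/polyP => i; rewrite coef_map coef_poly.
  by case: ltnP => [_|le] /=; [exact: fP | rewrite rmorph0 nth_default].
apply: (@algebraic_in_closed _ _ j x0 (\poly_(i < size p) f i)).
  by rewrite -(map_poly_eq0 j) -pE.
by apply/rootP; rewrite -pE.
Qed.

Lemma separating_filtration x0 : ~ (exists c, x0 = j c) ->
  exists A, admissible j x0 A /\ filtered_over A.
Proof.
move=> /range_transcendental/maximal_admissible[A [A_adm A_max]].
exists A; split=> //.
have [n nP] := adjoin_degree_bound A_adm A_max K_fingen.
have tr := @evalp_transcendental _ _ _ _ _ A_adm.
have [W [[WD WZ WS Wall Wf] [W0 Wj]]] := curve_filtration tr q_gt1 frob nP xs_surj.
have [A_sub Aj _] := A_adm.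
exists W; split; [split=> // N c x h | split=> [x /W0|c]].
- have [a ->] : exists a : subfield_type (to_subfield (let: And3 h _ _ := A_adm in h)), j c = sf_val a.
    by exists (sub_in _ (Aj c)).
  exact: WZ.
- exact: (maximal_algebraically_closed A_max).
- have [a ->] : exists a : subfield_type (to_subfield (let: And3 h _ _ := A_adm in h)), j c = sf_val a.
    by exists (sub_in _ (Aj c)).
  exact: Wj.
Qed.

(** If A is larger than F, pick x0 in A outside F and a filtered B over which x0 is transcendental.
    Induction applies to the intersection of A and B, and x0 prolongs any independent family found
    there. *)
Lemma filtered_or_independent m (A : K -> Prop) : is_subfield A ->
  (forall c, A (j c)) -> filtered_over A ->
  filtered_over (fun x => exists c, x = j c) \/
  exists t : m.-tuple K, algebraically_independent j t /\ forall y, y \in t -> A y.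
Proof.
elim: m A => [|m IH] A hA Aj fA; first by right; exists [tuple]; split=> //; apply: indep_nil.
have [Aj'|/existsNP[x0 /not_implyP[Ax0 nx0]]] :=
    pselect (forall x, A x -> exists c, x = j c).
  by left; have [W [h [W0 Wj]]] := fA; exists W; split=> //; split=> // x /W0/Aj'.
have [B [[hB Bj B_tr] fB]] := separating_filtration nx0.
have hAB : is_subfield (fun x => A x /\ B x).
  case: hA hB => A1 AB AD [B1 BB BD]; split=> // x y [h1 h2] [h3 h4].
    by split; [exact: AB | exact: BB].
  by split; [exact: AD | exact: BD].
have [|//|[t [t_ind tAB]]] := IH _ hAB _ (filtered_overI fA fB).
- by move=> c; split.
- by left.
right; have [|t' [t'_ind t'P]] := indep_rcons (x := x0) t_ind.
  move=> Q hQ; apply: B_tr => i; have [P ->] := hQ i.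
  apply: mmap_subring => //; first exact: is_subfield_ring.
  by move=> y /tAB[].
by exists t'; split=> // y /t'P[->|/tAB[]].
Qed.

Lemma global_filtration d : has_transcendence_degree j d ->
  filtered_over (fun x => exists c, x = j c).
Proof.
move=> [_ max_d].
have [||h|[t [/max_d]]] := @filtered_or_independent d.+1 (fun=> True) _ (fun=> I).
- by split.
- by exists (fun _ _ => True); split; [split=> // x; exists 0%N | split].
- exact: h.
by rewrite ltnn.
Qed.

End GlobalFiltration.

Lemma transcendence_degree_nontrivial (F K : fieldType) (j : {rmorphism F -> K}) d :
  has_transcendence_degree j d -> (0 < d)%N -> exists z, ~ exists c, z = j c.
Proof.
move=> [[t t_ind] _] d0; exists (tnth t (Ordinal d0)) => -[c tc].
have := t_ind ('X_(Ordinal d0) - c%:MP); rewrite mpoly.mmapB mpoly.mmapC mpoly.mmapX.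
rewrite mpoly.mmap1U tc subrr => /(_ erefl) /(congr1 (fun P => mpoly.mcoeff U_(Ordinal d0)%MM P)).
rewrite mpoly.mcoeffB mpoly.mcoeffX mpoly.mcoeffC mpoly.mcoeff0 eqxx mpoly.mnm1_eq0 mulr0 subr0.
by move/eqP; rewrite oner_eq0.
Qed.

(** * Drinfeld modules *)

Section RingAwayFrom.
Variables (Fq : finFieldType) (k : fieldType) (c : {rmorphism Fq -> k}).
Variable oo : {pred k}.
Local Notation A := (ring_away_from c oo).

Definition ring_val : A -> k := val.
HB.instance Definition _ := GRing.RMorphism.on ring_val.

Lemma ring_val_inj : injective ring_val.
Proof. exact: val_inj. Qed.

(** If 1/y lies in O, dividing the equation by y^(d-1) expresses y through the coefficients and
    powers of 1/y. *)
Lemma valuation_ring_integrally_closed (O : {pred k}) y (p : {poly k}) :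
  closed_point c O -> p \is monic -> (forall i, p`_i \in O) -> root p y -> y \in O.
Proof.
move=> [[O1 OB OM] Oc _ Ov] pm pO /rootP py.
have /orP[//|yO] := Ov y.
have [->|y0] := eqVneq y 0; first by rewrite -(rmorph0 c).
have O0 : 0 \in O by rewrite -(subrr 1); apply: OB.
have OD a b : a \in O -> b \in O -> a + b \in O.
  by move=> ha hb; rewrite -[b]opprK; apply: (OB) => //; rewrite -[- b]add0r; apply: OB.
have OX m : y^-1 ^+ m \in O by elim: m => [|m IH] //; rewrite exprS; apply: OM.
pose d := (size p).-1.
have sd : size p = d.+1 by rewrite prednK // size_poly_gt0 monic_neq0.
have d0 : (0 < d)%N.
  rewrite lt0n; apply: contra_eqN (py) => /eqP d0.
  rewrite (size1_polyC (_ : size p <= 1)%N) ?sd ?d0 // hornerC.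
  by move: (monicP pm); rewrite lead_coefE sd d0 /= => ->; rewrite oner_eq0.
have lead : p`_d = 1 by rewrite -(monicP pm) lead_coefE.
have yE : y = - \sum_(i < d) p`_i * y^-1 ^+ (d.-1 - i).
  have yd0 : y ^+ d.-1 != 0 by rewrite expf_neq0.
  apply: (mulfI yd0); rewrite -exprSr prednK // mulrN mulr_sumr.
  apply/eqP; rewrite eq_sym -subr_eq0 -opprD oppr_eq0 -[X in _ == X]py.
  rewrite (horner_coef_wide _ (_ : size p <= d.+1)%N) ?sd // big_ord_recr /= lead mul1r.
  apply/eqP; congr (_ + _); apply: eq_bigr => i _.
  rewrite mulrCA; congr (_ * _).
  have le : (i <= d.-1)%N by rewrite -ltnS prednK.
  have -> : y ^+ d.-1 = y ^+ i * y ^+ (d.-1 - i) by rewrite -exprD subnKC.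
  by rewrite -mulrA -exprMn divff // expr1n mulr1.
rewrite yE -sub0r; apply: (OB) => //.
by elim/big_ind: _ => // i _; apply: OM.
Qed.

Lemma ring_away_from_closed y : integralOver ring_val y -> exists a, y = ring_val a.
Proof.
move=> [p pm py]; suff hy : y \in regular_away_from c oo by exists (exist _ y hy).
apply/asboolP => O hO neO.
apply: (valuation_ring_integrally_closed hO _ _ py); first exact: monic_map.
move=> i; rewrite coef_map; have /asboolP hx := valP p`_i; exact: hx.
Qed.

Lemma ring_away_from_const x : exists a, ring_val a = c x.
Proof.
suff hx : c x \in regular_away_from c oo by exists (exist _ (c x) hx).
by apply/asboolP => O [_ Oc _ _] _; apply: Oc.
Qed.

End RingAwayFrom.

(** * Injectivity of phi *)

Section Injectivity.
Variables (Fq : finFieldType) (k : fieldType) (c : {rmorphism Fq -> k}).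
Variables (A : comNzRingType) (v : {rmorphism A -> k}).
Hypothesis v_inj : injective v.
Hypothesis v_const : forall x, exists a, v a = c x.
Variables (F : closedFieldType) (g : {rmorphism Fq -> F}).
Variable phi : {rmorphism A -> twisted_poly g}.
Variables (T : A) (r : nat).
Hypotheses (r_gt0 : (0 < r)%N) (size_T : tau_size (phi T) = r.+1).

(** A nonzero constant is a unit of A, so its image is a unit of D, and units of D have degree 0. *)
Lemma phi_const_size x a : x != 0 -> v a = c x -> tau_size (phi a) = 1%N.
Proof.
move=> x0 ax; have [b bx] := v_const x^-1.
have ab : a * b = 1 by apply: v_inj; rewrite rmorphM ax bx -rmorphM divff // !rmorph1.
have /(congr1 (@tau_size _ _ g)) : phi a * phi b = 1 by rewrite -rmorphM ab rmorph1.
have a0 : phi a != 0.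
  by apply/eqP => h; move/eqP: (oner_neq0 (twisted_poly g)); rewrite -(rmorph1 phi) -ab rmorphM h mul0r.
have b0 : phi b != 0.
  by apply/eqP => h; move/eqP: (oner_neq0 (twisted_poly g)); rewrite -(rmorph1 phi) -ab rmorphM h mulr0.
rewrite tau_sizeM // tau_size1; move: a0 b0; rewrite -!tau_size_gt0.
by case: (tau_size (phi a)) (tau_size (phi b)) => [|[|m]] [|l] //=; rewrite addnS.
Qed.

(** The images of the T^i have distinct degrees i r and nonzero constants do not change them, so the
    leading term of P(T) survives under phi. *)
Lemma kernel_poly (P : {poly Fq}) a : v a = (map_poly c P).[v T] -> phi a = 0 -> P = 0.
Proof.
move=> aP pa0; apply/eqP; apply: contrapT => /negP P0.
have /choice[cA cAP] := v_const.
have aE : a = \sum_(i < size P) cA P`_i * T ^+ i.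
  apply: v_inj; rewrite aP rmorph_sum (@horner_coef_wide _ (size P)); last exact: size_poly.
  by apply: eq_bigr => i _; rewrite coef_map rmorphM rmorphXn cAP.
pose n := (size P).-1; have sP : size P = n.+1 by rewrite prednK // size_poly_gt0.
have : tau_coef (phi a) (n * r) = 0 by rewrite pa0 tau_coef0.
have ph0 m : phi (T ^+ m) != 0.
  by rewrite -tau_size_gt0 (size_TX size_T).
rewrite aE sP big_ord_recr rmorphD /= tau_coefD; set s := \sum_(i < n) _.
have -> : tau_coef (phi s) (n * r) = 0.
  apply: tau_coef_out; rewrite /s rmorph_sum /=.
  elim/big_ind: _ => [|x y hx hy|i _]; first by rewrite tau_size0.
    by rewrite (leq_trans (tau_sizeD _ _)) // geq_max hx.
  rewrite rmorphM; apply: (@leq_trans (i * r).+1); last first.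
    apply: (@leq_trans (i.+1 * r)); last by rewrite leq_mul2r ltn_ord orbT.
    by rewrite mulSn -add1n leq_add2r.
  rewrite -(size_TX size_T); apply: (@tau_sizeM_leq _ _ _ _ _ 0) => //.
  have [p0|p0] := eqVneq P`_i 0; last by rewrite (phi_const_size p0 (cAP _)).
  by rewrite p0 (_ : cA 0 = 0) ?rmorph0 ?tau_size0 //; apply: v_inj; rewrite cAP !rmorph0.
rewrite add0r rmorphM -[(n * r)%N]add0n => /eqP.
have lP0 : P`_n != 0 by rewrite -lead_coefE lead_coef_eq0.
have sc := phi_const_size lP0 (cAP _).
rewrite tau_coefM_top ?sc ?(size_TX size_T) // mulf_eq0 fmorph_eq0.
have := @tau_lead_neq0 _ _ _ (phi (cA P`_n)).
have := @tau_lead_neq0 _ _ _ (phi (T ^+ n)).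
rewrite -!tau_size_gt0 sc (size_TX size_T) /=.
by move=> /(_ isT)/negbTE -> /(_ isT)/negbTE ->.
Qed.

(** A nonzero b in the kernel would be algebraically independent of T. In a relation for b over
    Fq[T], the constant term is a multiple of b, so phi kills it and it vanishes by [kernel_poly];
    then b can be cancelled. This contradicts transcendence degree 1. *)
Lemma drinfeld_injective : has_transcendence_degree c 1 -> injective phi.
Proof.
move=> [_ max1]; suff ker b : phi b = 0 -> b = 0.
  by move=> x y h; apply/eqP; rewrite -subr_eq0 [_ - _]ker ?eqxx // rmorphB h subrr.
move=> pb0; apply: contrapT => /eqP b0.
have /choice[cA cAP] := v_const.
pose S x := exists (P : {poly Fq}), x = (map_poly c P).[v T].
have hS : is_subring S.
  split=> [|_ _ [P ->] [Q ->]|_ _ [P ->] [Q ->]].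
  - by exists 1; rewrite rmorph1 hornerC.
  - by exists (P - Q); rewrite rmorphB hornerD hornerN.
  - by exists (P * Q); rewrite rmorphM hornerM.
have SA x : S x -> exists a, x = v a.
  move=> [P ->]; exists (\sum_(i < size P) cA P`_i * T ^+ i).
  rewrite rmorph_sum (@horner_coef_wide _ (size P)); last exact: size_poly.
  by apply: eq_bigr => i _; rewrite coef_map rmorphM rmorphXn cAP.
have Sc x : S (c x) by exists x%:P; rewrite map_polyC hornerC.
have [|t1 [t1_ind t1P]] := @indep_rcons _ _ c _ _ (v T) (@indep_nil _ _ c).
  move=> Q hQ QT; have /choice[f fP] i : exists x, Q`_i = c x.
    by have [P ->] := hQ i; rewrite [P]nvar0_mpolyC mpoly.mmapC; eexists.
  have QE : Q = map_poly c (\poly_(i < size Q) f i).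
    apply/polyP => i; rewrite coef_map coef_poly.
    by case: ltnP => [_|le] /=; [exact: fP | rewrite rmorph0 nth_default].
  rewrite QE (@kernel_poly (\poly_(i < size Q) f i) 0) ?rmorph0 //.
  by rewrite -QE QT.
have [|t2 [/max1]] := @indep_rcons _ _ c _ _ (v b) t1_ind; last by rewrite ltnn.
move=> Q hQ; have {}hQ i : S Q`_i.
  have [P ->] := hQ i; apply: mmap_subring => // y /t1P[->|//].
  by exists 'X; rewrite map_polyX hornerX.
have [n] := ubnP (size Q); elim: n Q hQ => // n IH Q hQ; rewrite ltnS => sQ Qb.
pose Q1 := \poly_(i < (size Q).-1) Q`_i.+1.
have [->//|Q_neq0] := eqVneq Q 0.
have QE : Q = Q1 * 'X + (Q`_0)%:P.
  apply/polyP => i; rewrite coefD coefMX coefC coef_poly; case: i => [|i]; first by rewrite add0r.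
  rewrite addr0 /=; case: ltnP => // le; rewrite nth_default //.
  by rewrite (leq_trans (leqSpred _)).
have hQ1 i : S Q1`_i.
  by rewrite coef_poly; case: ifP => _ //; apply: subring0.
have /choice[a aP] i := SA _ (hQ1 i).
have [a0 a0P] := SA _ (hQ 0%N).
have Q1b : Q1.[v b] = v (\sum_(i < size Q1) a i * b ^+ i).
  rewrite horner_coef rmorph_sum; apply: eq_bigr => i _.
  by rewrite rmorphM rmorphXn -aP.
have a0E : a0 = - (\sum_(i < size Q1) a i * b ^+ i) * b.
  apply: v_inj; rewrite rmorphM rmorphN -Q1b -a0P; apply/eqP; rewrite mulNr -addr_eq0 addrC.
  by rewrite -[X in _ == X]Qb [in X in _ == X]QE hornerMXaddC.
have Q00 : Q`_0 = 0.
  have [P0 hP0] := hQ 0%N; rewrite hP0 (@kernel_poly P0 a0) ?rmorph0 ?horner0 //.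
    by rewrite -a0P.
  by rewrite a0E rmorphM pb0 mulr0.
have Q10 : Q1 = 0.
  apply: IH => //.
    by apply: leq_trans sQ; rewrite -[size Q]prednK ?size_poly_gt0 // ltnS size_poly.
  move: Qb; rewrite QE hornerMXaddC Q00 addr0 => /eqP; rewrite mulf_eq0.
  by rewrite -(rmorph0 v) (inj_eq v_inj) (negbTE b0) orbF rmorph0 => /eqP.
by rewrite QE Q10 Q00 mul0r add0r.
Qed.

End Injectivity.

Theorem mainTheorem7
  (p e : nat) (p_prime : prime p) (e_gt0 : (0 < e)%N)
  (Fq : finFieldType) (card_Fq : #|Fq| = (p ^ e)%N)
  (k : fieldType) (c : {rmorphism Fq -> k})
  (k_curve : function_field_of_curve c)
  (oo : {pred k}) (oo_point : closed_point c oo)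
  (F : countClosedFieldType) (charF : p \in [pchar F])
  (g : {rmorphism Fq -> F})
  (i : {rmorphism ring_away_from c oo -> F})
  (K : fieldType) (j : {rmorphism F -> K})
  (K_fingen : finitely_generated_extension j)
  (d : nat) (K_trdeg : has_transcendence_degree j d) (d_gt0 : (0 < d)%N)
  (phi : {rmorphism ring_away_from c oo -> twisted_poly g})
  (phi_drinfeld : drinfeld_module i phi) :
  exists M : {pred drinfeld_points phi j},
    internal_direct_sum (constant_points phi j) M /\ free_of_rank_aleph0 M.
Proof.
have [T [r [r_gt0 size_T]]] : exists T r, (0 < r)%N /\ tau_size (phi T) = r.+1.
  have [_ /existsNP[T /negP]] := phi_drinfeld; rewrite -ltnNge => hT.
  exists T, (tau_size (phi T)).-1; rewrite -ltnS prednK //; exact: ltnW.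
pose v : {rmorphism ring_away_from c oo -> k} := @ring_val _ _ c oo.
have v_inj : injective v := @ring_val_inj _ _ c oo.
have phi_inj : injective phi.
  by apply: (drinfeld_injective v_inj _ r_gt0 size_T k_curve.2) => x; apply: ring_away_from_const.
have [beta [beta_ind beta_span]] : exists beta : nat -> {poly (twisted_poly g)},
    (forall n (a : nat -> ring_away_from c oo), \sum_(l < n) phi (a l) *: beta l = 0 ->
       forall l, (l < n)%N -> a l = 0) /\
    (forall x, exists n (a : nat -> ring_away_from c oo), x = \sum_(l < n) phi (a l) *: beta l).
  apply: (A_basis phi_inj r_gt0 size_T v_inj (@ring_away_from_closed _ _ c oo)
    (* D has [{poly F}] as carrier, so countability of F yields an enumeration of [{poly D}] through
       coefficient lists. *)
    (e := fun n => if (unpickle n : option (seq {poly F})) is Some s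
                   then Poly (s : seq (twisted_poly g)) else 0)).
  by move=> x; exists (pickle (polyseq x : seq {poly F})); rewrite pickleK polyseqK.
have [xs xs_surj] := countable_extension K_fingen.
have frob (x y : K) : (x + y) ^+ #|Fq| = x ^+ #|Fq| + y ^+ #|Fq|.
  by rewrite -!(@frE Fq F g K j) rmorphD.
have [W [[WD WZ WS Wall Wf] [W0 Wj]]] :=
  global_filtration (card_gt1 Fq) frob K_fingen xs_surj K_trdeg.
have [b [b_span b_ind]] : exists b : nat -> K,
    (forall z, exists y p, z = j y + @ev Fq F g K j b p) /\
    (forall p, (exists y, @ev Fq F g K j b p = j y) -> p = 0).
  apply: (tau_basis _ xs_surj WD WZ _ WS Wall Wf).
    by move=> z; split=> [/W0//|[a ->]].
  exact: transcendence_degree_nontrivial K_trdeg d_gt0.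
pose V := drinfeld_points phi j.
pose eV p : V := @ev Fq F g K j b p.
have eV_act a p0 : a *: eV p0 = eV (phi a *: p0) by rewrite drinfeld_scaleE /eV evZ.
have eV_sum n (a : nat -> ring_away_from c oo) :
    \sum_(l < n) a l *: eV (beta l) = eV (\sum_(l < n) phi (a l) *: beta l).
  elim: n => [|n IH]; first by rewrite !big_ord0 /eV ev0.
  by rewrite !big_ord_recr /= IH /eV evD eV_act.
have eV_inj p0 : eV p0 = 0 -> p0 = 0.
  by move=> h; apply: b_ind; exists 0; rewrite rmorph0; exact: h.
pose M : {pred drinfeld_points phi j} := fun x => `[< exists p0, x = eV p0 >].
exists M; split.
  split.
  - split; first by apply/asboolP; exists 0; rewrite rmorph0.
    move=> a x y /asboolP[x' ->] /asboolP[y' ->]; apply/asboolP.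
    (* phi_a has coefficients in F, so it can be evaluated inside F and then transported along j. *)
    exists (@tau_eval Fq F g F idfun (phi a) x' + y').
    rewrite rmorphD; congr (_ + _).
    rewrite drinfeld_scaleE /tau_eval rmorph_sum; apply: eq_bigr => l _.
    by rewrite rmorphM !qpowE rmorphXn.
  - split; first by apply/asboolP; exists 0; rewrite /eV ev0.
    move=> a x y /asboolP[x' ->] /asboolP[y' ->]; apply/asboolP.
    by exists (phi a *: x' + y'); rewrite eV_act /eV evD.
  - move=> x; have [y [p0 xE]] := b_span x; exists (j y : V), (eV p0); split.
    + by apply/asboolP; exists y.
    + by apply/asboolP; exists p0.
    + exact: xE.
  - move=> x /asboolP[y xy] /asboolP[p0 xp0]; rewrite xp0 (b_ind p0) /eV ?ev0 //.
    by exists y; rewrite -xy -[LHS]/(eV p0) xp0.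
exists (fun l => eV (beta l)); split=> [n a h l|x].
  (* Ordinal-indexed coefficients are extended by 0 to all of nat, the form used for [beta]. *)
  pose a' l' := if insub l' is Some l'' then a l'' else 0.
  have a'E (l' : 'I_n) : a' l' = a l' by rewrite /a' valK.
  rewrite -a'E; apply: (beta_ind n) => //; apply: eV_inj; rewrite -eV_sum.
  by rewrite -[RHS]h; apply: eq_bigr => l' _; rewrite a'E.
split=> [/asboolP[p0 ->]|[n [a ->]]].
  have [n [a ->]] := beta_span p0; exists n, (fun l => a l).
  by rewrite eV_sum.
apply/asboolP; pose a' l' := if insub l' is Some l'' then a l'' else 0.
exists (\sum_(l < n) phi (a' l) *: beta l); rewrite -eV_sum.
by apply: eq_bigr => l' _; rewrite /a' valK.
Qed.
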